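(* Let $c_0,\delta_0>0$ and let $a\in[0,1]^{\mathbb{Z}}$ be an irreducible, aperiodic sequence. Let $\alpha\in(1/2,2/3)$. There are $C,c\in(0,+\infty)$ and $n_0\geq 1$ such that for any $n\geq n_0$ and any independent sequence $X_1,\dots,X_n$ of random variables with laws in $\mathcal{M}_{\delta_0,c_0}^a$ the following holds. For any $0\leq u,v\leq n^{\alpha}$ with $P_u(\bar S_n=v)>0$, $$P_u\bigl(\bar S_n=v,\ \min_{i=1,\dots,n}\bar S_i\geq 0\bigr)\geq\frac{C\min(u+1,\sqrt n)\min(v+1,\sqrt n)}{n^{3/2}}e^{-c(u-v)^2/n}.$$
   Context: Here $u,v$ are real. Write $\bar X_i=X_i-E(X_i)$. Under $P_u$, $\bar S_0=u$ and $\bar S_k=u+\bar X_1+\dots+\bar X_k$. $\mathcal{M}_{\mathbb{Z}}$ is the set of probability measures on $\mathbb{Z}$; $p(i)$ is the mass of $p$ at $i$. A measure $p\in\mathcal{M}_{\mathbb{Z}}$ is called irreducible (resp. aperiodic) if the random walk on $\mathbb{Z}$ with i.i.d. steps of law $p$ is an irreducible (resp. aperiodic) Markov chain. A sequence $a=(a_i)_{i\in\mathbb{Z}}\in[0,1]^{\mathbb{Z}}$ is irreducible and aperiodic if there are an irreducible and aperiodic $p\in\mathcal{M}_{\mathbb{Z}}$ and numbers $b_i>0$, $i\in\mathbb{Z}$, with $a_i=b_ip(i)$ for all $i$. For $\delta,c>0$, $$\mathcal{M}_{\delta,c}^a=\Bigl\{p\in\mathcal{M}_{\mathbb{Z}}:\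 \sup_{|t|\leq\delta}\sum_{k\in\mathbb{Z}}p(k)e^{tk}\leq c,\ p(i)\geq a_i\ \forall i\in\mathbb{Z}\Bigr\}.$$ *)

(* Defs.v *)
From HB Require Import structures.
From mathcomp Require Import all_boot all_order all_algebra.
From mathcomp Require Import all_classical all_reals all_analysis.

Set Implicit Arguments.
Unset Strict Implicit.
Unset Printing Implicit Defensive.
Import Order.TTheory GRing.Theory Num.Theory.
Import numFieldNormedType.Exports.

Local Open Scope classical_set_scope.
Local Open Scope ring_scope.

(* The integers carry the discrete sigma-algebra, as nat does in the library,
   so that M_Z is the type [probability int R]. *)
HB.instance Definition _ := isPointed.Build int 0.
HB.instance Definition _ := @isMeasurable.Build default_measure_display
  int discrete_measurable discrete_measurable0
  discrete_measurableC discrete_measurableU.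

Section MarkovChain.
Context {R : realType} {E : choiceType}.
Implicit Types (Q : E -> E -> \bar R) (x y : E) (n : nat).

(* n-step transition probabilities of the chain with transition matrix Q *)
Fixpoint mc_step Q n x y : \bar R :=
  if n is m.+1 then \esum_(z in [set: E]) (Q x z * mc_step Q m z y)%E
  else (x == y)%:R%:E.

Definition mc_irreducible Q : Prop :=
  forall x y, exists n, (0 < mc_step Q n x y)%E.

Definition is_gcd (A : set nat) (g : nat) : Prop :=
  (forall k, A k -> (g %| k)%N) /\
  (forall d, (forall k, A k -> (d %| k)%N) -> (d %| g)%N).

Definition mc_aperiodic Q : Prop :=
  forall x, is_gcd [set k | (0 < k)%N /\ (0 < mc_step Q k x x)%E] 1.

End MarkovChain.

Section Laws.
Context {R : realType}.
Implicit Types (p : probability int R) (a : int -> R).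

Definition walk_matrix p (x y : int) : \bar R := p [set y - x].

Definition irreducible_law p : Prop := mc_irreducible (walk_matrix p).

Definition aperiodic_law p : Prop := mc_aperiodic (walk_matrix p).

Definition irreducible_aperiodic_seq a : Prop :=
  exists (p : probability int R) (b : int -> R),
    [/\ irreducible_law p, aperiodic_law p, forall i, 0 < b i &
        forall i, (a i)%:E = ((b i)%:E * p [set i])%E].

Definition law_class (delta c : R) a : set (probability int R) :=
  [set p : probability int R |
    (ereal_sup [set \esum_(k in [set: int]) (p [set k] * (expR (t * k%:~R))%:E)%E
               | t in [set t : R | `|t| <= delta]%R] <= c%:E)%E
    /\ forall i, ((a i)%:E <= p [set i])%E].

End Laws.

Section RandomVariables.
Context {d d' : measure_display} {T : measurableType d} {T' : measurableType d'}
  {R : realType} (P : probability T R).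

Definition independent_RVs (I : finType) (X : I -> {RV P >-> T'}) : Prop :=
  forall (J : {set I}) (B : I -> set T'), (forall i, measurable (B i)) ->
    P (\bigcap_(i in [set` J]) (X i @^-1` B i)) =
    (\prod_(i in J) P (X i @^-1` B i))%E.

End RandomVariables.

Section CenteredWalk.
Context {d : measure_display} {T : measurableType d} {R : realType}
  (P : probability T R).
Implicit Types (u : R) (k : nat) (w : T).

(* 'E_P is extended-real valued; [fine] only matters when the variable is not
   integrable, which the exponential moments of [law_class] exclude. *)
Definition centered (X : {RV P >-> int}) w : R :=
  (X w)%:~R - fine ('E_P[fun w' => ((X w')%:~R : R)]).

(* [X i], i : 'I_n, is the variable written X_(i+1) in 1-based notation. *)
Definition centered_walk n (X : 'I_n -> {RV P >-> int}) u k w : R :=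
  u + \sum_(i < n | (i < k)%N) centered (X i) w.

(* The minimum over 1 <= i <= n; for 0 < n the initial value of the fold is
   one of the terms. *)
Definition centered_walk_min n (X : 'I_n -> {RV P >-> int}) u w : R :=
  \big[Num.min/centered_walk X u n w]_(1 <= i < n.+1) centered_walk X u i w.

End CenteredWalk.

(* Main.v *)
From mathcomp Require Import all_boot all_order all_algebra.
From mathcomp Require Import boolp reals sequences exp.
From mathcomp Require Import ring lra zify.

(** The bound is wanted only up to constants, so no law is ever computed.
    Instead one exhibits functions that a single step of any admissible law
    does not decrease, up to an explicit factor (subsolutions of the backward
    equation), and iterates the one-step inequality along the walk. It does
    not matter then that the steps have different laws.

    Irreducibility and aperiodicity of [a] provide [N0], [eps] and a window
    such that any [N0] to [2 * N0 - 1] consecutive steps add up to each of [0],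
    [1] and [-1] with probability at least [eps], along paths inside the window
    ([seq_paths]); two distinct atoms of [a] bound the variances from below, and
    the exponential moments bound second and third moments from above. For a
    lower bound each step may be restricted to a large window, since this only
    discards trajectories ([walk_le_probability]). The steps become finitely
    supported, at the price of defects of mass and mean which are made at most
    [n ^- 2] ([regular_truncated]).

    Four estimates then give the result.

    - Local bounds for the free walk ([local_upper], [local_lower]). Each block
      of about [N0] steps contains a lazy simple step with probability [eps].
      These commute with all other steps, a positive fraction of the blocks
      provides one, and the central binomial coefficients give the order
      [1 / sqrt n].

    - Killing near the diagonal ([near_diagonal]). At a height of a large
      multiple of [sqrt m], a path of [m] steps is killed in its first half or,
      read backwards, in its second half, each time with small probability by
      Chebyshev, while the other half costs [1 / sqrt m] by the upper local
      bound. What is lost is a fraction of the lower local bound.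

    - Steering ([walk_tube], [walk_bulk]). A bump of width [w] around a moving
      centre loses a fraction of order [w ^- 2] per step as long as the speed is
      at most a small multiple of [1 / w]. To go from height [u] to height [v]
      in [n] steps, [w] may be taken of order [n / (sqrt n + `|u - v|)], which is
      large as [`|u - v|] is negligible with respect to [n]. The total loss is
      the exponential of a multiple of [1 + (u - v) ^+ 2 / n]: this is the
      Gaussian factor, for end points at heights at least of order [sqrt n].

    - Entrance ([walk_entrance]). From a height [u] below [sqrt n] the walk
      reaches height of order [sqrt n] within [n / 4] steps, before being killed,
      with probability at least a multiple of [(u + 1) / sqrt n], by comparison
      with a convex parabola.

    The entrance estimate is used at the start ([walk_up]) and, after time
    reversal ([walk_reversal]), at the end ([walk_core]). The product of the two
    entrance factors, of [1 / sqrt n] and of the Gaussian factor is the claim. *)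

Set Implicit Arguments.
Unset Strict Implicit.
Unset Printing Implicit Defensive.
Import Order.TTheory GRing.Theory Num.Theory.
Local Open Scope ring_scope.

(** * Step laws and killed walks *)

Section KilledWalks.
Context {R : realType}.

(** A finitely supported measure on the integers, as a list of weights and
    atoms, together with a centring [mu]: an atom [k] moves the walk by
    [k - mu]. Neither mass one nor mean [mu] is imposed, because truncation
    disturbs both. *)
Definition law : Type := (R * seq (R * int))%type.

Implicit Types (l : law) (s t : seq law) (G : pred R) (f g : R -> R) (x y z : R).

Definition step l f : R := \sum_(a <- l.2) a.1 * f (a.2%:~R - l.1).

Definition nneg l : Prop := forall a, a \in l.2 -> 0 <= a.1.

(** The backward semigroup of the walk killed outside [G]. The starting point
    is not tested, as the minimum in the theorem runs over times [1] to [n];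
    [G := predT] gives the free walk. *)
Fixpoint walk G s f x : R :=
  if s is l :: s' then step l (fun d => (G (x + d))%:R * walk G s' f (x + d))
  else f x.

Lemma eq_step l f g : f =1 g -> step l f = step l g.
Proof. by move=> fg; apply: eq_bigr => a _; rewrite fg. Qed.

Lemma stepD l f g : step l (fun d => f d + g d) = step l f + step l g.
Proof.
by rewrite /step -big_split /=; apply: eq_bigr => a _; rewrite mulrDr.
Qed.

Lemma stepZ l c f : step l (fun d => c * f d) = c * step l f.
Proof.
by rewrite /step big_distrr /=; apply: eq_bigr => a _; rewrite mulrCA.
Qed.

Lemma stepB l f g : step l (fun d => f d - g d) = step l f - step l g.
Proof.
rewrite -[- step l g]mulN1r -stepZ -stepD.
by apply: eq_step => d; rewrite mulN1r.
Qed.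

Lemma step_cst l c : step l (fun=> c) = c * step l (fun=> 1).
Proof. by rewrite -stepZ; apply: eq_step => d; rewrite mulr1. Qed.

Lemma le_step l f g : nneg l -> (forall d, f d <= g d) -> step l f <= step l g.
Proof.
move=> l0 fg; rewrite /step !big_seq; apply: ler_sum => a al.
by rewrite ler_wpM2l ?l0.
Qed.

Lemma step_ge0 l f : nneg l -> (forall d, 0 <= f d) -> 0 <= step l f.
Proof.
move=> l0 f0; rewrite /step big_seq; apply: sumr_ge0 => a al.
by rewrite mulr_ge0 ?l0.
Qed.

Lemma eq_walk G s f g : f =1 g -> walk G s f =1 walk G s g.
Proof.
by move=> fg; elim: s => //= l s IH x; apply: eq_step => d; rewrite IH.
Qed.

Lemma walk_cat G s t f x : walk G (s ++ t) f x = walk G s (walk G t f) x.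
Proof. by elim: s x => //= l s IH x; apply: eq_step => d; rewrite IH. Qed.

Lemma walkD G s f g x :
  walk G s (fun z => f z + g z) x = walk G s f x + walk G s g x.
Proof.
elim: s x => //= l s IH x; rewrite -stepD; apply: eq_step => d.
by rewrite IH mulrDr.
Qed.

Lemma walkZ G s c f x : walk G s (fun z => c * f z) x = c * walk G s f x.
Proof.
elim: s x => //= l s IH x; rewrite -stepZ; apply: eq_step => d.
by rewrite IH mulrCA.
Qed.

Lemma walkB G s f g x :
  walk G s (fun z => f z - g z) x = walk G s f x - walk G s g x.
Proof.
rewrite -[- walk G s g x]mulN1r -walkZ -walkD.
by apply: eq_walk => z; rewrite mulN1r.
Qed.

Lemma walk_cst G s c x : walk G s (fun=> c) x = c * walk G s (fun=> 1) x.
Proof. by rewrite -walkZ; apply: eq_walk => d; rewrite mulr1. Qed.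

Lemma walk_ge0 G s f x : (forall l, l \in s -> nneg l) ->
  (forall z, 0 <= f z) -> 0 <= walk G s f x.
Proof.
move=> + f0; elim: s x => //= l s IH x s0; apply: step_ge0 => [|d].
  by apply: s0; rewrite mem_head.
rewrite mulr_ge0 ?IH // => l' l's.
by apply: s0; rewrite inE l's orbT.
Qed.

Lemma le_walk G s f g x : (forall l, l \in s -> nneg l) ->
  (forall z, f z <= g z) -> walk G s f x <= walk G s g x.
Proof.
move=> s0 fg; rewrite -subr_ge0 -walkB; apply: walk_ge0 => // z.
by rewrite subr_ge0.
Qed.

Lemma walk_kill_le G s f x : (forall l, l \in s -> nneg l) ->
  (forall z, 0 <= f z) -> walk G s f x <= walk predT s f x.
Proof.
move=> + f0; elim: s x => //= l s IH x s0.
have s0' l' : l' \in s -> nneg l'.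
  by move=> l's; apply: s0; rewrite inE l's orbT.
apply: le_step => [|d]; first by apply: s0; rewrite mem_head.
rewrite mul1r; case: (G _); rewrite ?mul1r ?mul0r ?IH //.
exact: walk_ge0.
Qed.

Lemma walk_shift s f c x :
  walk predT s (fun z => f (z + c)) x = walk predT s f (x + c).
Proof.
elim: s x => //= l s IH x; apply: eq_step => d.
by rewrite !mul1r IH addrAC.
Qed.

Lemma step_sum (I : Type) (r : seq I) l (F : I -> R -> R) :
  step l (fun d => \sum_(i <- r) F i d) = \sum_(i <- r) step l (F i).
Proof.
by rewrite /step exchange_big /=; apply: eq_bigr => a _; rewrite big_distrr.
Qed.

Lemma walk_sum (I : Type) (r : seq I) G s (F : I -> R -> R) x :
  walk G s (fun z => \sum_(i <- r) F i z) x = \sum_(i <- r) walk G s (F i) x.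
Proof.
elim: s x => //= l s IH x; rewrite -step_sum; apply: eq_step => d.
by rewrite IH big_distrr.
Qed.

(** Fubini for two independent walks; it replaces Chapman-Kolmogorov sums
    over an intermediate position. *)
Lemma walk_exchange G G' s t (F : R -> R -> R) x y :
  walk G s (fun a => walk G' t (F a) y) x =
  walk G' t (fun b => walk G s (F^~ b) x) y.
Proof.
elim: s x => //= l s IH x; rewrite /step walk_sum; apply: eq_bigr => a _.
by rewrite IH -!walkZ.
Qed.

Definition reflect_law l : law := (- l.1, [seq (a.1, - a.2) | a <- l.2]).

Definition reversal s : seq law := rev [seq reflect_law l | l <- s].

Definition delta y x : R := (x == y)%:R.

Lemma step_reflect l f : step (reflect_law l) f = step l (fun d => f (- d)).
Proof.
rewrite /step /= big_map; apply: eq_bigr => a _ /=.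
by rewrite rmorphN opprB opprK addrC.
Qed.

Lemma reflect_lawK : involutive reflect_law.
Proof.
case=> mu s; rewrite /reflect_law /= opprK -map_comp; congr pair.
rewrite -[RHS]map_id; apply: eq_map => -[w k] /=; by rewrite opprK.
Qed.

Lemma size_reversal s : size (reversal s) = size s.
Proof. by rewrite size_rev size_map. Qed.

Lemma reversal_cons l s : reversal (l :: s) = rcons (reversal s) (reflect_law l).
Proof. by rewrite /reversal /= rev_cons. Qed.

(** Reading a path backwards preserves its weight, but moves the killing test
    from the end of each step to its start, whence the two boundary factors. *)
Lemma walk_reversal G s x y :
  (G x)%:R * walk G s (delta y) x = (G y)%:R * walk G (reversal s) (delta x) y.
Proof.
elim: s x => [|l s IH] x /=.
  rewrite /delta eq_sym; case: eqP => [->|_]; by rewrite ?mulr0.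
rewrite reversal_cons -cats1 walk_cat /=.
have -> : walk G (reversal s) (fun z => step (reflect_law l)
     (fun d => (G (z + d))%:R * delta x (z + d))) y
  = walk G (reversal s) (fun z => \sum_(a <- l.2) (a.1 * (G x)%:R) *
     delta (x + (a.2%:~R - l.1)) z) y.
  apply: eq_walk => z; rewrite step_reflect /step; apply: eq_bigr => a _.
  rewrite -mulrA; congr (_ * _); rewrite /delta subr_eq.
  by case: eqP => [->|_]; rewrite ?addrK ?mulr0.
rewrite walk_sum /step !big_distrr /=; apply: eq_bigr => a _.
by rewrite walkZ IH mulrCA [RHS]mulrCA -!mulrA; congr (_ * _); rewrite mulrCA.
Qed.

Lemma nneg_reflect l : nneg l -> nneg (reflect_law l).
Proof. by move=> l0 _ /mapP[a al ->] /=; exact: l0. Qed.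

Lemma nneg_reversal s : (forall l, l \in s -> nneg l) ->
  forall l, l \in reversal s -> nneg l.
Proof.
move=> s0 l; rewrite mem_rev => /mapP[l' l's ->].
by apply: nneg_reflect; exact: s0.
Qed.

Definition drift s : R := \sum_(l <- s) l.1.

(** The walk lives on a translate of the integers that depends on the
    centrings. A half-open unit interval contains exactly one point of any
    such lattice, so bounds stated for [bin] are free of arithmetic
    conditions, and [walk_bin] recovers point masses. *)
Definition bin y x : R := (y <= x < y + 1)%R%:R.

Lemma bin_ge0 y x : 0 <= bin y x. Proof. exact: ler0n. Qed.
Lemma delta_ge0 y x : 0 <= delta y x. Proof. exact: ler0n. Qed.

Lemma delta_le_bin y y' x : y <= y' < y + 1 -> delta y' x <= bin y x.
Proof.
rewrite /delta /bin; case: eqP => [->->//|_ _]; exact: ler0n.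
Qed.

Lemma walk_bin G s x y : y - x + drift s \is a Num.int ->
  walk G s (delta y) x = walk G s (bin y) x.
Proof.
elim: s x => [|l s IH] x /=.
  rewrite /drift big_nil addr0 /delta /bin => /intrP[k yx].
  have -> : x = y - k%:~R by lra.
  have -> : (y - k%:~R == y) = (k == 0).
    by rewrite -subr_eq0 addrAC subrr add0r oppr_eq0 intr_eq0.
  have -> : (y <= y - k%:~R) = (k <= 0) by rewrite lerBrDr gerDl lerz0.
  have -> : (y - k%:~R < y + 1) = (-1 < k).
    by rewrite -[RHS](ltr_int R) rmorphN1 ltrD2l ltrNl.
  by case: k {yx} => [[|k]|k].
move=> yx; rewrite /step !big_seq; apply: eq_bigr => a al.
rewrite IH //.
have -> : y - (x + (a.2%:~R - l.1)) + drift s =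
   (y - x + drift (l :: s)) - a.2%:~R.
  by rewrite /drift big_cons; ring.
by rewrite rpredB // intr_int.
Qed.

End KilledWalks.

(** * Regular laws and second moments *)

Section RegularLaws.
Context {R : realType}.
Variables (s1 s2 c3 eta : R).
Implicit Types (l : @law R) (s t : seq (@law R)) (f g : R -> R) (x y z : R).

(** What the estimates use of a step: [s1] and [s2] bound its second moment,
    [c3] its third absolute moment, and [eta] the defects of mass and mean
    caused by truncation. *)
Definition regular l : Prop :=
  [/\ nneg l, 1 - eta <= step l (fun=> 1) <= 1, `|step l id| <= eta,
      s1 <= step l (fun d => d ^+ 2) <= s2 & step l (fun d => `|d| ^+ 3) <= c3].

Lemma regular_reflect l : regular l -> regular (reflect_law l).
Proof.
case=> l0 l1 l2 l3 l4; split; rewrite ?step_reflect //.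
- exact: nneg_reflect.
- have -> : step l -%R = - step l id.
    by rewrite -mulN1r -stepZ; apply: eq_step => d; rewrite mulN1r.
  by rewrite normrN.
- rewrite (@eq_step _ l _ (fun d => d ^+ 2)) // => d; exact: sqrrN.
- rewrite (@eq_step _ l _ (fun d => `|d| ^+ 3)) // => d; by rewrite normrN.
Qed.

Lemma step_poly l al be ga ka :
  step l (fun d => al + be * d + ga * d ^+ 2 - ka * `|d| ^+ 3) =
  al * step l (fun=> 1) + be * step l id + ga * step l (fun d => d ^+ 2)
    - ka * step l (fun d => `|d| ^+ 3).
Proof. by rewrite stepB !stepD !stepZ step_cst. Qed.

(** The profiles of [tube_step], [entrance_step] and [entrance_first] are all
    bounded below by a quadratic polynomial in the displacement minus a cubic
    error, and this much is averaged using only the data of [regular]. *)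
Lemma step_lower l f al be ga ka : regular l -> 0 <= ka ->
  (forall d, al + be * d + ga * d ^+ 2 - ka * `|d| ^+ 3 <= f d) ->
  al - (`|al| + `|be|) * eta + ga * step l (fun d => d ^+ 2) - ka * c3
    <= step l f.
Proof.
move=> [l0 /andP[l1 l1'] l2 _ l3] ka0 hf.
apply: le_trans (le_step l0 hf); rewrite step_poly.
have h1 : - (`|al| * eta) <= al * step l (fun=> 1) - al.
  have -> : al * step l (fun=> 1) - al = - (al * (1 - step l (fun=> 1))) by ring.
  rewrite lerN2; apply: le_trans (ler_norm _) _; rewrite normrM ler_wpM2l //.
  by rewrite ger0_norm; lra.
have h2 : - (`|be| * eta) <= be * step l id.
  rewrite lerNl; apply: le_trans (ler_norm _) _.
  by rewrite normrN normrM ler_wpM2l.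
have h3 := ler_wpM2l ka0 l3.
lra.
Qed.

Lemma walk_mass s x : 0 <= eta <= 1 -> (forall l, l \in s -> regular l) ->
  1 - (size s)%:R * eta <= walk predT s (fun=> 1) x <= 1.
Proof.
move=> /andP[eta0 eta1]; elim: s x => [|l s IH] x hs /=; first lra.
have hs' l' : l' \in s -> regular l'.
  by move=> l's; apply: hs; rewrite inE l's orbT.
have [l0 /andP[l1 l1'] _ _ _] : regular l by apply: hs; rewrite mem_head.
have m0 : 0 <= (size s)%:R :> R by [].
apply/andP; split.
  apply: (@le_trans _ _ (step l (fun=> 1 - (size s)%:R * eta))).
    rewrite step_cst -natr1.
    have : 0 <= (size s)%:R * eta * (1 - step l (fun=> 1)).
      by rewrite !mulr_ge0 // subr_ge0.
    lra.
  by apply: le_step => // d; rewrite mul1r; case/andP: (IH (x + d) hs').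
apply: le_trans l1'; apply: le_step => // d; rewrite mul1r.
by case/andP: (IH (x + d) hs').
Qed.

(** Variances add up; the factor [(1 + eta) ^+ size s] absorbs the mean
    defects. *)
Lemma walk_sqr s x y : 0 <= eta <= 1 -> (forall l, l \in s -> regular l) ->
  walk predT s (fun z => (z - y) ^+ 2) x <=
  (1 + eta) ^+ size s * ((x - y) ^+ 2 + (s2 + 1) * (size s)%:R).
Proof.
move=> /andP[eta0 eta1]; elim: s x => [|l s IH] x hs /=; first by lra.
have hs' l' : l' \in s -> regular l'.
  by move=> l's; apply: hs; rewrite inE l's orbT.
have [l0 /andP[l1 l1'] l2 /andP[l3 l3'] _] : regular l.
  by apply: hs; rewrite mem_head.
set E := (1 + eta) ^+ size s; set m := (size s)%:R : R.
have E0 : 0 < E by apply: exprn_gt0; lra.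
have m0 : 0 <= m by [].
have s20 : 0 <= s2.
  by apply: le_trans l3'; apply: step_ge0 => // d; exact: sqr_ge0.
apply: (@le_trans _ _ (step l (fun d => E * (((x - y) ^+ 2 + (s2 + 1) * m)
     + 2 * (x - y) * d + d ^+ 2)))).
  apply: le_step => // d; rewrite mul1r; apply: le_trans (IH (x + d) hs') _.
  rewrite ler_pM2l //; lra.
rewrite stepZ 2!stepD step_cst stepZ (exprS _ (size s)) -natr1 -/m -/E.
rewrite [(1 + eta) * E]mulrC -[leRHS]mulrA ler_pM2l //.
have h : 2 * (x - y) * step l id <= ((x - y) ^+ 2 + 1) * eta.
  apply: le_trans (ler_norm _) _; rewrite normrM.
  apply: ler_pM => //; rewrite ler_norml; apply/andP; split.
    by have := sqr_ge0 (x - y + 1); lra.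
  by have := sqr_ge0 (x - y - 1); lra.
have q0 := sqr_ge0 (x - y).
have : ((x - y) ^+ 2 + (s2 + 1) * m) * step l (fun=> 1) <=
   (x - y) ^+ 2 + (s2 + 1) * m.
  rewrite ler_piMr // addr_ge0 // mulr_ge0 //; lra.
have : 0 <= eta * (s2 * m) by rewrite !mulr_ge0.
have : 0 <= eta * s2 by rewrite !mulr_ge0.
have : 0 <= eta * m by rewrite !mulr_ge0.
set q := (x - y) ^+ 2 in q0 h *.
nra.
Qed.

Definition pos : pred R := fun z => 0 <= z.

(** Chebyshev for the exit of a ball of radius [B] around [y], which lies in
    the half-line: one minus the squared distance over [B ^+ 2] is a
    subsolution, nonpositive outside the ball. *)
Lemma walk_survive s x y B : 0 <= eta -> eta * B ^+ 2 <= 1 -> eta * B <= 1 ->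
  0 < B <= y -> (forall l, l \in s -> regular l) ->
  1 - ((x - y) ^+ 2 + (s2 + 3) * (size s)%:R) / B ^+ 2
    <= walk pos s (fun=> 1) x.
Proof.
move=> eta0 B2 B1 /andP[B0 By].
elim: s x => [|l s IH] x hs.
  by rewrite /= mulr0 addr0 gerBl divr_ge0 ?sqr_ge0.
have hs' l' : l' \in s -> regular l'.
  by move=> l's; apply: hs; rewrite inE l's orbT.
have rl : regular l by apply: hs; rewrite mem_head.
have [l0 /andP[l1 l1'] l2 /andP[l3 l3'] _] := rl.
have [xB|xB] := lerP (B ^+ 2) ((x - y) ^+ 2).
  apply: (@le_trans _ _ 0); last first.
    by apply: walk_ge0 => // l' /hs[].
  rewrite subr_le0 ler_pdivlMr ?exprn_gt0 // mul1r.
  apply: (le_trans xB); rewrite lerDl mulr_ge0 //.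
  suff : 0 <= s2 by lra.
  by apply: le_trans l3'; apply: step_ge0 => // d; exact: sqr_ge0.
set m := (size s)%:R : R; set c := (B ^+ 2)^-1.
have c0 : 0 < c by rewrite invr_gt0 exprn_gt0.
have cB : c * B ^+ 2 = 1 by rewrite mulVf // gt_eqF // exprn_gt0.
pose F d := (1 - (s2 + 3) * m * c) * 1 - c * ((x - y) ^+ 2 * 1 + 2 * (x - y) * d + d ^+ 2).
apply: (@le_trans _ _ (step l F)); last first.
  rewrite /=; apply: le_step => // d.
  have e : 1 - ((x + d - y) ^+ 2 + (s2 + 3) * m) / B ^+ 2 = F d.
    by rewrite /F -/c; ring.
  have := IH (x + d) hs'; rewrite e.
  have [xd|xd] := boolP (pos (x + d)); rewrite ?mul1r ?mul0r // => _.
  rewrite -e subr_le0 ler_pdivlMr ?exprn_gt0 // mul1r.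
  rewrite -[leLHS]addr0 lerD //; last first.
    rewrite mulr_ge0 // addr_ge0 //.
    by apply: le_trans l3'; apply: step_ge0 => // ?; exact: sqr_ge0.
  move: xd; rewrite /pos -ltNge => xd.
  by rewrite -(sqrrN (_ - _)) ler_sqr ?nnegrE; lra.
have -> : (size (l :: s))%:R = m + 1 by rewrite natr1.
rewrite /F stepB !stepZ 2!stepD !stepZ -/c.
have s20 : 0 <= s2.
  by apply: le_trans l3'; apply: step_ge0 => // ?; exact: sqr_ge0.
have m0 : 0 <= m by [].
have h1 : (1 - (s2 + 3) * m * c) - eta <= (1 - (s2 + 3) * m * c) * step l (fun=> 1).
  have : 0 <= (s2 + 3) * m * c by rewrite !mulr_ge0 // ?ltW //; lra.
  nra.
have h2 : (x - y) ^+ 2 * step l (fun=> 1) <= (x - y) ^+ 2.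
  by rewrite ler_piMr // sqr_ge0.
have xB' : `|x - y| <= B.
  rewrite -[B]gtr0_norm // -ler_sqr ?nnegrE // !real_normK ?num_real //.
  exact: ltW.
have h3 : 2 * (x - y) * step l id <= 2.
  apply: le_trans (ler_norm _) _; rewrite !normrM ger0_norm // -mulrA.
  rewrite ler_piMr //; apply: (@le_trans _ _ (B * eta)); last by rewrite mulrC.
  exact: ler_pM.
have h4 : eta <= c by rewrite /c -div1r ler_pdivlMr // exprn_gt0.
have := ler_wpM2l (ltW c0) h2; have := ler_wpM2l (ltW c0) h3.
have := ler_wpM2l (ltW c0) l3'.
lra.
Qed.

End RegularLaws.

(** * Smoothing by a lazy component *)

Section Smoothing.
Context {R : realType}.
Implicit Types (s t : seq (@law R)) (f g : R -> R) (x y z : R).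

(** One step of the lazy simple random walk, that is two Bernoulli half steps
    recentred. *)
Definition lazy f x : R := (f (x - 1) + 2 * f x + f (x + 1)) / 4.

(** The sum of the steps in [t] contains a lazy simple step with probability
    at least [eps]. The displacement of [t] is [- m] when its jumps add up to
    zero. *)
Definition minorized (eps : R) t : Prop := exists m : R, forall g x,
  (forall z, 0 <= g z) -> eps * lazy g (x - m) <= walk predT t g x.

Lemma lazyB f g x : lazy (fun z => f z - g z) x = lazy f x - lazy g x.
Proof. by rewrite /lazy; ring. Qed.

Lemma lazy_cst c x : lazy (fun=> c) x = c.
Proof. by rewrite /lazy; field. Qed.

Lemma walk_lazy s f k :
  walk predT s (iter k lazy f) = iter k lazy (walk predT s f).
Proof.
elim: k => //= k <-; apply/funext => x; rewrite {1}/lazy.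
rewrite (@eq_walk _ _ _ _ (fun z => 4^-1 * ((iter k lazy f (z + (-1)) +
   2 * iter k lazy f z) + iter k lazy f (z + 1)))); last first.
  by move=> z; rewrite mulrC.
by rewrite walkZ 2!walkD walkZ !walk_shift mulrC.
Qed.

Variables (s1 s2 c3 eta eps : R).
Hypothesis s2_ge0 : 0 <= s2.
Hypothesis eta01 : 0 <= eta <= 1.
Hypothesis eps01 : 0 <= eps <= 1.
Let reg := regular s1 s2 c3 eta.

Definition smoothing_block t : Prop :=
  minorized eps t /\ forall l, l \in t -> reg l.

(** The index [k] counts the lazy steps already extracted; they commute with
    all other steps and act on [f] directly. The weight [a / 2 ^+ k] charges
    the event that few of them are found: a block produces a new one with
    weight [eps], which halves it, hence a factor [1 - eps / 2] per block. *)
Lemma smoothing_upper f (a b : R) (bs : seq (seq (@law R))) : 0 <= a -> 0 <= b ->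
  (forall k x, iter k lazy f x <= b + a / 2 ^+ k) ->
  (forall t, t \in bs -> smoothing_block t) -> forall k x,
  iter k lazy (walk predT (flatten bs) f) x <=
    b + a / 2 ^+ k * (1 - eps / 2) ^+ size bs.
Proof.
move=> a0 b0 hf; have [e0 e1] := andP eps01; elim: bs => [|t bs IH] hbs k x; first by rewrite /= mulr1.
have hbs' t' : t' \in bs -> smoothing_block t'.
  by move=> h; apply: hbs; rewrite inE h orbT.
have [[m hm] ht] : smoothing_block t by apply: hbs; rewrite mem_head.
have {}IH := IH hbs'.
have -> : walk predT (flatten (t :: bs)) f = walk predT t (walk predT (flatten bs) f).
  by apply/funext => z; rewrite /= walk_cat.
rewrite -walk_lazy; set h := iter k lazy _.
set E := (1 - eps / 2) ^+ size bs.
have E0 : 0 <= E by apply: exprn_ge0; lra.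
set A := a / 2 ^+ k.
have A0 : 0 <= A by rewrite divr_ge0 // exprn_ge0.
set U := b + A * E.
have hU z : h z <= U by exact: IH.
have hU' : lazy h (x - m) <= b + A / 2 * E.
  by have := IH k.+1 (x - m); rewrite /= -/h (exprSr _ k) invfM (mulrA a) -/A.
(* the deficit U - h is nonnegative, so the lazy step extracts part of it *)
have hx := hm (fun z => U - h z) x; rewrite lazyB lazy_cst walkB walk_cst in hx.
have {}hx := hx (fun z => etrans (subr_ge0 _ _) (hU z)).
have /andP[_ w1] := walk_mass x eta01 ht.
have U0 : 0 <= U by rewrite addr_ge0 // mulr_ge0.
have w2 := ler_wpM2l U0 w1.
have w3 := ler_wpM2l e0 hU'.
rewrite (exprS _ (size bs)) -/E.
have -> : b + A * ((1 - eps / 2) * E) = U - eps * U + eps * (b + A / 2 * E).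
  by rewrite /U; field.
lra.
Qed.

(** As in [smoothing_upper], but from below: the comparison function is a
    downward parabola around [y], so the part of a block which is not used
    for smoothing enters only through its second moment [walk_sqr]. *)
Lemma smoothing_lower f (y a be B : R) (M : nat) (bs : seq (seq (@law R))) :
  0 <= a -> 0 <= be -> 0 < B ->
  (forall k x, (k <= M)%N ->
     be * (1 - (x - y) ^+ 2 / B - a / 2 ^+ k) <= iter k lazy f x) ->
  (forall t, t \in bs -> smoothing_block t) ->
  forall k x, (k + size bs <= M)%N ->
  be * (1 - (size (flatten bs))%:R * eta
        - (1 + eta) ^+ size (flatten bs)
           * ((x - y) ^+ 2 + (s2 + 1) * (size (flatten bs))%:R) / B
        - a / 2 ^+ k * (1 - eps / 2) ^+ size bs)
   <= iter k lazy (walk predT (flatten bs) f) x.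
Proof.
move=> a0 be0 B0 hf; have [eta0 eta1] := andP eta01; have [e0 e1] := andP eps01.
elim: bs => [|t bs IH] hbs k x.
  rewrite addn0 /= => kM.
  by rewrite mul0r subr0 mulr0 addr0 mul1r mulr1 hf.
rewrite /= addnS => kM.
have hbs' t' : t' \in bs -> smoothing_block t'.
  by move=> h; apply: hbs; rewrite inE h orbT.
have [[m hm] ht] : smoothing_block t by apply: hbs; rewrite mem_head.
have {}IH := IH hbs'.
have -> : walk predT (t ++ flatten bs) f = walk predT t (walk predT (flatten bs) f).
  by apply/funext => z; rewrite walk_cat.
rewrite -walk_lazy; set h := iter k lazy _.
rewrite size_cat natrD exprD (exprS _ (size bs)).
set n1 := (size t)%:R : R; set n2 := (size (flatten bs))%:R : R.
set E1 := (1 + eta) ^+ size t; set E2 := (1 + eta) ^+ size (flatten bs).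
set E := (1 - eps / 2) ^+ size bs.
have E_ge0 : 0 <= E by apply: exprn_ge0; lra.
have E1_ge1 : 1 <= E1 by apply: exprn_ege1; lra.
have E2_ge0 : 0 <= E2 by apply: exprn_ge0; lra.
have n1_ge0 : 0 <= n1 by [].
have n2_ge0 : 0 <= n2 by [].
set A := a / 2 ^+ k.
have A0 : 0 <= A by rewrite divr_ge0 // exprn_ge0.
have s2pos : 0 <= s2 + 1 by rewrite addr_ge0.
pose c1 := E2 / B.
have c10 : 0 <= c1 by rewrite divr_ge0 // ltW.
(* the comparison function after the remaining blocks, written as a constant
   minus a multiple of the squared distance *)
pose K := 1 - n2 * eta - c1 * ((s2 + 1) * n2) - A * E.
pose phi z := be * (K - c1 * (z - y) ^+ 2).
have phiE z : phi z = be * (1 - n2 * eta - E2 * ((z - y) ^+ 2 + (s2 + 1) * n2) / B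
    - A * E) by rewrite /phi /K /c1; ring.
have h1 z : phi z <= h z.
  by rewrite phiE; apply: IH; apply: leq_trans kM; rewrite leqW.
have h2 z : phi z + be * (A * E / 2) <= lazy h z.
  have := IH k.+1 z; rewrite addSn => /(_ kM); rewrite /= -/h (exprSr _ k) invfM.
  apply: le_trans; rewrite phiE (mulrA a) -/A le_eqVlt; apply/orP; left.
  by apply/eqP; rewrite -/n2 -/E2 -/E; field; rewrite gt_eqF.
have hx := hm (fun z => h z - phi z) x; rewrite lazyB walkB in hx.
have {}hx := hx (fun z => etrans (subr_ge0 _ _) (h1 z)).
have lazyphi z : lazy phi z = phi z - be * c1 / 2.
  by rewrite /lazy /phi; field.
have /andP[w1 w1'] := walk_mass x eta01 ht; rewrite -/n1 in w1.
have w2 := walk_sqr x y eta01 ht; rewrite -/n1 -/E1 in w2.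
have wphi : walk predT t phi x =
    be * (K * walk predT t (fun=> 1) x - c1 * walk predT t (fun z => (z - y) ^+ 2) x).
  by rewrite /phi walkZ walkB walkZ walk_cst.
set W := walk predT t (fun=> 1) x in w1 w1' wphi.
set V := walk predT t _ x in w2 wphi.
have K1 : K <= 1.
  have : 0 <= n2 * eta by rewrite mulr_ge0.
  have : 0 <= c1 * ((s2 + 1) * n2) by apply: mulr_ge0 => //; apply: mulr_ge0.
  have : 0 <= A * E by rewrite mulr_ge0.
  rewrite /K; lra.
have hK : K - n1 * eta - (E1 - 1) * c1 * ((s2 + 1) * n2) <= K * W.
  have : 0 <= (E1 - 1) * c1 * ((s2 + 1) * n2).
    apply: mulr_ge0; last exact: mulr_ge0.
    apply: mulr_ge0 => //; lra.
  have : 0 <= (1 - W) * (1 - K) by apply: mulr_ge0; rewrite subr_ge0.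
  lra.
have hV := ler_wpM2l c10 w2.
have hb : eps * (be * (A * E / 2)) <= eps * (lazy h (x - m) - lazy phi (x - m)).
  rewrite ler_wpM2l //; have := h2 (x - m).
  have : 0 <= be * c1 by rewrite mulr_ge0.
  rewrite lazyphi; lra.
have hb' : be * (K - n1 * eta - (E1 - 1) * c1 * ((s2 + 1) * n2) -
    c1 * (E1 * ((x - y) ^+ 2 + (s2 + 1) * n1))) <= walk predT t phi x.
  by rewrite wphi ler_wpM2l //; lra.
apply: (@le_trans _ _ (be * (K - n1 * eta - (E1 - 1) * c1 * ((s2 + 1) * n2) -
    c1 * (E1 * ((x - y) ^+ 2 + (s2 + 1) * n1))) + eps * (be * (A * E / 2)))).
  by rewrite le_eqVlt; apply/orP; left; apply/eqP; rewrite /K /c1; field;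
    rewrite gt_eqF.
lra.
Qed.

End Smoothing.

(** * Binomial estimates *)

Section Binomial.
Context {R : realType}.
Implicit Types (f g : R -> R) (x y z : R) (k j i n : nat).

Definition bernoulli_half f x : R := (f x + f (x + 1)) / 2.

Lemma iter_half n f x : iter n bernoulli_half f x =
  \sum_(i < n.+1) 'C(n, i)%:R / 2 ^+ n * f (x + i%:R).
Proof.
elim: n x => [|n IH] x.
  by rewrite big_ord1 /= bin0 expr0 divr1 mul1r addr0.
rewrite iterS /bernoulli_half !IH big_ord_recl /= [in RHS]big_ord_recl /=.
rewrite !bin0 !addr0 exprS.
have -> : \sum_(i < n.+1) 'C(n, i)%:R / 2 ^+ n * f (x + 1 + i%:R) =
   \sum_(i < n.+1) 'C(n, i)%:R / 2 ^+ n * f (x + (bump 0 i)%:R).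
  apply: eq_bigr => i _; rewrite /bump leq0n add1n -[i.+1%:R]natr1.
  by congr (_ * f _); ring.
have -> : \sum_(i < n) 'C(n, bump 0 i)%:R / 2 ^+ n * f (x + (bump 0 i)%:R) =
   \sum_(i < n.+1) 'C(n, bump 0 i)%:R / 2 ^+ n * f (x + (bump 0 i)%:R).
  by rewrite [RHS]big_ord_recr /= bin_small // !mul0r addr0.
rewrite -addrA -big_split /= mulrDl big_distrl /=; congr (_ + _).
  by field; rewrite expf_neq0 ?pnatr_eq0.
apply: eq_bigr => i _; rewrite /bump /= add1n binS natrD; field.
by rewrite expf_neq0 ?pnatr_eq0.
Qed.

Lemma iter_lazy_half k f x :
  iter k lazy f x = iter k.*2 bernoulli_half f (x - k%:R).
Proof.
elim: k x => [|k IH] x; first by rewrite subr0.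
rewrite iterS doubleS 2!iterS /lazy !IH {1}/bernoulli_half.
rewrite /bernoulli_half -!natr1.
have -> : x - (k%:R + 1) = x - 1 - k%:R by ring.
have -> : x - 1 - k%:R + 1 = x - k%:R by ring.
have -> : x + 1 - k%:R = x - k%:R + 1 by ring.
by field.
Qed.

(** The probability that [k] lazy steps lead from [0] to [j]. *)
Definition central k j : R := 'C(k.*2, k + j)%:R / 4 ^+ k.

Lemma iter_lazy k f x : iter k lazy f x =
  \sum_(i < k.*2.+1) 'C(k.*2, i)%:R / 4 ^+ k * f (x - k%:R + i%:R).
Proof.
rewrite iter_lazy_half iter_half; apply: eq_bigr => i _.
have -> : 2 ^+ k.*2 = 4 ^+ k :> R; last by [].
by rewrite -mul2n exprM; congr (_ ^+ _); lra.
Qed.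

Lemma central_ge0 k j : 0 <= central k j.
Proof. by rewrite divr_ge0 ?exprn_ge0. Qed.

Lemma centralS k j : central k j.+1 * (k + j.+1)%:R = central k j * (k - j)%:R.
Proof.
rewrite /central mulrAC [RHS]mulrAC -!natrM; congr (_%:R / _).
by rewrite addnS mulnC mul_bin_left mulnC -addnn subnDl.
Qed.

Lemma centralSk k : central k.+1 0 * (k.*2.+2)%:R = central k 0 * (k.*2.+1)%:R.
Proof.
rewrite /central !addn0 exprS.
have h : (k.+1 * 'C(k.+1.*2, k.+1) = k.*2.+2 * 'C(k.*2.+1, k))%N.
  by rewrite doubleS -mul_bin_diag.
have h' : (k.+1 * 'C(k.*2.+1, k) = k.*2.+1 * 'C(k.*2, k))%N.
  have -> : 'C(k.*2.+1, k) = 'C(k.*2.+1, k.+1).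
    rewrite -[in RHS]bin_sub; last lia.
    by congr 'C(_, _); lia.
  by rewrite -mul_bin_diag.
have {}h := congr1 (fun n => n%:R : R) h.
have {}h' := congr1 (fun n => n%:R : R) h'.
rewrite !natrM in h h'.
have k0 : k.+1%:R != 0 :> R by rewrite pnatr_eq0.
have e : (k.*2.+2)%:R = 2 * k.+1%:R :> R.
  by rewrite -natrM; congr _%:R; lia.
rewrite e in h *.
have h2 : 'C(k.+1.*2, k.+1)%:R * k.+1%:R = 2 * (k.*2.+1)%:R * 'C(k.*2, k)%:R :> R.
  apply: (mulfI k0); rewrite mulrA h.
  transitivity (2 * k.+1%:R * ((k.*2.+1)%:R * 'C(k.*2, k)%:R) : R); last by ring.
  by rewrite -h'; ring.
have -> : 'C(k.+1.*2, k.+1)%:R / (4 * 4 ^+ k) * (2 * k.+1%:R) =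
   ('C(k.+1.*2, k.+1)%:R * k.+1%:R) / (2 * 4 ^+ k) :> R.
  by field; rewrite expf_neq0 ?pnatr_eq0.
by rewrite h2; field; rewrite expf_neq0 ?pnatr_eq0.
Qed.

(** Working with the square of the central binomial probability keeps the
    recursion rational and yields the two bounds of order [1 / k] by
    induction (the Wallis estimates). *)
Lemma central0_bounds k :
  (k.*2.+1)%:R * central k 0 ^+ 2 <= 1 /\
  ((0 < k)%N -> 1 <= 4 * k%:R * central k 0 ^+ 2).
Proof.
elim: k => [|k [IH1 IH2]].
  by rewrite /central bin0 expr0 divr1 expr1n mulr1.
have h := centralSk k; set c' := central k.+1 0 in h *.
set c := central k 0 in h IH1 IH2.
have e1 : (k.*2.+1)%:R = 2 * k%:R + 1 :> R by rewrite -addn1 natrD -mul2n natrM.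
have e2 : (k.*2.+2)%:R = 2 * k%:R + 2 :> R by rewrite -addn2 natrD -mul2n natrM.
rewrite e1 e2 in h IH1.
have e3 : (k.+1.*2.+1)%:R = 2 * k%:R + 3 :> R.
  by rewrite doubleS -addn3 natrD -mul2n natrM.
rewrite e3 -natr1.
have k0 : 0 <= k%:R :> R by [].
have d0 : 0 < (2 * k%:R + 2) ^+ 2 :> R by rewrite exprn_gt0 //; lra.
have hh : c' ^+ 2 * (2 * k%:R + 2) ^+ 2 = c ^+ 2 * (2 * k%:R + 1) ^+ 2.
  by rewrite -!exprMn h.
have c2 : 0 <= c ^+ 2 by exact: sqr_ge0.
split.
  rewrite -(ler_pM2r d0) mul1r -[leLHS]mulrA hh; nra.
move=> _; rewrite -(ler_pM2r d0) mul1r -[leRHS]mulrA hh.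
case: (posnP k) => [kz|kpos]; last by have := IH2 kpos; nra.
have -> : c = 1 by rewrite /c kz /central bin0 expr0 divr1.
by rewrite kz; lra.
Qed.

Lemma central_le k j : central k j <= central k 0.
Proof.
elim: j => // j; apply: le_trans.
have h := centralS k j.
have p : 0 < (k + j.+1)%:R :> R by rewrite ltr0n addnS.
rewrite -(ler_pM2r p) h ler_wpM2l ?central_ge0 // ler_nat; lia.
Qed.

Lemma binomial_le_central k i : 'C(k.*2, i)%:R / 4 ^+ k <= central k 0.
Proof.
have [ki|ki] := leqP k i.
  by have := central_le k (i - k); rewrite /central subnKC.
have := central_le k (k - i); rewrite /central.
rewrite -[in X in X -> _]bin_sub; last lia.
by have -> : (k.*2 - (k + (k - i)) = i)%N by lia.
Qed.

Lemma central0_le k : central k 0 <= (Num.sqrt k.+1%:R)^-1.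
Proof.
have [h _] := central0_bounds k.
have p : 0 < Num.sqrt k.+1%:R :> R by rewrite sqrtr_gt0.
rewrite -div1r ler_pdivlMr //.
have cp : 0 <= central k 0 * Num.sqrt k.+1%:R by rewrite mulr_ge0 ?central_ge0 ?ltW.
rewrite -(expr_le1 (ltn0Sn 1) cp) exprMn sqr_sqrtr // mulrC.
 apply: le_trans h; rewrite ler_wpM2r ?sqr_ge0 // ler_nat; lia.
Qed.

Lemma central0_ge k : (0 < k)%N -> (2 * Num.sqrt k%:R)^-1 <= central k 0.
Proof.
move=> k0; have [_ /(_ k0) h] := central0_bounds k.
have p : 0 < 2 * Num.sqrt k%:R :> R by rewrite mulr_gt0 // sqrtr_gt0 ltr0n.
rewrite -div1r ler_pdivrMr //.
have cp : 0 <= central k 0 * (2 * Num.sqrt k%:R).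
  by rewrite mulr_ge0 ?central_ge0 ?ltW.
rewrite -(expr_ge1 (ltn0Sn 1) cp) exprMn [X in _ * X]exprMn sqr_sqrtr //; lra.
Qed.

(** Consecutive terms have ratio [(k - j) / (k + j + 1)], at least
    [expR (- (2 * (2 * j + 1) / k))] while [j] stays below [k / 2]; the
    exponents add up to a multiple of [j ^ 2]. *)
Lemma central_ge k j : (j.*2 <= k)%N ->
  central k 0 * expR (- (2 * j%:R ^+ 2 / k%:R)) <= central k j.
Proof.
elim: j => [|j IH] jk; first by rewrite expr0n /= mulr0 mul0r oppr0 expR0 mulr1.
have k0 : 0 < k%:R :> R by rewrite ltr0n; lia.
have {}IH : central k 0 * expR (- (2 * j%:R ^+ 2 / k%:R)) <= central k j.
  by apply: IH; lia.
have h := centralS k j.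
have kj : (j <= k)%N by lia.
rewrite natrD natrB // -natr1 in h.
have jk' : 2 * (j%:R + 1) <= k%:R :> R by rewrite natr1 -natrM ler_nat; lia.
have j0 : 0 <= j%:R :> R by [].
have p : 0 < k%:R + (j%:R + 1) :> R by lra.
have p' : 0 < k%:R - j%:R :> R by lra.
rewrite -[j.+1%:R]natr1.
have e : k%:R + (j%:R + 1) <= (k%:R - j%:R) * expR (2 * (2 * j%:R + 1) / k%:R) :> R.
  apply: (@le_trans _ _ ((k%:R - j%:R) * (1 + 2 * (2 * j%:R + 1) / k%:R))).
    rewrite -(ler_pM2r k0).
    have -> : (k%:R - j%:R) * (1 + 2 * (2 * j%:R + 1) / k%:R) * k%:R =
      (k%:R - j%:R) * (k%:R + 2 * (2 * j%:R + 1)) :> R by field; rewrite gt_eqF.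
    nra.
  by rewrite ler_pM2l // expR_ge1Dx.
have -> : - (2 * (j%:R + 1) ^+ 2 / k%:R) =
   - (2 * j%:R ^+ 2 / k%:R) - (2 * (2 * j%:R + 1) / k%:R) :> R.
  by field; rewrite gt_eqF.
rewrite expRD mulrA.
set a := central k 0 * _ in IH *; set E := 2 * (2 * j%:R + 1) / k%:R in e *.
have E0 := expR_gt0 E.
rewrite expRN ler_pdivrMr // -(ler_pM2r p) [leRHS]mulrAC h -[leRHS]mulrA.
have c0 := central_ge0 k j.
apply: (@le_trans _ _ (central k j * (k%:R + (j%:R + 1)))).
  by rewrite ler_pM2r.
by rewrite ler_wpM2l.
Qed.

Lemma binE y z (i : int) : bin y (z + i%:~R) = (i == Num.ceil (y - z))%:R :> R.
Proof.
rewrite /bin eq_sym ceil_eq intrB; congr ((nat_of_bool _)%:R : R).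
by apply/idP/idP => /andP[h1 h2]; apply/andP; split; lra.
Qed.

Lemma iter_lazy_bin_le k y x : iter k lazy (bin y) x <= (Num.sqrt k.+1%:R)^-1.
Proof.
apply: le_trans (central0_le k); rewrite iter_lazy.
apply: (@le_trans _ _ (central k 0 * \sum_(i < k.*2.+1) bin y (x - k%:R + i%:R))).
  rewrite big_distrr; apply: ler_sum => i _.
  by rewrite ler_wpM2r ?bin_ge0 // binomial_le_central.
rewrite ler_piMr ?central_ge0 //.
under eq_bigr => i _ do rewrite -[i%:R]/((i%:Z)%:~R) binE.
set c := Num.ceil _.
case: (pickP (fun i : 'I_(k.*2.+1) => i%:Z == c)) => [i0 /eqP hi0|h].
  rewrite (bigD1 i0) //= hi0 eqxx big1 ?addr0 // => i ii0.
  by rewrite -hi0 eqz_nat (inj_eq val_inj) (negbTE ii0).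
by rewrite big1 // => i _; rewrite h.
Qed.

Lemma iter_lazy_bin_ge k y x A : (0 < k)%N -> `|x - y| <= A -> 2 * (A + 1) <= k%:R ->
  (2 * Num.sqrt k%:R)^-1 * expR (- (2 * (A + 1) ^+ 2 / k%:R)) <= iter k lazy (bin y) x.
Proof.
move=> k0 xy Ak; rewrite iter_lazy.
under eq_bigr => i _ do rewrite -[i%:R]/((i%:Z)%:~R) binE.
set c := Num.ceil _.
pose j : int := Num.ceil (y - x).
have cE : c = j + k%:Z.
  apply/eqP; rewrite ceil_eq intrB intrD.
  by have := ceil_itv (y - x); rewrite -/j intrB -[k%:~R]/(k%:R); lra.
have jA : (`|j|%N)%:R <= A + 1.
  rewrite natr_absz intr_norm.
  have := ceil_itv (y - x); rewrite -/j intrB => /andP[h1 h2].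
  move: xy; rewrite !ler_norml => /andP[h3 h4]; lra.
have jk : (`|j| .*2 <= k)%N.
  by rewrite -(ler_nat R) -mul2n natrM; lra.
have ck : (`|c| < k.*2.+1)%N by lia.
have c0 : c = (`|c|%N)%:Z by lia.
rewrite (bigD1 (Ordinal ck)) //= -c0 eqxx mulr1.
apply: (@le_trans _ _ (central k `|j|)); last first.
  have -> : 'C(k.*2, `|c|%N) = 'C(k.*2, k + `|j|%N).
    have [j0|j0] := lerP 0 j; first by congr 'C(_, _); lia.
    by rewrite -bin_sub; [congr 'C(_, _); lia|lia].
  rewrite lerDl sumr_ge0 // => i _; by rewrite !mulr_ge0 ?invr_ge0 ?exprn_ge0.
apply: le_trans (central_ge jk).
apply: ler_pM; rewrite ?central0_ge ?expR_ge0 ?invr_ge0 ?mulr_ge0 ?sqrtr_ge0 //.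
rewrite ler_expR lerN2 ler_wpM2r ?invr_ge0 // ler_wpM2l //.
by rewrite ler_sqr ?nnegrE //; apply: le_trans jA.
Qed.

End Binomial.

(** * Local bounds for the free walk *)

Section LocalBounds.
Context {R : realType}.
Implicit Types (s t : seq (@law R)) (x y z : R).

Lemma expR_le_inv (t : R) : 0 <= t -> expR (- t) <= (1 + t)^-1.
Proof.
by move=> t0; rewrite expRN lef_pV2 ?posrE ?expR_gt0 ?expR_ge1Dx //; lra.
Qed.

Lemma leq_double_divn (N m : nat) : (0 < N <= m)%N -> (m <= 2 * N * (m %/ N))%N.
Proof.
move=> /andP[N0 Nm]; have := ltn_ceil m N0.
have : (0 < m %/ N)%N by rewrite divn_gt0.
nia.
Qed.

(** Block sizes range over [N0] to [2 * N0 - 1], so that no remainder is left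
    over. *)
Lemma chop (T : eqType) (N0 : nat) (r : seq T) : (0 < N0 <= size r)%N ->
  exists bs : seq (seq T), [/\ r = flatten bs, size bs = (size r %/ N0)%N &
    forall b, b \in bs -> (N0 <= size b < N0.*2)%N /\ {subset b <= r}].
Proof.
move=> /andP[N0_gt0]; have [n] := ubnP (size r); elim: n r => // n IH r sn Ns.
have [sN|Ns2] := ltnP (size r) N0.*2.
  exists [:: r]; split => /=; rewrite ?cats0 //.
    apply/eqP; rewrite eqn_leq leq_divRL // mul1n Ns -ltnS ltn_divLR //.
    by rewrite mul2n.
  by move=> t; rewrite inE => /eqP ->; rewrite Ns sN; split.
have [||bs [sE sz hbs]] := IH (drop N0 r).
- by rewrite size_drop; lia.
- by rewrite size_drop; lia.
exists (take N0 r :: bs); split.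
- by rewrite /= -sE cat_take_drop.
- rewrite /= sz size_drop -[in RHS](subnK Ns) divnDr ?dvdnn // divnn N0_gt0.
  by rewrite addn1.
- move=> t; rewrite inE => /predU1P[->|/hbs[h1 h2]].
    by rewrite size_takel //; split; [lia | exact: mem_take].
  by split=> // l /h2; exact: mem_drop.
Qed.

Variables (s1 s2 c3 eps : R) (N0 : nat).
Hypothesis s2_ge0 : 0 <= s2.
Hypothesis eps01 : 0 < eps <= 1.
Hypothesis N0_gt0 : (0 < N0)%N.

(** Stated for a class [Q], so that every piece of a walk, and after
    reflection its reversal, falls under the same estimates. *)
Definition admissible (eta : R) (Q : @law R -> Prop) : Prop :=
  (forall l, Q l -> regular s1 s2 c3 eta l) /\
  (forall t, (N0 <= size t < N0.*2)%N -> (forall l, l \in t -> Q l) ->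
     minorized eps t).

Lemma admissible_blocks eta Q s : admissible eta Q -> (N0 <= size s)%N ->
  (forall l, l \in s -> Q l) ->
  exists bs, [/\ s = flatten bs, size bs = (size s %/ N0)%N &
    forall t, t \in bs -> smoothing_block s1 s2 c3 eta eps t].
Proof.
move=> [Qr Qm] Ns hs; have [|bs [sE sz hbs]] := @chop _ N0 s; first by rewrite N0_gt0.
exists bs; split=> // t /hbs[h1 h2]; split; last by move=> l /h2 /hs /Qr.
by apply: Qm => // l /h2 /hs.
Qed.

(** A Markov bound for the probability that [M] blocks provide at most a
    quarter of the expected [eps * M] lazy steps. *)
Lemma decay_bound (M : nat) (k0 := Num.truncn (eps * M%:R / 4)) :
  2 ^+ k0 * (1 - eps / 2) ^+ M <= (1 + eps * M%:R / 4)^-1.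
Proof.
have [e0 e1] := andP eps01.
have m0 : 0 <= M%:R :> R by [].
have em0 : 0 <= eps * M%:R / 4 by rewrite divr_ge0 // mulr_ge0 // ltW.
apply: le_trans (expR_le_inv em0).
have -> : - (eps * M%:R / 4) = eps * M%:R / 4 + M%:R * - (eps / 2) :> R by field.
rewrite expRD expRM_natl.
have h1 : 2 ^+ k0 <= expR (eps * M%:R / 4) :> R.
  apply: (@le_trans _ _ (expR k0%:R)); last by rewrite ler_expR /k0 truncn_le.
  rewrite -[k0%:R]mulr1 expRM_natl lerXn2r ?nnegrE ?expR_ge0 //.
  by apply: le_trans (expR_ge1Dx _); lra.
apply: ler_pM => //; rewrite ?exprn_ge0 //; first by lra.
rewrite lerXn2r ?nnegrE ?expR_ge0 //; first by lra.
exact: (expR_ge1Dx (- (eps / 2))).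
Qed.

Definition cU : R := 3 * Num.sqrt (2 * N0%:R / eps).

Lemma cU_gt0 : 0 < cU.
Proof.
have [e0 e1] := andP eps01.
by rewrite /cU mulr_gt0 // sqrtr_gt0 divr_gt0 // mulr_gt0 // ltr0n.
Qed.

(** Outside an event of probability of order at most [1 / sqrt n], a positive
    fraction of the blocks provides a lazy step, and after that many lazy
    steps no point carries mass more than a constant over [sqrt n]. *)
Lemma local_upper eta Q s x y : 0 <= eta <= 1 -> admissible eta Q ->
  (forall l, l \in s -> Q l) -> (0 < size s)%N ->
  walk predT s (bin y) x <= cU / Num.sqrt (size s)%:R.
Proof.
move=> eta01 gQ hs m_gt0; have [e0 e1] := andP eps01.
have N0' : 0 < N0%:R :> R by rewrite ltr0n.
set m := size s; have m0 : 0 < m%:R :> R by rewrite ltr0n.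
have sm0 : 0 < Num.sqrt m%:R :> R by rewrite sqrtr_gt0.
have cE : cU / Num.sqrt m%:R = 3 * Num.sqrt (2 * N0%:R / eps / m%:R).
  rewrite /cU [in RHS]sqrtrM; last by rewrite divr_ge0 ?mulr_ge0 ?ltW.
  by rewrite sqrtrV ?mulrA ?ltW.
rewrite cE; have [mN|Nm] := ltnP m N0.
  apply: (@le_trans _ _ 1).
    have /andP[_ h] := walk_mass x eta01 (fun l ls => gQ.1 l (hs l ls)).
    apply: le_trans h; apply: le_walk => [l ls|z]; first by case: (gQ.1 l (hs l ls)).
    by rewrite /bin; case: (_ <= _ < _).
  have : 1 <= Num.sqrt (2 * N0%:R / eps / m%:R).
    rewrite -{1}[1]sqrtr1 ler_sqrt; last by rewrite !divr_ge0 ?mulr_ge0 ?ltW.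
    rewrite ler_pdivlMr // mul1r ler_pdivlMr //.
    have : m%:R < N0%:R :> R by rewrite ltr_nat.
    nra.
  lra.
have [bs [sE sz hbs]] := admissible_blocks gQ Nm hs; rewrite -/m in sz.
set M := size bs in sz; set k0 := Num.truncn (eps * M%:R / 4).
have M_gt0 : (0 < M)%N by rewrite sz divn_gt0.
have M0 : 0 < M%:R :> R by rewrite ltr0n.
have mM : m%:R <= 2 * N0%:R * M%:R :> R.
  by rewrite -!natrM ler_nat sz leq_double_divn // N0_gt0.
have eM : 0 < eps * M%:R by rewrite mulr_gt0.
pose q := Num.sqrt (eps * M%:R).
have q0 : 0 < q by rewrite sqrtr_gt0.
have qq : q ^+ 2 = eps * M%:R by rewrite sqr_sqrtr // ltW.
(* up to k0 extracted steps the trivial bound 1, beyond it the binomial one *)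
have b1 k x' : iter k lazy (bin y) x' <= 2 / q + 2 ^+ k0 / 2 ^+ k.
  apply: (le_trans (iter_lazy_bin_le k y x')).
  have [kk|kk] := ltnP k k0.
    apply: (@le_trans _ _ 1).
      rewrite -{2}[1]invr1 lef_pV2 ?posrE ?sqrtr_gt0 //.
      by rewrite -[leLHS]sqrtr1 ler_sqrt // ler1n.
    have : 1 <= 2 ^+ k0 / 2 ^+ k :> R.
      rewrite ler_pdivlMr ?exprn_gt0 // mul1r.
      by rewrite ler_weXn2l ?ler1n // ltnW.
    have : 0 < 2 / q by rewrite divr_gt0.
    lra.
  have : 0 <= 2 ^+ k0 / 2 ^+ k :> R by rewrite divr_ge0 ?exprn_ge0.
  suff : (Num.sqrt k.+1%:R)^-1 <= 2 / q :> R by lra.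
  have sk0 : 0 < Num.sqrt k.+1%:R :> R by rewrite sqrtr_gt0.
  rewrite ler_pdivlMr // mulrC ler_pdivrMr // /q.
  rewrite -[2]gtr0_norm // -sqrtr_sqr -sqrtrM ?sqr_ge0 // ler_sqrt ?mulr_ge0 ?sqr_ge0 //.
  have : eps * M%:R / 4 < k.+1%:R.
    apply: lt_le_trans (truncnS_gt _) _; by rewrite ler_nat.
  lra.
have e01 : 0 <= eps <= 1 by rewrite ltW.
have pow0 : 0 <= 2 ^+ k0 :> R by rewrite exprn_ge0.
have b0 : 0 <= 2 / q by rewrite divr_ge0 ?ltW.
have := smoothing_upper eta01 e01 pow0 b0 b1 hbs 0 x.
rewrite -sE /= expr0 divr1 -/M => h.
apply: (le_trans h).
apply: (@le_trans _ _ (3 / q)).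
  have : 2 ^+ k0 * (1 - eps / 2) ^+ M <= q^-1.
    apply: (le_trans (decay_bound M)); rewrite -qq lef_pV2 ?posrE //; last first.
      by rewrite ltr_wpDr // divr_ge0 // sqr_ge0.
    have := sqr_ge0 (q / 2 - 1); lra.
  lra.
rewrite ler_pM2l // /q -sqrtrV; last exact: ltW.
rewrite ler_sqrt; last by rewrite !divr_ge0 ?mulr_ge0 ?ltW.
rewrite ler_pdivlMr // mulrC ler_pdivrMr //.
have -> : 2 * N0%:R / eps * (eps * M%:R) = 2 * N0%:R * M%:R by field; rewrite gt_eqF.
exact: mM.
Qed.

(** The parabola of [smoothing_lower] has squared radius [bL * M] for [M]
    blocks; the factor [24] leaves a Chebyshev loss of at most [1 / 4]. *)
Definition bL : R := 24 * N0%:R * (s2 + 2).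
Definition cL : R := expR (- (16 * (bL + 1) / eps)) / 8.
Definition mL : R := 2 * N0%:R * (16 * (Num.sqrt bL + 1) / eps) ^+ 2.

(** With probability bounded below the smoothing steps are at least
    [eps * M / 4] in number and the other steps end within distance of order
    [sqrt n] of [y]; the binomial lower bound covers what remains. *)
Lemma local_lower eta Q s x y : 0 <= eta <= 1 -> admissible eta Q ->
  (forall l, l \in s -> Q l) -> mL <= (size s)%:R ->
  8 * (size s)%:R * eta <= 1 -> (x - y) ^+ 2 <= (size s)%:R ->
  cL / Num.sqrt (size s)%:R <= walk predT s (bin y) x.
Proof.
move=> eta01 gQ hs mm0 m_eta xym; have [e0 e1] := andP eps01.
have [eta0 eta1] := andP eta01.
have N0' : 1 <= N0%:R :> R by rewrite ler1n.
have s2' := s2_ge0.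
have b0 : 0 < bL by rewrite /bL !mulr_gt0 //; lra.
set m := size s in mm0 m_eta xym *.
have sb0 : 0 < Num.sqrt bL by rewrite sqrtr_gt0.
set r0 := 16 * (Num.sqrt bL + 1) / eps.
have r0_gt : 16 < r0 by rewrite /r0 ltr_pdivlMr //; nra.
have mm0' : 2 * N0%:R * r0 ^+ 2 <= m%:R by exact: mm0.
have r02 : 1 <= r0 ^+ 2 by nra.
have Nr : N0%:R * 1 <= N0%:R * r0 ^+ 2 by rewrite ler_wpM2l.
have Nm : (N0 <= m)%N by rewrite -(ler_nat R); lra.
have m0 : 0 < m%:R :> R by lra.
have [bs [sE sz hbs]] := admissible_blocks gQ Nm hs; rewrite -/m in sz.
set M := size bs in sz; set k0 := Num.truncn (eps * M%:R / 4).
have mM : m%:R <= 2 * N0%:R * M%:R :> R.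
  by rewrite -!natrM ler_nat sz leq_double_divn // N0_gt0.
have Mm : M%:R <= m%:R :> R by rewrite ler_nat sz leq_div.
have r0M : r0 ^+ 2 <= M%:R.
  have : 0 < 2 * N0%:R :> R by lra.
  by move=> h; rewrite -(ler_pM2l h); apply: le_trans mm0' _.
have M0 : 0 < M%:R :> R by nra.
pose r := Num.sqrt (M%:R : R).
have rM : r ^+ 2 = M%:R by rewrite sqr_sqrtr // ltW.
have r0r : r0 <= r by rewrite -[r0]gtr0_norm -?sqrtr_sqr ?ler_sqrt // ?ltW //; lra.
have r_gt : 16 < r by lra.
pose A := Num.sqrt bL * r.
have AA : A ^+ 2 = bL * M%:R by rewrite /A exprMn rM sqr_sqrtr // ltW.
have er : 16 * (Num.sqrt bL + 1) <= eps * r.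
  by rewrite [eps * r]mulrC -ler_pdivrMr.
have A0 : 0 <= A by rewrite mulr_ge0 ?ltW //; lra.
have Ak k : (k0 < k)%N -> 2 * (A + 1) <= k%:R /\ eps * M%:R / 4 <= k%:R.
  move=> kk.
  have : eps * M%:R / 4 < k%:R.
    by apply: lt_le_trans (truncnS_gt _) _; rewrite ler_nat.
  rewrite -rM => h; split; last exact: ltW.
  apply: le_trans (ltW h); rewrite /A; nra.
pose be := expR (- (16 * (bL + 1) / eps)) / (2 * r).
have r_gt0 : 0 < r by lra.
have be0 : 0 <= be by rewrite divr_ge0 ?expR_ge0 // mulr_ge0 // ltW.
have B0 : 0 < bL * M%:R by rewrite mulr_gt0.
have hyp k x' : (k <= M)%N ->
    be * (1 - (x' - y) ^+ 2 / (bL * M%:R) - 2 ^+ k0 / 2 ^+ k) <= iter k lazy (bin y) x'.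
  move=> kM; have it0 : 0 <= iter k lazy (bin y) x'.
    rewrite iter_lazy; apply: sumr_ge0 => i _.
    by rewrite mulr_ge0 ?bin_ge0 // divr_ge0 // exprn_ge0.
  have p0 : 0 <= 2 ^+ k0 / 2 ^+ k :> R by rewrite divr_ge0 ?exprn_ge0.
  have q0 : 0 <= (x' - y) ^+ 2 / (bL * M%:R) by rewrite divr_ge0 ?sqr_ge0 // ltW.
  (* for few extracted steps, or far from y, the left-hand side is nonpositive *)
  have [kk|kk] := leqP k k0.
    have p1 : 1 <= 2 ^+ k0 / 2 ^+ k :> R.
      by rewrite ler_pdivlMr ?exprn_gt0 // mul1r ler_weXn2l // ler1n.
    by apply: le_trans it0; rewrite mulr_ge0_le0 //; lra.
  have [xB|xB] := lerP (bL * M%:R) ((x' - y) ^+ 2).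
    have q1 : 1 <= (x' - y) ^+ 2 / (bL * M%:R) by rewrite ler_pdivlMr // mul1r.
    by apply: le_trans it0; rewrite mulr_ge0_le0 //; lra.
  have [Ak1 Ak2] := Ak k kk.
  have xA : `|x' - y| <= A.
    by rewrite -ler_sqr ?nnegrE // real_normK ?num_real // AA ltW.
  have k_gt0 : (0 < k)%N by apply: leq_ltn_trans kk.
  have kR0 : 0 < k%:R :> R by rewrite ltr0n.
  apply: le_trans (iter_lazy_bin_ge k_gt0 xA Ak1).
  apply: (@le_trans _ _ be); first by rewrite ler_piMr //; lra.
  rewrite /be mulrC; apply: ler_pM; rewrite ?expR_ge0 ?invr_ge0 ?mulr_ge0 ?(ltW r_gt0) //.
    rewrite lef_pV2 ?posrE ?mulr_gt0 ?sqrtr_gt0 //.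
    by rewrite ler_pM2l // /r ler_sqrt ?ler_nat // ltW.
  rewrite ler_expR lerN2 ler_pdivrMr //.
  apply: (@le_trans _ _ (16 * (bL + 1) / eps * (eps * M%:R / 4))); last first.
    rewrite ler_wpM2l // divr_ge0 ?mulr_ge0 ?ltW //; lra.
  have -> : 16 * (bL + 1) / eps * (eps * M%:R / 4) = 4 * (bL * M%:R + M%:R).
    by field; rewrite gt_eqF.
  rewrite -AA; have := sqr_ge0 (A - 1); have : 1 <= M%:R :> R by exact: le_trans r02 r0M.
  lra.
have pow0 : 0 <= 2 ^+ k0 :> R by rewrite exprn_ge0.
have e01 : 0 <= eps <= 1 by rewrite ltW.
have := smoothing_lower s2_ge0 eta01 e01 pow0 be0 B0 hyp hbs (k := 0) x (leqnn M).
rewrite -sE /= expr0 divr1 -/m -/M.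
apply: le_trans.
clear gQ hs hbs sE hyp Ak mm0 mm0' Nr Nm sz AA r0r.
have hE : (1 + eta) ^+ m <= 3.
  apply: (@le_trans _ _ (expR (m%:R * eta))).
    rewrite expRM_natl lerXn2r ?nnegrE ?expR_ge0 ?expR_ge1Dx //; lra.
  have e8 : expR (m%:R * eta) <= expR (8^-1 : R) by rewrite ler_expR; lra.
  apply: (le_trans e8); have := expR_ge1Dx (- 8^-1 : R); rewrite expRN => h8.
  have e8' := expR_gt0 (8^-1 : R).
  have : expR (8^-1) * (1 - 8^-1) <= expR (8^-1) * (expR 8^-1)^-1 :> R.
    by rewrite ler_pM2l.
  rewrite mulfV ?gt_eqF //; lra.
have hq : (1 + eta) ^+ m * ((x - y) ^+ 2 + (s2 + 1) * m%:R) / (bL * M%:R) <= 1 / 4.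
  rewrite ler_pdivrMr //.
  apply: (@le_trans _ _ (3 * ((s2 + 2) * (2 * N0%:R * M%:R)))).
    apply: ler_pM => //.
    - by rewrite exprn_ge0 //; lra.
    - by rewrite addr_ge0 ?sqr_ge0 // mulr_ge0 ?ltW //; lra.
    - have := ler_wpM2l (addr_ge0 s2' (ler0n R 1)) mM; lra.
  by rewrite /bL; lra.
have hd : 2 ^+ k0 * (1 - eps / 2) ^+ M <= 1 / 4.
  have eM : 16 * 16 <= eps * M%:R by rewrite -rM; nra.
  apply: (le_trans (decay_bound M)).
  by rewrite -div1r ler_pdivrMr; lra.
apply: (@le_trans _ _ (be * (1 / 4))); last first.
  rewrite ler_wpM2l //; lra.
have -> : be * (1 / 4) = cL / r by rewrite /be /cL; field; rewrite gt_eqF.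
rewrite ler_wpM2l ?divr_ge0 ?expR_ge0 // lef_pV2 ?posrE ?sqrtr_gt0 //.
by rewrite /r ler_sqrt // ltW.
Qed.

End LocalBounds.

(** * Steering through a moving tube *)

Section Subsolutions.
Context {R : realType}.
Implicit Types (l : @law R) (s t : seq (@law R)) (x y z : R).

(** A profile supported in [-1, 1] whose second derivative is positive near
    both ends of the support: there diffusion outweighs the drift of a moving
    centre, so that the profile can be transported. *)
Definition bump_fun (t : R) : R :=
  if t ^+ 2 <= 1 then (1 - t ^+ 2) * (2 - t ^+ 2) else 0.

Lemma bump_fun_ge0 (t : R) : 0 <= bump_fun t.
Proof.
rewrite /bump_fun; case: ifP => // h.
have := sqr_ge0 t; move: h; set q := t ^+ 2 => h h'; nra.
Qed.

Lemma bump_fun_le2 (t : R) : bump_fun t <= 2.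
Proof.
rewrite /bump_fun; case: ifP => // h.
have := sqr_ge0 t; move: h; set q := t ^+ 2 => h h'; nra.
Qed.

(** For [(t + e) ^+ 2 <= 2] the polynomial of degree four defining [bump_fun]
    still minorizes it, and its expansion is exact; a larger displacement has
    [`|e| >= 4 / 10], and then the cubic term outweighs all others. *)
Lemma bump_fun_taylor (t e : R) : t ^+ 2 <= 1 ->
  bump_fun t + (4 * t ^+ 3 - 6 * t) * e + (6 * t ^+ 2 - 3) * e ^+ 2
    - 110 * `|e| ^+ 3 <= bump_fun (t + e).
Proof.
move=> t1; rewrite {1}/bump_fun t1.
have tl : -1 <= t <= 1.
  by rewrite -ler_norml -[1]normr1 -ler_sqr ?nnegrE // !real_normK ?num_real // expr1n.
have [tl1 tl2] := andP tl.
set a := `|e|; have a0 : 0 <= a by exact: normr_ge0.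
have a2 : a ^+ 2 = e ^+ 2 by rewrite real_normK ?num_real.
have a3 : 0 <= a ^+ 3 by rewrite exprn_ge0.
have te : - a ^+ 3 <= t * e ^+ 3 <= a ^+ 3.
  rewrite -ler_norml normrM normrX -/a ler_piMl //.
  by rewrite ler_norml.
have [h|h] := lerP ((t + e) ^+ 2) 2.
  apply: (@le_trans _ _ ((1 - (t + e) ^+ 2) * (2 - (t + e) ^+ 2))).
    have : 0 <= e ^+ 4 by rewrite -[4%N]/(2 * 2)%N exprM sqr_ge0.
    have [te1 te2] := andP te.
    have -> : (1 - (t + e) ^+ 2) * (2 - (t + e) ^+ 2) =
      (1 - t ^+ 2) * (2 - t ^+ 2) + (4 * t ^+ 3 - 6 * t) * e +
      (6 * t ^+ 2 - 3) * e ^+ 2 + 4 * (t * e ^+ 3) + e ^+ 4 by ring.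
    lra.
  rewrite /bump_fun; case: ifP => // /negbT; rewrite -ltNge => h'.
  by move: h h'; set q := (t + e) ^+ 2 => h h'; nra.
apply: le_trans (bump_fun_ge0 _).
have ea : e <= a /\ - e <= a by rewrite /a ler_norm -normrN ler_norm.
have [ea1 ea2] := ea.
have a4 : 4 / 10 <= a.
  rewrite leNgt; apply/negP => a4; have : (t + e) ^+ 2 < 2 by nra.
  by rewrite ltNge ltW.
have b1 : (1 - t ^+ 2) * (2 - t ^+ 2) <= 2.
  have := sqr_ge0 t; move: t1; set q := t ^+ 2 => h1 h2; nra.
have b2 : (4 * t ^+ 3 - 6 * t) * e <= 10 * a.
  apply: le_trans (ler_norm _) _; rewrite normrM -/a ler_wpM2r //.
  have t3 : -1 <= t ^+ 3 <= 1.
    by rewrite -ler_norml normrX exprn_ile1 // ler_norml.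
  rewrite ler_norml; lra.
have b3 : (6 * t ^+ 2 - 3) * e ^+ 2 <= 3 * a ^+ 2.
  rewrite a2 ler_wpM2r ?sqr_ge0 //; lra.
have c2 : 4 / 10 * a ^+ 2 <= a ^+ 3.
  by rewrite [a ^+ 3]exprS ler_wpM2r ?sqr_ge0.
have c1 : 4 / 10 * a <= a ^+ 2.
  by rewrite [a ^+ 2]expr2 ler_wpM2r.
lra.
Qed.

Variables (s1 s2 c3 : R).
Hypotheses (s1_gt0 : 0 < s1) (s2_ge0 : 0 <= s2) (c3_gt0 : 0 < c3).

(** The slope [s1 / 20] is small enough for the drift term, at most
    [10 * tube_slope], to be half of [s1], the least variance. *)
Definition tube_slope : R := s1 / 20.
(** In units of [w ^- 3]: the quadratic term of the drift, then [440] for the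
    cubic term of the drift, [500] for the defects of mass and mean, and
    [440 * c3] for the third moment, where [440] is four times the constant
    [110] of [bump_fun_taylor]. *)
Definition tube_err : R := 3 * tube_slope ^+ 2 + 940 + 440 * c3.
Definition tube_rate : R := 4 * (3 * s2 + 10 * tube_slope + tube_err).
Definition tube_width : R := 1 + tube_slope + tube_err / s1.

Lemma combine_bounds (g a b c A B C : R) : `|a| <= A -> `|b| <= B -> `|c| <= C ->
  g - A - B - C <= g - a + b - c /\ `|g - a + b - c| <= `|g| + A + B + C.
Proof.
move=> ha hb hc; split.
  move: ha hb hc; rewrite !ler_norml => /andP[? ?] /andP[? ?] /andP[? ?]; lra.
apply: (le_trans (ler_normB _ _)); apply: lerD => //.
apply: (le_trans (ler_normD _ _)); apply: lerD => //.
by apply: (le_trans (ler_normB _ _)); apply: lerD.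
Qed.

(** Near the ends of the support, [q >= 3 / 4], the second derivative pays
    for drift and errors; in the middle the profile is bounded below and the
    rate pays for everything. *)
Lemma tube_arith (q m v : R) (g := (1 - q) * (2 - q)) :
  0 <= q <= 1 -> s1 <= m <= s2 -> 0 < v <= 1 -> tube_err * v <= s1 ->
  0 <= tube_err ->
  (1 - tube_rate * v ^+ 2) * g <= g - 10 * tube_slope * v ^+ 2
     + (6 * q - 3) * m * v ^+ 2 - tube_err * v * v ^+ 2.
Proof.
have p1 := s1_gt0; have p2 := s2_ge0.
move=> /andP[q0 q1] /andP[m1 m2] /andP[v0 v1] Cv C0.
have k0 : 0 < tube_slope by rewrite /tube_slope divr_gt0.
have v2 : 0 <= v ^+ 2 by exact: sqr_ge0.
have g0 : 0 <= g by rewrite /g mulr_ge0 //; lra.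
have rate0 : 0 <= tube_rate by rewrite /tube_rate; lra.
have kE : 20 * tube_slope = s1 by rewrite /tube_slope; field.
have [ht|ht] := lerP (3 / 4) q.
  have h1 : 3 / 2 * s1 <= (6 * q - 3) * m.
    apply: ler_pM => //; lra.
  have h2 : 0 <= (6 * q - 3) * m - 10 * tube_slope - tube_err * v.
    lra.
  have := mulr_ge0 h2 v2; have := mulr_ge0 (mulr_ge0 rate0 v2) g0.
  lra.
have gg : 5 / 16 <= g by rewrite /g; nra.
have h1 : - 3 * s2 <= (6 * q - 3) * m.
  have : 0 <= 6 * q * m by rewrite !mulr_ge0 //; lra.
  lra.
have h2 : tube_err * v <= tube_err by rewrite ler_piMr // ltW.
have h3 : 0 <= (6 * q - 3) * m + 3 * s2 + tube_err - tube_err * v.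
  lra.
have h4 : 0 <= (3 * s2 + 10 * tube_slope + tube_err) * (4 * g - 1).
  apply: mulr_ge0; lra.
have := mulr_ge0 h3 v2; have := mulr_ge0 h4 v2.
rewrite /tube_rate; lra.
Qed.

Lemma tube_step eta l (t b w : R) : regular s1 s2 c3 eta l -> t ^+ 2 <= 1 ->
  tube_width <= w -> `|b| * w <= tube_slope -> 0 <= eta -> eta * w ^+ 3 <= 1 ->
  (1 - tube_rate / w ^+ 2) * bump_fun t
    <= step l (fun d => bump_fun (t + (d - b) / w)).
Proof.
move=> rl t1 ww bw eta0 etaw.
have p1 := s1_gt0; have p2 := s2_ge0; have p3 := c3_gt0.
have k0 : 0 < tube_slope by rewrite /tube_slope divr_gt0.
have C0 : 0 < tube_err.
  by rewrite /tube_err; have := sqr_ge0 tube_slope; lra.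
have w1 : 1 + tube_slope + tube_err / s1 <= w by exact: ww.
have C1 : 0 < tube_err / s1 by rewrite divr_gt0.
have w0 : 0 < w by lra.
set v := w^-1; have v0 : 0 < v by rewrite invr_gt0.
have v1 : v <= 1 by rewrite invf_le1 //; lra.
have vw : v * w = 1 by rewrite mulVf // gt_eqF.
have bk : `|b| <= tube_slope * v by rewrite ler_pdivlMr.
have b1 : `|b| <= 1.
  apply: (le_trans bk); rewrite -vw mulrC ler_wpM2l ?ltW //; lra.
have Cv : tube_err * v <= s1.
  rewrite ler_pdivrMr // mulrC -ler_pdivrMr //; lra.
have etav : eta <= v ^+ 3 by rewrite exprVn -div1r ler_pdivlMr // exprn_gt0.
have [bl bu] : - `|b| <= b /\ b <= `|b| by rewrite ler_norm lerNl -normrN ler_norm.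
have tl : -1 <= t <= 1.
  by rewrite -ler_norml -[1]normr1 -ler_sqr ?nnegrE // !real_normK ?num_real // expr1n.
set g := bump_fun t; have g2 : g <= 2 by exact: bump_fun_le2.
have g0 : 0 <= g by exact: bump_fun_ge0.
set g' := 4 * t ^+ 3 - 6 * t; set g'' := 6 * t ^+ 2 - 3.
have g'10 : `|g'| <= 10.
  have t3 : -1 <= t ^+ 3 <= 1.
    by rewrite -ler_norml normrX exprn_ile1 // ler_norml.
  rewrite ler_norml /g'; lra.
have g''3 : -3 <= g'' <= 3 by rewrite /g''; have := sqr_ge0 t; lra.
pose al := g - g' * b * v + g'' * b ^+ 2 * v ^+ 2 - 440 * `|b| ^+ 3 * v ^+ 3.
pose be := g' * v - 2 * g'' * b * v ^+ 2.
pose ga := g'' * v ^+ 2.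
pose ka := 440 * v ^+ 3.
have v3 : 0 <= v ^+ 3 by rewrite exprn_ge0 ?ltW.
have ka0 : 0 <= ka by rewrite /ka mulr_ge0.
have hf d : al + be * d + ga * d ^+ 2 - ka * `|d| ^+ 3 <= bump_fun (t + (d - b) / w).
  apply: le_trans (bump_fun_taylor _ t1); rewrite -/g -/g' -/g'' -/v.
  (* convexity of the cube splits jump and drift *)
  have h3 : `|(d - b) * v| ^+ 3 <= 4 * (`|d| ^+ 3 + `|b| ^+ 3) * v ^+ 3.
    rewrite normrM (gtr0_norm v0) exprMn ler_wpM2r //.
    apply: (@le_trans _ _ ((`|d| + `|b|) ^+ 3)).
      by rewrite lerXn2r ?nnegrE ?addr_ge0 // ler_normB.
    have d0 := normr_ge0 d; have b0 := normr_ge0 b.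
    have : 0 <= (`|d| + `|b|) * (`|d| - `|b|) ^+ 2.
      by rewrite mulr_ge0 ?sqr_ge0 ?addr_ge0.
    set A := `|d|; set B := `|b|; lra.
  have -> : al + be * d + ga * d ^+ 2 - ka * `|d| ^+ 3 =
    g + g' * ((d - b) * v) + g'' * ((d - b) * v) ^+ 2
      - 110 * (4 * (`|d| ^+ 3 + `|b| ^+ 3) * v ^+ 3).
    by rewrite /al /be /ga /ka; ring.
  lra.
apply: le_trans (step_lower rl ka0 hf).
have [_ _ _ /andP[m1 m2] _] := rl; set m := step l _ in m1 m2 *.
have v2 : 0 <= v ^+ 2 by exact: sqr_ge0.
have v21 : v ^+ 2 <= 1 by rewrite exprn_ile1 // ltW.
have v31 : v ^+ 3 <= 1 by rewrite exprn_ile1 // ltW.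
have v32 : v ^+ 3 = v * v ^+ 2 by rewrite exprS.
have q1 : `|g' * b * v| <= 10 * tube_slope * v ^+ 2.
  rewrite !normrM (gtr0_norm v0) expr2 mulrA ler_wpM2r ?(ltW v0) //.
  rewrite -mulrA; exact: ler_pM.
have b2 : b ^+ 2 <= 1.
  by rewrite -[b ^+ 2]real_normK ?num_real // exprn_ile1.
have b2' : b ^+ 2 <= tube_slope ^+ 2 * v.
  have : b ^+ 2 <= (tube_slope * v) ^+ 2.
    by rewrite -[b ^+ 2]real_normK ?num_real // lerXn2r ?nnegrE // mulr_ge0 ?ltW.
  move=> h; apply: (le_trans h); rewrite exprMn ler_wpM2l ?sqr_ge0 // expr2.
  by rewrite ler_piMr // ltW.
have b3 : `|b| ^+ 3 <= 1 by rewrite exprn_ile1.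
have b30 : 0 <= `|b| ^+ 3 by rewrite exprn_ge0.
have q2 : `|g'' * b ^+ 2 * v ^+ 2| <= 3 * tube_slope ^+ 2 * v ^+ 3.
  rewrite 2!normrM (ger0_norm v2) (ger0_norm (sqr_ge0 b)) v32 [leRHS]mulrA.
  rewrite ler_wpM2r // -[leRHS]mulrA; apply: ler_pM => //; first exact: sqr_ge0.
  by rewrite ler_norml.
have q2' : `|g'' * b ^+ 2 * v ^+ 2| <= 3.
  rewrite 2!normrM (ger0_norm v2) (ger0_norm (sqr_ge0 b)) -mulrA.
  rewrite -[3]mulr1; apply: ler_pM => //.
  - by rewrite mulr_ge0 // sqr_ge0.
  - by rewrite ler_norml.
  - by rewrite mulr_ile1 // sqr_ge0.
have q3 : `|g' * b * v| <= 10.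
  rewrite !normrM (gtr0_norm v0) -mulrA -[10]mulr1; apply: ler_pM => //.
    by rewrite mulr_ge0 // ltW.
  by rewrite mulr_ile1 // ltW.
have q4 : `|440 * `|b| ^+ 3 * v ^+ 3| <= 440 * v ^+ 3.
  rewrite ger0_norm; last by rewrite mulr_ge0 // mulr_ge0.
  by rewrite ler_wpM2r // ler_piMr.
have v3' : 440 * v ^+ 3 <= 440 by rewrite ler_piMr.
have al_le : `|al| <= 2 + 10 + 3 + 440.
  have [_ h] := combine_bounds g q3 q2' (le_trans q4 v3').
  apply: (le_trans h); by rewrite (ger0_norm g0) !lerD2r.
have be_le : `|be| <= 10 + 6.
  have : `|g' * v| <= 10.
    by rewrite normrM (gtr0_norm v0) -[10]mulr1; apply: ler_pM => //; exact: ltW.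
  have : `|2 * g'' * b * v ^+ 2| <= 6.
    rewrite 3!normrM (ger0_norm v2) -mulrA -[6]mulr1; apply: ler_pM => //.
    - by rewrite mulr_ge0.
    - by rewrite mulr_ge0.
    - rewrite ger0_norm //.
      have : `|g''| <= 3 by rewrite ler_norml.
      lra.
    - by rewrite mulr_ile1.
  by move=> h6 h10; apply: (le_trans (ler_normB _ _)); exact: lerD.
have err : (`|al| + `|be|) * eta <= 500 * v ^+ 3.
  apply: ler_pM => //; [exact: addr_ge0 |].
  by apply: (le_trans (lerD al_le be_le)); rewrite -!natrD ler_nat.
have al_ge := (combine_bounds g q1 q2 q4).1.
clear hf al_le be_le q1 q2 q2' q3 q4 v3' g'10 b2 b2' b3 b30 bk bl bu tl w1 ww bw etaw.
have main : g - 10 * tube_slope * v ^+ 2 + g'' * m * v ^+ 2 - tube_err * v * v ^+ 2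
    <= al - (`|al| + `|be|) * eta + ga * m - ka * c3.
  rewrite -(mulrA tube_err) -v32 /ga /ka /tube_err; rewrite -/al in al_ge; lra.
apply: le_trans main; rewrite -exprVn -/v.
have := @tube_arith (t ^+ 2) m v; rewrite /g /bump_fun t1; apply => //.
- by rewrite sqr_ge0.
- by rewrite m1.
- by rewrite v0.
- exact: ltW.
Qed.

(** A tube of width [w] whose centre moves at a speed at most
    [tube_slope / w] retains a fraction [1 - tube_rate / w ^+ 2] of the
    profile per step: the speed costs nothing beyond the diffusive rate. The
    profile vanishes outside the half-line since the centre stays above [w],
    so that killing never acts on it. *)
Lemma walk_tube eta s (c x b w : R) :
  (forall l, l \in s -> regular s1 s2 c3 eta l) ->
  tube_width <= w -> `|b| * w <= tube_slope -> 0 <= eta -> eta * w ^+ 3 <= 1 ->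
  tube_rate / w ^+ 2 <= 1 ->
  (forall i, (i <= size s)%N -> w <= c + b * i%:R) ->
  (1 - tube_rate / w ^+ 2) ^+ size s * bump_fun ((x - c) / w) <=
  walk pos s (fun z => bump_fun ((z - (c + b * (size s)%:R)) / w)) x.
Proof.
move=> + ww bw eta0 etaw rate1; elim: s c x => [|l s IH] c x hs hc /=.
  by rewrite mulr0 addr0 mul1r.
have p1 := s1_gt0; have p3 := c3_gt0.
have w0 : 0 < w.
  have k0 : 0 <= tube_slope by rewrite /tube_slope divr_ge0 // ltW.
  have C0 : 0 <= tube_err.
    by rewrite /tube_err; have := sqr_ge0 tube_slope; lra.
  have C1 : 0 <= tube_err / s1 by rewrite divr_ge0 // ltW.
  by apply: lt_le_trans ww; rewrite /tube_width; lra.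
have rl : regular s1 s2 c3 eta l by apply: hs; rewrite mem_head.
have hs' l' : l' \in s -> regular s1 s2 c3 eta l'.
  by move=> h; apply: hs; rewrite inE h orbT.
have l0 : nneg l by case: rl.
set rho := 1 - _; have rho0 : 0 <= rho by rewrite /rho subr_ge0.
have [ht|ht] := lerP (((x - c) / w) ^+ 2) 1; last first.
  have -> : bump_fun ((x - c) / w) = 0 by rewrite /bump_fun leNgt ht.
  rewrite mulr0; apply: step_ge0 => // d.
  rewrite mulr_ge0 //; apply: walk_ge0 => [l' /hs'[]//|z]; exact: bump_fun_ge0.
have := tube_step rl ht ww bw eta0 etaw; rewrite -/rho => hstep.
apply: (@le_trans _ _ (rho ^+ size s * step l (fun d => bump_fun ((x - c) / w + (d - b) / w)))).
  by rewrite exprSr -mulrA ler_wpM2l // exprn_ge0.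
rewrite -stepZ; apply: le_step => // d.
have -> : (x - c) / w + (d - b) / w = (x + d - (c + b)) / w by field; rewrite gt_eqF.
have e : c + b * (size s).+1%:R = c + b + b * (size s)%:R.
  by rewrite -natr1; ring.
have [xd|xd] := boolP (pos (x + d)).
  rewrite mul1r e; apply: IH => // i i_s.
  have := hc i.+1 i_s; rewrite -natr1; lra.
rewrite mul0r; suff -> : bump_fun ((x + d - (c + b)) / w) = 0 by rewrite mulr0.
rewrite /bump_fun; case: ifP => //; rewrite exprMn exprVn ler_pdivrMr ?exprn_gt0 //.
move: xd; rewrite /pos -ltNge mul1r => xd h.
have := hc 1%N isT; rewrite mulr1 => hc1.
have : w ^+ 2 < (x + d - (c + b)) ^+ 2.
  by rewrite -[ltRHS]sqrrN ltr_sqr ?nnegrE; lra.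
by rewrite ltNge h.
Qed.

End Subsolutions.

(** * Entrance from the boundary *)

Section Entrance.
Context {R : realType}.
Implicit Types (l : @law R) (s t : seq (@law R)) (x y z : R).

Variables (s1 s2 c3 : R).
Hypotheses (s1_gt0 : 0 < s1) (c3_gt0 : 0 < c3).

(** A convex parabola on the interval from [- H] to [H], zero at [- H] and
    [0] and one at [H], cut off outside: it is nonpositive where the walk is
    killed, and its convexity makes it grow on average. *)
Definition entrance_fun (H x : R) : R :=
  if x ^+ 2 <= H ^+ 2 then (x / H + (x / H) ^+ 2) / 2 else 0.

(** Maximum over [tau] of [tau * s1 - tau ^+ 2 * c3 / 2], a lower bound for
    the mean of the positive part of a step. *)
Definition entrance_gain : R := s1 ^+ 2 / (2 * c3).
Definition entrance_cst : R := Num.min 1 entrance_gain / 8.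
Definition entrance_scale : R :=
  1 + (8 + 32 * c3) / s1 + 8 * (1 + 3 * c3) / entrance_gain.

Lemma entrance_fun_le1 H x : 0 < H -> entrance_fun H x <= 1.
Proof.
move=> H0; rewrite /entrance_fun; case: ifP => // h.
have : (x / H) ^+ 2 <= 1.
  by rewrite exprMn exprVn ler_pdivrMr ?exprn_gt0 // mul1r.
set q := x / H => q1; have := sqr_ge0 (q - 1); lra.
Qed.

Lemma entrance_fun_le0 H x : 0 < H -> x <= 0 -> entrance_fun H x <= 0.
Proof.
move=> H0 x0; rewrite /entrance_fun; case: ifP => // h.
have : (x / H) ^+ 2 <= 1.
  by rewrite exprMn exprVn ler_pdivrMr ?exprn_gt0 // mul1r.
have : x / H <= 0 by rewrite pmulr_lle0 ?invr_gt0.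
set q := x / H => q0 q1; nra.
Qed.

Lemma entrance_fun_gt H x : 0 < H -> H < x -> entrance_fun H x = 0.
Proof.
move=> H0 Hx; rewrite /entrance_fun ifF //; apply/negbTE.
by rewrite -ltNge ltr_sqr ?nnegrE ?ltW // (lt_trans H0).
Qed.

(** The second derivative [H ^- 2] yields a gain [s1 / (2 * H ^+ 2)], of
    which half is left for the errors. *)
Lemma entrance_step eta l H x : regular s1 s2 c3 eta l ->
  entrance_scale <= H -> 0 <= eta -> eta * H ^+ 3 <= 1 -> 0 <= x <= H / 2 ->
  entrance_fun H x + s1 / (4 * H ^+ 2) <= step l (fun d => entrance_fun H (x + d)).
Proof.
move=> rl HH eta0 etaH /andP[x0 xH].
have p1 := s1_gt0; have p3 := c3_gt0.
have gain0 : 0 < entrance_gain by rewrite divr_gt0 ?exprn_gt0 ?mulr_gt0.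
have H1 : 1 + (8 + 32 * c3) / s1 + 8 * (1 + 3 * c3) / entrance_gain <= H by [].
have r1 : 0 < (8 + 32 * c3) / s1 by rewrite divr_gt0 //; lra.
have r2 : 0 < 8 * (1 + 3 * c3) / entrance_gain by rewrite divr_gt0 //; lra.
have H0 : 0 < H by lra.
set v := H^-1; have v0 : 0 < v by rewrite invr_gt0.
have vH : H * v = 1 by rewrite mulfV // gt_eqF.
have v1 : v <= 1 by rewrite invf_le1 //; lra.
have v2 : 0 <= v ^+ 2 by exact: sqr_ge0.
have v3 : 0 <= v ^+ 3 by rewrite exprn_ge0 ?ltW.
have etav : eta <= v ^+ 3 by rewrite exprVn -div1r ler_pdivlMr // exprn_gt0.
set q := x * v.
have q0 : 0 <= q by rewrite mulr_ge0 // ltW.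
have q2 : q <= 1 / 2 by rewrite /q ler_pdivrMr //; lra.
have ->: entrance_fun H x = (q + q ^+ 2) / 2.
  rewrite /entrance_fun ifT // lerXn2r ?nnegrE ?(ltW H0) //; lra.
pose al := (q + q ^+ 2) / 2; pose be := (1 / 2 + q) * v.
pose ga := v ^+ 2 / 2; pose ka := 8 * v ^+ 3.
have ka0 : 0 <= ka by rewrite /ka mulr_ge0.
have hf d : al + be * d + ga * d ^+ 2 - ka * `|d| ^+ 3 <= entrance_fun H (x + d).
  pose r := d * v.
  have -> : al + be * d + ga * d ^+ 2 - ka * `|d| ^+ 3 =
    ((q + r) + (q + r) ^+ 2) / 2 - 8 * `|r| ^+ 3.
    by rewrite /r normrM (gtr0_norm v0) /al /be /ga /ka; field.
  have r3 : 0 <= `|r| ^+ 3 by rewrite exprn_ge0.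
  have e : (x + d) / H = q + r by rewrite mulrDl.
  rewrite /entrance_fun e; case: ifP => [_|/negbT]; first lra.
  rewrite -ltNge => h.
  have {h} : 1 < (q + r) ^+ 2.
    by rewrite -e exprMn exprVn ltr_pdivlMr ?exprn_gt0 // mul1r.
  set a := `|r| in r3 *.
  have [ra1 ra2] : r <= a /\ - r <= a by rewrite /a ler_norm -normrN ler_norm.
  have a0 : 0 <= a by exact: normr_ge0.
  have a2 : a ^+ 2 = r ^+ 2 by rewrite real_normK ?num_real.
  move=> h; have a12 : 1 / 2 <= a.
    rewrite leNgt; apply/negP => a12; suff : (q + r) ^+ 2 <= 1 by lra.
    nra.
  have c2 : 1 / 2 * a ^+ 2 <= a ^+ 3.
    by rewrite [a ^+ 3]exprS ler_wpM2r ?sqr_ge0.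
  have c1 : 1 / 2 * a <= a ^+ 2 by rewrite [a ^+ 2]expr2 ler_wpM2r.
  have : (q + r) ^+ 2 <= 4 * a ^+ 2 by nra.
  lra.
have [_ _ _ /andP[m1 m2] _] := rl.
apply: le_trans (step_lower rl ka0 hf).
set m := step l _ in m1 m2 *.
have al0 : 0 <= al by rewrite /al divr_ge0 // addr_ge0 // sqr_ge0.
have al1 : al <= 1 by rewrite /al; nra.
have be0 : 0 <= be by rewrite /be mulr_ge0 ?(ltW v0) //; lra.
have be1 : be <= 1 by rewrite /be mulr_ile1 ?(ltW v0) //; lra.
have err : (`|al| + `|be|) * eta <= 2 * v ^+ 3.
  rewrite !ger0_norm //; apply: ler_pM => //; lra.
have -> : s1 / (4 * H ^+ 2) = s1 * v ^+ 2 / 4 by rewrite /v; field; rewrite gt_eqF.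
have hga : v ^+ 2 / 2 * s1 <= ga * m by rewrite ler_wpM2l // divr_ge0.
have Hs : (8 + 32 * c3) <= s1 * H by rewrite [s1 * H]mulrC -ler_pdivrMr //; lra.
have : 0 <= (s1 * H - (8 + 32 * c3)) * v ^+ 3 by rewrite mulr_ge0 //; lra.
have -> : (s1 * H - (8 + 32 * c3)) * v ^+ 3 =
   s1 * (H * v) * v ^+ 2 - (8 + 32 * c3) * v ^+ 3 by ring.
rewrite vH mulr1 -/al /ka; lra.
Qed.

(** The positive part of the first step has mean bounded below, which turns
    the harmonic value [u / H] into [(u + 1) / H] and gives a positive bound
    even at [u = 0]. *)
Lemma entrance_first eta l H u : regular s1 s2 c3 eta l ->
  entrance_scale <= H -> 0 <= eta -> eta * H ^+ 3 <= 1 -> 0 <= u <= H / 2 ->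
  entrance_cst * (u + 1) / H <=
  step l (fun d => (pos (u + d))%:R * entrance_fun H (u + d)).
Proof.
move=> rl HH eta0 etaH /andP[u0 uH].
have p1 := s1_gt0; have p3 := c3_gt0.
have gain0 : 0 < entrance_gain by rewrite divr_gt0 ?exprn_gt0 ?mulr_gt0.
have H1 : 1 + (8 + 32 * c3) / s1 + 8 * (1 + 3 * c3) / entrance_gain <= H by [].
have r1 : 0 < (8 + 32 * c3) / s1 by rewrite divr_gt0 //; lra.
have r2 : 0 < 8 * (1 + 3 * c3) / entrance_gain by rewrite divr_gt0 //; lra.
have H0 : 0 < H by lra.
set v := H^-1; have v0 : 0 < v by rewrite invr_gt0.
have vH : H * v = 1 by rewrite mulfV // gt_eqF.
have v1 : v <= 1 by rewrite invf_le1 //; lra.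
have v2 : 0 <= v ^+ 2 by exact: sqr_ge0.
have v3 : 0 <= v ^+ 3 by rewrite exprn_ge0 ?ltW.
have etav : eta <= v ^+ 3 by rewrite exprVn -div1r ler_pdivlMr // exprn_gt0.
set q := u * v.
have q0 : 0 <= q by rewrite mulr_ge0 // ltW.
have q2 : q <= 1 / 2 by rewrite /q ler_pdivrMr //; lra.
pose tau := s1 / c3; have tau0 : 0 < tau by rewrite divr_gt0.
pose al := q / 4; pose be := 3 / 8 * v.
pose ga := tau * v / 4; pose ka := tau ^+ 2 * v / 8 + 3 * v ^+ 3.
have ka0 : 0 <= ka.
  have h1 : 0 <= tau ^+ 2 * v by rewrite mulr_ge0 ?sqr_ge0 // ltW.
  by rewrite /ka; lra.
have hf d : al + be * d + ga * d ^+ 2 - ka * `|d| ^+ 3 <=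
   (pos (u + d))%:R * entrance_fun H (u + d).
  pose r := d * v.
  pose dp := Num.max d 0.
  have hd : d / 2 + tau * d ^+ 2 - tau ^+ 2 * `|d| ^+ 3 / 2 <= dp.
    have : (d + `|d|) / 2 <= dp.
      rewrite /dp; case: (leP d 0) => hd; first by rewrite (ler0_norm hd); lra.
      by rewrite (gtr0_norm hd); lra.
    (* the choice of tau balances second and third moments *)
    have : 0 <= `|d| * (1 - tau * `|d|) ^+ 2 by rewrite mulr_ge0 ?sqr_ge0.
    have -> : `|d| * (1 - tau * `|d|) ^+ 2 =
      `|d| - 2 * tau * `|d| ^+ 2 + tau ^+ 2 * `|d| ^+ 3 by ring.
    by rewrite real_normK ?num_real //; lra.
  apply: (@le_trans _ _ ((u + d + dp) * v / 4 - 3 * `|r| ^+ 3)).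
    have := ler_wpM2l (ltW v0) hd.
    rewrite /r normrM (gtr0_norm v0) [(`|d| * v) ^+ 3]exprMn /al /be /ga /ka /q; lra.
  have r3 : 0 <= `|r| ^+ 3 by rewrite exprn_ge0.
  have [ud|ud] := boolP (pos (u + d)); last first.
    rewrite mul0r; move: ud; rewrite /pos -ltNge => ud.
    have -> : dp = 0 by rewrite /dp max_r //; lra.
    have : 0 <= - (u + d) * v by rewrite mulr_ge0 ?(ltW v0) //; lra.
    lra.
  rewrite mul1r; have ud' : 0 <= u + d by [].
  have dpu : dp <= u + d by rewrite /dp ge_max; lra.
  rewrite /entrance_fun; case: ifP => [_|/negbT].
    have : 0 <= (u + d - dp) * v by rewrite mulr_ge0 ?(ltW v0) //; lra.
    have := sqr_ge0 ((u + d) * v); rewrite -/v; lra.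
  rewrite -ltNge ltr_sqr ?nnegrE ?(ltW H0) // => h.
  have dr : 1 / 2 <= r by rewrite /r ler_pdivlMr //; lra.
  have d0 : 0 < d by lra.
  have -> : dp = d by rewrite /dp max_l // ltW.
  have -> : `|r| = r by rewrite ger0_norm //; lra.
  have -> : (u + d + d) * v / 4 = (q + 2 * r) / 4 by rewrite /q /r; ring.
  have : 1 / 2 * r ^+ 2 <= r ^+ 3.
    by rewrite [r ^+ 3]exprS ler_wpM2r ?sqr_ge0.
  have : 1 / 2 * r <= r ^+ 2 by rewrite [r ^+ 2]expr2 ler_wpM2r //; lra.
  lra.
have [_ _ _ /andP[m1 m2] _] := rl.
apply: le_trans (step_lower rl ka0 hf).
set m := step l _ in m1 m2 *.
have al0 : 0 <= al by rewrite /al divr_ge0.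
have be0 : 0 <= be by rewrite /be; lra.
have err : (`|al| + `|be|) * eta <= 1 * v ^+ 3.
  rewrite !ger0_norm //; apply: ler_pM => //; first by rewrite addr_ge0.
  rewrite /al /be; lra.
have hga : tau * v / 4 * s1 <= ga * m.
  by rewrite ler_wpM2l // divr_ge0 // mulr_ge0 // ltW.
have gainE : tau * s1 * v / 4 - tau ^+ 2 * v * c3 / 8 = entrance_gain * v / 4.
  by rewrite /tau /entrance_gain; field; rewrite gt_eqF.
have Hg : 8 * (1 + 3 * c3) <= entrance_gain * H.
  by rewrite [entrance_gain * H]mulrC -ler_pdivrMr //; lra.
have hv : (1 + 3 * c3) * v ^+ 3 <= entrance_gain * v / 8.
  have : 0 <= (entrance_gain * H - 8 * (1 + 3 * c3)) * v ^+ 3.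
    by rewrite mulr_ge0 //; lra.
  have -> : (entrance_gain * H - 8 * (1 + 3 * c3)) * v ^+ 3 =
    entrance_gain * (H * v) * v ^+ 2 - 8 * (1 + 3 * c3) * v ^+ 3 by ring.
  rewrite vH mulr1.
  have : entrance_gain * v ^+ 2 <= entrance_gain * v.
    by rewrite ler_wpM2l ?(ltW gain0) // expr2 ler_piMr ?(ltW v0).
  lra.
apply: (@le_trans _ _ (q / 8 + entrance_gain * v / 8)); last first.
  rewrite /al /ka; lra.
rewrite /entrance_cst -/v.
have min1 : Num.min 1 entrance_gain <= 1 by rewrite ge_min lexx.
have min2 : Num.min 1 entrance_gain <= entrance_gain by rewrite ge_min lexx orbT.
have h1 : Num.min 1 entrance_gain * q <= q by rewrite ler_piMl.
have h2 := ler_wpM2r (ltW v0) min2.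
have -> : Num.min 1 entrance_gain / 8 * (u + 1) * v =
  (Num.min 1 entrance_gain * q + Num.min 1 entrance_gain * v) / 8.
  by rewrite /q; ring.
lra.
Qed.

(** Subtracting the elapsed fraction of the time [m] from [entrance_fun]
    leaves a subsolution below [H / 2], by [entrance_step] and the choice of
    [m], and it is nonpositive when the time is up. This is optional stopping
    at the entrance into the upper half of [0, H], without stopping times:
    [be] is a lower bound for the rest of the walk from there. *)
Lemma walk_entrance eta s (f : R -> R) (H be u : R) (m : nat) :
  (forall l, l \in s -> regular s1 s2 c3 eta l) -> (forall z, 0 <= f z) ->
  entrance_scale <= H -> 0 <= eta -> eta * H ^+ 3 <= 1 ->
  4 * H ^+ 2 <= s1 * m%:R -> (m < size s)%N -> 0 <= be ->
  (forall i x, (0 < i <= m.+1)%N -> H / 2 <= x <= H ->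
      be <= walk pos (drop i s) f x) ->
  0 <= u <= H / 2 ->
  be * (entrance_cst * (u + 1) / H) <= walk pos s f u.
Proof.
move=> hs f0 HH eta0 etaH mH ms be0 hbe uH.
have p1 := s1_gt0; have p3 := c3_gt0.
have gain0 : 0 < entrance_gain by rewrite divr_gt0 ?exprn_gt0 ?mulr_gt0.
have H1 : 1 + (8 + 32 * c3) / s1 + 8 * (1 + 3 * c3) / entrance_gain <= H by [].
have r1 : 0 < (8 + 32 * c3) / s1 by rewrite divr_gt0 //; lra.
have r2 : 0 < 8 * (1 + 3 * c3) / entrance_gain by rewrite divr_gt0 //; lra.
have H0 : 0 < H by lra.
have m0 : 0 < m%:R :> R.
  rewrite -(pmulr_rgt0 _ p1); apply: lt_le_trans mH.
  by rewrite mulr_gt0 // exprn_gt0.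
case: s hs ms hbe => // l s hs ms hbe.
have rl : regular s1 s2 c3 eta l by apply: hs; rewrite mem_head.
have hs' l' : l' \in s -> regular s1 s2 c3 eta l'.
  by move=> h; apply: hs; rewrite inE h orbT.
have hs0 i l' : l' \in drop i s -> nneg l'.
  by move=> /mem_drop /hs'[].
have claim k x : (k <= m)%N ->
   be * (entrance_fun H x - (m - k)%:R / m%:R) <= walk pos (drop (m - k) s) f x.
  have w0 i z : 0 <= walk pos (drop i s) f z by apply: walk_ge0 => // l' /hs0.
  elim: k x => [|k IH] x km.
    apply: le_trans (w0 _ _); rewrite subn0 divff ?gt_eqF //.
    rewrite mulr_ge0_le0 // subr_le0; exact: entrance_fun_le1.
  have frac0 : 0 <= (m - k.+1)%:R / m%:R :> R by rewrite divr_ge0.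
  have [x0|x0] := lerP x 0.
    apply: le_trans (w0 _ _); rewrite mulr_ge0_le0 //.
    have := entrance_fun_le0 H0 x0; lra.
  have [xH|xH] := ltrP H x.
    apply: le_trans (w0 _ _); rewrite mulr_ge0_le0 //.
    rewrite (entrance_fun_gt H0 xH); lra.
  have [xH2|xH2] := lerP (H / 2) x.
    apply: (@le_trans _ _ be).
      rewrite ler_piMr //; have := entrance_fun_le1 x H0; lra.
    have := hbe (m - k.+1).+1 x; rewrite /= => -> //; last by rewrite xH2.
    by rewrite ltnS leq_subr.
  have kE : (m - k = (m - k.+1).+1)%N by rewrite -subSn.
  have ks : (m - k.+1 < size s)%N.
    apply: (@leq_trans m); last exact: ms.
    by rewrite ltn_subrL /= (leq_ltn_trans _ km).
  rewrite (drop_nth l ks) -kE /=; set l' := nth l s _.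
  have rl' : regular s1 s2 c3 eta l' by apply/hs'/mem_nth.
  have nl' : nneg l' by case: rl'.
  have x0H : 0 <= x <= H / 2 by rewrite !ltW.
  have hstep := entrance_step rl' HH eta0 etaH x0H.
  have hm : m%:R^-1 <= s1 / (4 * H ^+ 2).
    rewrite ler_pdivlMr ?mulr_gt0 ?exprn_gt0 // mulrC ler_pdivrMr //.
  apply: (@le_trans _ _ (be * (step l' (fun d => entrance_fun H (x + d))
      - (m - k)%:R / m%:R))).
    have e : (m - k)%:R = (m - k.+1)%:R + 1 :> R by rewrite kE -natr1.
    rewrite ler_wpM2l // e mulrDl mul1r; lra.
  apply: (@le_trans _ _ (step l' (fun d => be * (entrance_fun H (x + d)
      - (m - k)%:R / m%:R)))).
    rewrite stepZ ler_wpM2l // stepB step_cst lerD2l lerN2 ler_piMr ?divr_ge0 //.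
    by case: rl' => _ /andP[].
  apply: le_step => // d; have [xd|xd] := boolP (pos (x + d)).
    by rewrite mul1r IH // ltnW.
  rewrite mul0r mulr_ge0_le0 //.
  have : entrance_fun H (x + d) <= 0.
    by apply: entrance_fun_le0 => //; move: xd; rewrite /pos -ltNge; exact: ltW.
  have : 0 <= (m - k)%:R / m%:R :> R by rewrite divr_ge0.
  lra.
rewrite /=; apply: (@le_trans _ _ (be * step l (fun d =>
   (pos (u + d))%:R * entrance_fun H (u + d)))).
  by rewrite ler_wpM2l //; apply: entrance_first rl _ _ _ _.
rewrite -stepZ; apply: le_step => [|d]; first by case: rl.
rewrite mulrCA ler_wpM2l //.
have := claim m (u + d) (leqnn m).
by rewrite subnn mul0r subr0 drop0.
Qed.

End Entrance.

(** * Local bounds with killing *)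

Section NearDiagonal.
Context {R : realType}.
Implicit Types (l : @law R) (s t : seq (@law R)) (x y z : R).
Variables (s1 s2 c3 eps : R) (N0 : nat).
Hypotheses (s1_gt0 : 0 < s1) (s2_ge0 : 0 <= s2) (c3_gt0 : 0 < c3).
Hypothesis eps01 : 0 < eps <= 1.
Hypothesis N0_gt0 : (0 < N0)%N.

Lemma half_bounds (m : nat) : (1 < m)%N ->
  [/\ (m <= 4 * m./2)%N, (m <= 4 * (m - m./2))%N, (0 < m./2)%N, (m./2 <= m)%N
    & (0 < m - m./2)%N].
Proof. by move=> m1; split; lia. Qed.

(** Killing decreases the average of the nonnegative function [S - F], so
    that [F] loses at most [S] times the killed mass. *)
Lemma kill_defect G s (F : R -> R) (S x : R) : (forall l, l \in s -> nneg l) ->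
  walk predT s (fun=> 1) x <= 1 -> 0 <= S -> (forall z, F z <= S) ->
  walk predT s F x - S * (1 - walk G s (fun=> 1) x) <= walk G s F x.
Proof.
move=> s0 m1 S0 FS.
have := @walk_kill_le _ G s (fun z => S - F z) x s0.
rewrite !walkB !(walk_cst _ _ S) => h.
have {}h := h (fun z => etrans (subr_ge0 _ _) (FS z)).
have := ler_wpM2l S0 m1; lra.
Qed.

(** A path that is killed is killed in its first half or in its second half;
    in the second case it is read backwards from its end point. Either way
    the other half contributes at most its maximal point mass. *)
Lemma walk_two_sided s t x y (S S' : R) : (forall l, l \in s ++ t -> nneg l) ->
  walk predT s (fun=> 1) x <= 1 ->
  walk predT (reversal t) (fun=> 1) y <= 1 -> pos y ->
  0 <= S -> (forall z, walk predT t (delta y) z <= S) ->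
  0 <= S' -> (forall z, walk predT s (delta z) x <= S') ->
  walk predT (s ++ t) (delta y) x - S * (1 - walk pos s (fun=> 1) x)
    - S' * (1 - walk pos (reversal t) (fun=> 1) y)
  <= walk pos (s ++ t) (delta y) x.
Proof.
move=> st0 ms mt y0 S0 hS S'0 hS'.
have s0 l : l \in s -> nneg l by move=> h; apply: st0; rewrite mem_cat h.
have t0 l : l \in t -> nneg l by move=> h; apply: st0; rewrite mem_cat h orbT.
have rt0 := nneg_reversal t0.
rewrite !walk_cat; set F := walk predT t (delta y); set K := walk pos t (delta y).
have FK z : K z <= F z by apply: walk_kill_le => // ?; exact: delta_ge0.
have h1 : walk predT s K x - walk pos s K x <= walk predT s F x - walk pos s F x.
  have : walk pos s F x - walk pos s K x <= walk predT s F x - walk predT s K x.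
    by rewrite -!walkB; apply: walk_kill_le => // z; rewrite subr_ge0.
  lra.
have h2 := kill_defect pos s0 ms S0 hS.
(* the backward kernel of the second half, read from its end point *)
pose back G z := walk G (reversal t) (fun b => walk predT s (delta b) x) z.
have backE G : walk predT s (fun a => walk G (reversal t) (delta a) y) x = back G y.
  rewrite walk_exchange /back; apply: eq_walk => b; apply: eq_walk => a.
  by rewrite /delta eq_sym.
have h3 : back pos y <= walk predT s K x.
  rewrite -backE; apply: le_walk => // a; rewrite /K.
  have := walk_reversal pos t a y; rewrite y0 mul1r => <-.
  have [a0|_] := boolP (pos a); first by rewrite mul1r.
  by rewrite mul0r walk_ge0 // => z; exact: delta_ge0.
have h4 : back predT y = walk predT s F x.
  rewrite -backE; apply: eq_walk => a; rewrite /F.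
  by have := walk_reversal predT t a y; rewrite !mul1r.
have h5 := kill_defect pos rt0 mt S'0 hS'.
rewrite -/(back _ _) -/(back _ _) h4 in h5.
lra.
Qed.

(** At height at least the square root of [exit_ratio * m], each of the two
    losses in [walk_two_sided] takes at most a quarter of the local lower
    bound. *)
Definition exit_ratio : R := 8 * cU eps N0 * (s2 + 4) / cL s2 eps N0.

Lemma cL_gt0 : 0 < cL s2 eps N0.
Proof. by rewrite /cL divr_gt0 ?expR_gt0. Qed.

Lemma exit_ratio_gt0 : 0 < exit_ratio.
Proof.
have p := s2_ge0; have cU0 := cU_gt0 eps01 N0_gt0.
rewrite /exit_ratio divr_gt0 ?cL_gt0 //; apply: mulr_gt0; last lra.
by rewrite mulr_gt0.
Qed.

(** At a height of a large multiple of [sqrt m], killing over [m] steps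
    removes only part of the mass provided by [local_lower]. *)
Lemma near_diagonal eta Q s x y (m := (size s)%:R : R) :
  0 <= eta <= 1 -> admissible s1 s2 c3 eps N0 eta Q -> (forall l, l \in s -> Q l) ->
  (1 < size s)%N -> mL s2 eps N0 <= m -> 8 * m * eta <= 1 -> (x - y) ^+ 2 <= m ->
  eta * (exit_ratio * m) <= 1 -> eta * Num.sqrt (exit_ratio * m) <= 1 ->
  Num.sqrt (exit_ratio * m) <= y -> y - x + drift s \is a Num.int ->
  cL s2 eps N0 / 2 / Num.sqrt m <= walk pos s (delta y) x.
Proof.
move=> eta01 gQ hs m1 mm meta xym etaB etaB' By yx.
have [eta0 _] := andP eta01.
have b0 := exit_ratio_gt0; have p2 := s2_ge0.
have m0 : 0 < m by rewrite ltr0n ltnW.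
set B := Num.sqrt (exit_ratio * m) in etaB' By.
have B2 : B ^+ 2 = exit_ratio * m by rewrite sqr_sqrtr // mulr_ge0 ?ltW.
have B0 : 0 < B by rewrite sqrtr_gt0 mulr_gt0.
set k := (size s)./2.
have [mk1' mk2' k1 k2 k3] := half_bounds m1; rewrite -/k in mk1' mk2' k1 k2 k3.
have mk1 : m <= 4 * k%:R by rewrite -natrM ler_nat.
have mk2 : m <= 4 * (size s - k)%:R by rewrite -natrM ler_nat.
have km : k%:R <= m by rewrite ler_nat.
have km' : (size s - k)%:R <= m by rewrite ler_nat leq_subr.
pose t1 := take k s; pose t2 := drop k s.
have st : s = t1 ++ t2 by rewrite cat_take_drop.
have sz1 : size t1 = k by rewrite size_takel.
have sz2 : size t2 = (size s - k)%N by rewrite size_drop.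
have ht1 l : l \in t1 -> Q l by move=> /mem_take /hs.
have ht2 l : l \in t2 -> Q l by move=> /mem_drop /hs.
have [rQ _] := gQ.
have rt l : l \in reversal t2 -> regular s1 s2 c3 eta l.
  by rewrite mem_rev => /mapP[l' /ht2 /rQ /regular_reflect h ->].
have cU0 : 0 < cU eps N0 by exact: cU_gt0.
have sq (j : nat) : (0 < j)%N -> m <= 4 * j%:R ->
    cU eps N0 / Num.sqrt j%:R <= 2 * cU eps N0 / Num.sqrt m.
  move=> j0 mj; have j0' : 0 < j%:R :> R by rewrite ltr0n.
  rewrite ler_pdivrMr ?sqrtr_gt0 // mulrAC ler_pdivlMr ?sqrtr_gt0 //.
  rewrite [2 * _]mulrC -[leRHS]mulrA ler_pM2l // -[X in X * _](@ger0_norm _ 2) // -sqrtr_sqr.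
  by rewrite -sqrtrM ?sqr_ge0 // ler_sqrt ?mulr_ge0 ?sqr_ge0 //; lra.
set S := 2 * cU eps N0 / Num.sqrt m in sq.
have S0 : 0 <= S by rewrite /S divr_ge0 ?sqrtr_ge0 // mulr_ge0 // ltW.
have pm l : l \in s -> nneg l by move=> /hs /rQ[].
have up t z : (0 < size t)%N -> m <= 4 * (size t)%:R -> (forall l, l \in t -> Q l) ->
   forall w, walk predT t (delta w) z <= S.
  move=> t0 tm ht w; apply: le_trans (sq _ t0 tm).
  apply: le_trans (local_upper eps01 N0_gt0 z w eta01 gQ ht t0).
  apply: le_walk => [l /ht /rQ[]//|z']; apply: delta_le_bin.
  by rewrite lexx ltrDl ltr01.
have h1 := @walk_survive _ s1 s2 c3 eta t1 x y B eta0.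
rewrite B2 sz1 B0 By in h1; have {}h1 := h1 etaB etaB' isT (fun l hl => rQ l (ht1 l hl)).
have h2 := @walk_survive _ s1 s2 c3 eta (reversal t2) y y B eta0.
rewrite B2 size_reversal sz2 B0 By subrr expr0n /= add0r in h2.
have {}h2 := h2 etaB etaB' isT rt.
have low := local_lower s2_ge0 eps01 N0_gt0 eta01 gQ hs mm meta xym.
rewrite -/m in low.
rewrite -(walk_bin predT yx) in low.
have := @walk_two_sided t1 t2 x y S S.
rewrite -st => two; have {}two : walk predT s (delta y) x -
   S * (1 - walk pos t1 (fun=> 1) x) - S * (1 - walk pos (reversal t2) (fun=> 1) y) <=
   walk pos s (delta y) x.
  apply: two => //.
  - by have /andP[] := walk_mass x eta01 (fun l hl => rQ l (ht1 l hl)).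
  - by have /andP[] := walk_mass y eta01 rt.
  - by rewrite /pos; apply: le_trans By; rewrite ltW.
  - by move=> z; apply: up => //; rewrite sz2.
  - by move=> z; apply: up => //; rewrite sz1.
apply: le_trans two.
have em0 : 0 < exit_ratio * m by rewrite mulr_gt0.
have e1 : 1 - walk pos t1 (fun=> 1) x <= (s2 + 4) / exit_ratio.
  have : ((x - y) ^+ 2 + (s2 + 3) * k%:R) / (exit_ratio * m) <= (s2 + 4) / exit_ratio.
    rewrite ler_pdivrMr //.
    have -> : (s2 + 4) / exit_ratio * (exit_ratio * m) = (s2 + 4) * m.
      by field; rewrite gt_eqF.
    have : (s2 + 3) * k%:R <= (s2 + 3) * m by rewrite ler_wpM2l // addr_ge0.
    lra.
  lra.
have e2 : 1 - walk pos (reversal t2) (fun=> 1) y <= (s2 + 4) / exit_ratio.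
  have : ((s2 + 3) * (size s - k)%:R) / (exit_ratio * m) <= (s2 + 4) / exit_ratio.
    rewrite ler_pdivrMr //.
    have -> : (s2 + 4) / exit_ratio * (exit_ratio * m) = (s2 + 4) * m.
      by field; rewrite gt_eqF.
    have : (s2 + 3) * (size s - k)%:R <= (s2 + 3) * m by rewrite ler_wpM2l // addr_ge0.
    lra.
  lra.
have := ler_wpM2l S0 e1; have := ler_wpM2l S0 e2.
have -> : S * ((s2 + 4) / exit_ratio) = cL s2 eps N0 / 4 / Num.sqrt m.
  rewrite /S /exit_ratio; field.
  by rewrite !gt_eqF ?sqrtr_gt0 ?cL_gt0 ?cU_gt0 //; lra.
lra.
Qed.

Lemma near_diagonal_bin eta Q s x y (m := (size s)%:R : R) :
  0 <= eta <= 1 -> admissible s1 s2 c3 eps N0 eta Q -> (forall l, l \in s -> Q l) ->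
  (1 < size s)%N -> mL s2 eps N0 <= m -> 8 * m * eta <= 1 ->
  (`|x - y| + 1) ^+ 2 <= m ->
  eta * (exit_ratio * m) <= 1 -> eta * Num.sqrt (exit_ratio * m) <= 1 ->
  Num.sqrt (exit_ratio * m) <= y ->
  cL s2 eps N0 / 2 / Num.sqrt m <= walk pos s (bin y) x.
Proof.
move=> eta01 gQ hs m1 mm meta xym etaB etaB' By.
(* the unique point of the lattice of the walk in the unit interval above y *)
pose k := Num.ceil (y - x + drift s); pose y' := x - drift s + k%:~R.
have /andP[kl ku] := ceil_itv (y - x + drift s); rewrite -/k intrB in kl ku.
have yy' : y <= y' < y + 1 by rewrite /y'; lra.
have [yy1 yy2] := andP yy'.
apply: (@le_trans _ _ (walk pos s (delta y') x)); last first.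
  apply: le_walk => [l /hs h|z]; last exact: delta_le_bin.
  by case: gQ => /(_ _ h)[].
apply: near_diagonal eta01 gQ hs m1 mm meta _ etaB etaB' _ _ => //.
- apply: le_trans xym; rewrite -[leLHS]real_normK ?num_real //.
  rewrite lerXn2r ?nnegrE ?addr_ge0 //.
  have -> : x - y' = (x - y) - (y' - y) by ring.
  apply: (le_trans (ler_normB _ _)); rewrite lerD2l ger0_norm; lra.
- exact: le_trans By yy1.
- have -> : y' - x + drift s = k%:~R by rewrite /y'; ring.
  exact: intr_int.
Qed.

End NearDiagonal.

(** * The bulk estimate *)

Section Steering.
Context {R : realType}.
Implicit Types (l : @law R) (s t : seq (@law R)) (x y z : R).
Variables (s1 s2 c3 eps : R) (N0 : nat).
Hypotheses (s1_gt0 : 0 < s1) (s2_ge0 : 0 <= s2) (c3_gt0 : 0 < c3).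
Hypothesis eps01 : 0 < eps <= 1.
Hypothesis N0_gt0 : (0 < N0)%N.

(** [height * sqrt n] separates the boundary layer from the bulk; the bound
    [s1 / 128] leaves time to climb to twice that height within [n / 4]
    steps. *)
Definition height : R := Num.min 1 (s1 / 128).
(** The width of the tube is at most [aperture * sqrt n]; the denominator
    makes both this width and the safety distance of the last
    [m <= 5 * w ^+ 2] steps at most [height * sqrt n]. *)
Definition aperture : R := height / (6 + Num.sqrt (5 * exit_ratio s2 eps N0)).
Definition spread : R := 6 * aperture / tube_slope s1.
(** The sum of all lower bounds that the width of the tube has to satisfy. *)
Definition min_width : R := 1 + tube_width s1 c3 + Num.sqrt (2 * tube_rate s1 s2 c3)
  + Num.sqrt (mL s2 eps N0).
Definition bulk_cst : R :=
  cL s2 eps N0 / 2 * expR (- (4 * tube_rate s1 s2 c3 / aperture ^+ 2)).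
Definition bulk_exp : R := 4 * tube_rate s1 s2 c3 * spread ^+ 2 / aperture ^+ 2.

Lemma height_gt0 : 0 < height.
Proof. by rewrite /height lt_min ltr01 divr_gt0. Qed.

Lemma height_le1 : height <= 1.
Proof. by rewrite /height ge_min lexx. Qed.

Lemma height_sqr_le : 128 * height ^+ 2 <= s1.
Proof.
have h0 := height_gt0; have h1 := height_le1.
have : height <= s1 / 128 by rewrite /height ge_min lexx orbT.
have : height ^+ 2 <= height by rewrite expr2 ler_piMr // ltW.
lra.
Qed.

Lemma aperture_gt0 : 0 < aperture.
Proof.
rewrite /aperture divr_gt0 ?height_gt0 //.
have := sqrtr_ge0 (5 * exit_ratio s2 eps N0); lra.
Qed.

Lemma apertureE : aperture * 6 + aperture * Num.sqrt (5 * exit_ratio s2 eps N0) = height.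
Proof.
have := sqrtr_ge0 (5 * exit_ratio s2 eps N0) => h.
rewrite -mulrDr /aperture mulfVK // gt_eqF //; lra.
Qed.

Lemma slope_gt0 : 0 < tube_slope s1.
Proof. by rewrite /tube_slope divr_gt0. Qed.

Lemma tube_err_gt0 : 0 < tube_err s1 c3.
Proof.
have p3 := c3_gt0.
by rewrite /tube_err; have := sqr_ge0 (tube_slope s1); lra.
Qed.

Lemma tube_rate_gt0 : 0 < tube_rate s1 s2 c3.
Proof.
have p2 := s2_ge0; have := slope_gt0; have := tube_err_gt0.
by rewrite /tube_rate; lra.
Qed.

Lemma tube_width_gt0 : 0 < tube_width s1 c3.
Proof.
have : 0 < tube_err s1 c3 / s1 by rewrite divr_gt0 // tube_err_gt0.
have := slope_gt0; rewrite /tube_width; lra.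
Qed.

Lemma spread_gt0 : 0 < spread.
Proof. by rewrite /spread divr_gt0 ?slope_gt0 // mulr_gt0 // aperture_gt0. Qed.

Lemma expR_le_1Bx (t : R) : 0 <= t <= 1 / 2 -> expR (- (2 * t)) <= 1 - t.
Proof.
move=> /andP[t0 t1]; apply: (@le_trans _ _ (1 + 2 * t)^-1).
  by apply: expR_le_inv; lra.
rewrite -div1r ler_pdivrMr; last lra.
have : 0 <= t * (1 - 2 * t) by rewrite mulr_ge0 //; lra.
lra.
Qed.

(** The tube leads from [x] to within distance [w] of [y], and the last [m]
    steps, enough of them to diffuse over the distance [w], aim at the unit
    interval above [y] from any such point. *)
Lemma steer eta Q t1 t2 x y w (m := (size t2)%:R : R) :
  0 <= eta <= 1 -> admissible s1 s2 c3 eps N0 eta Q ->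
  (forall l, l \in t1 -> Q l) -> (forall l, l \in t2 -> Q l) ->
  (0 < size t1)%N -> (1 < size t2)%N ->
  1 <= w -> tube_width s1 c3 <= w -> eta * w ^+ 3 <= 1 ->
  tube_rate s1 s2 c3 / w ^+ 2 <= 1 -> w <= x -> w <= y ->
  `|x - y| * w <= tube_slope s1 * (size t1)%:R ->
  mL s2 eps N0 <= m -> 8 * m * eta <= 1 -> 4 * w ^+ 2 <= m ->
  eta * (exit_ratio s2 eps N0 * m) <= 1 ->
  eta * Num.sqrt (exit_ratio s2 eps N0 * m) <= 1 ->
  Num.sqrt (exit_ratio s2 eps N0 * m) <= y ->
  cL s2 eps N0 / 2 / Num.sqrt m * (1 - tube_rate s1 s2 c3 / w ^+ 2) ^+ size t1
    <= walk pos (t1 ++ t2) (bin y) x.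
Proof.
move=> eta01 gQ ht1 ht2 N1_gt0 m_gt1 w1 ww ew lamw xw yw xyw mm meta wm eB eB' By.
have [rQ _] := gQ; have [eta0 _] := andP eta01.
have w0 : 0 < w by lra.
set N1 := size t1; have N10 : 0 < N1%:R :> R by rewrite ltr0n.
pose b := (y - x) / N1%:R.
have bw : `|b| * w <= tube_slope s1.
  rewrite /b normrM normrV ?unitfE ?gt_eqF // distrC (gtr0_norm N10).
  by rewrite mulrAC ler_pdivrMr.
have centers i : (i <= N1)%N -> w <= x + b * i%:R.
  move=> iN; have iN' : i%:R <= N1%:R :> R by rewrite ler_nat.
  have -> : x + b * i%:R = (x * (N1%:R - i%:R) + y * i%:R) / N1%:R.
    by rewrite /b; field; rewrite gt_eqF.
  rewrite ler_pdivlMr //.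
  have -> : w * N1%:R = w * (N1%:R - i%:R) + w * i%:R by ring.
  by apply: lerD; rewrite ler_wpM2r // subr_ge0.
have hreg l : l \in t1 -> regular s1 s2 c3 eta l by move=> /ht1 /rQ.
have tube := @walk_tube _ s1 s2 c3 s1_gt0 s2_ge0 c3_gt0 eta t1 x x b w hreg ww bw
  eta0 ew lamw centers.
have cy : x + b * N1%:R = y by rewrite /b; field; rewrite gt_eqF.
rewrite -/N1 subrr mul0r cy in tube.
have b0 : bump_fun (0 : R) = 2.
  by rewrite /bump_fun expr0n /= ler01 !subr0 mul1r.
rewrite b0 in tube.
have m0 : 0 < Num.sqrt m by rewrite sqrtr_gt0 ltr0n ltnW.
have near z : cL s2 eps N0 / 4 / Num.sqrt m * bump_fun ((z - y) / w)
    <= walk pos t2 (bin y) z.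
  have nt2 : 0 <= walk pos t2 (bin y) z.
    by apply: walk_ge0 => [l /ht2 /rQ[]//|z']; exact: bin_ge0.
  have [zw|zw] := lerP (((z - y) / w) ^+ 2) 1; last first.
    by rewrite /bump_fun [_ <= 1]leNgt zw /= mulr0.
  have zyw : `|z - y| <= w.
    rewrite -ler_sqr ?nnegrE ?(ltW w0) // real_normK ?num_real //.
    by move: zw; rewrite exprMn exprVn ler_pdivrMr ?exprn_gt0 // mul1r.
  apply: (@le_trans _ _ (cL s2 eps N0 / 2 / Num.sqrt m)).
    have -> : cL s2 eps N0 / 2 / Num.sqrt m = cL s2 eps N0 / 4 / Num.sqrt m * 2.
      by field; rewrite gt_eqF.
    rewrite ler_wpM2l ?bump_fun_le2 //.
    by rewrite divr_ge0 ?(ltW m0) // divr_ge0 // ltW // cL_gt0.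
  apply: (@near_diagonal_bin _ s1 s2 c3 eps N0 s1_gt0 s2_ge0 c3_gt0 eps01 N0_gt0 eta Q t2 z y) => //.
  apply: le_trans wm; have -> : 4 * w ^+ 2 = (2 * w) ^+ 2 by ring.
  rewrite lerXn2r ?nnegrE ?addr_ge0 //; lra.
rewrite walk_cat.
apply: (@le_trans _ _ (walk pos t1 (fun z => cL s2 eps N0 / 4 / Num.sqrt m *
   bump_fun ((z - y) / w)) x)); last first.
  by apply: le_walk => // l /ht1 /rQ[].
rewrite walkZ.
have -> : cL s2 eps N0 / 2 / Num.sqrt m * (1 - tube_rate s1 s2 c3 / w ^+ 2) ^+ N1 =
  cL s2 eps N0 / 4 / Num.sqrt m * ((1 - tube_rate s1 s2 c3 / w ^+ 2) ^+ N1 * 2).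
  by field; rewrite !gt_eqF.
rewrite ler_wpM2l //.
by rewrite divr_ge0 ?(ltW m0) // divr_ge0 // ltW // cL_gt0.
Qed.

End Steering.

(** The width [w] of the tube is of harmonic type, [e1 n / (r + K D)] with
    [r] the square root of [n]: below both [e1 r] and [e1 n / (K D)], so the
    tube stays away from the boundary and its slope is admissible, while its
    cost [n / w ^ 2] is of order [1 + D ^ 2 / n]. *)
Lemma bulk_scales {R : realType} (n N : nat) (eta r D e1 q K lam er h tw ml : R) :
  (24 <= n)%N -> (n <= 3 * N)%N -> (N <= n)%N -> 0 < r -> r ^+ 2 = n%:R ->
  0 <= eta -> eta * n%:R ^+ 2 <= 1 -> 0 < e1 -> 0 <= q -> q ^+ 2 = 5 * er ->
  0 <= er -> e1 * 6 + e1 * q = h -> h <= 1 -> 0 < K -> 0 < lam -> 0 <= tw ->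
  0 <= ml -> 0 <= D ->
  (1 + tw + Num.sqrt (2 * lam) + Num.sqrt ml) * (r + K * D) <= e1 * n%:R ->
  exists (w : R) (m : nat),
  [/\ [/\ 1 <= w, tw <= w, w <= h * r, eta * w ^+ 3 <= 1 & lam / w ^+ 2 <= 1 / 2],
      [/\ (1 < m)%N, (m <= N)%N & n%:R <= 6 * (N - m)%:R :> R],
      [/\ ml <= m%:R, 8 * m%:R * eta <= 1, 4 * w ^+ 2 <= m%:R,
          eta * (er * m%:R) <= 1 & eta * Num.sqrt (er * m%:R) <= 1],
      [/\ Num.sqrt (er * m%:R) <= h * r, w * (K * D) <= e1 * n%:R & Num.sqrt m%:R <= r]
    & 2 * (lam / w ^+ 2) * (N - m)%:R <=
       4 * lam / e1 ^+ 2 + 4 * lam * K ^+ 2 / e1 ^+ 2 * (D ^+ 2 / n%:R)].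
Proof.
move=> n24 sn1 sn2 r0 rr eta0 etan a0 q0 qq er0 aE h1 K0 lam0 tw0 ml0 D0 hW.
have n24' : 24 <= n%:R :> R by rewrite ler_nat.
have n0 : 0 < n%:R :> R by lra.
have r1 : 1 <= r.
  by rewrite -(@expr_ge1 _ 2) // ?ltW // rr; lra.
have rn : r <= n%:R by rewrite -rr expr2 ler_pMr.
have e1q0 : 0 <= e1 * q by rewrite mulr_ge0 // ltW.
have e16 : e1 * 6 <= 1 by lra.
have h0 : 0 < h by lra.
set L := r + K * D in hW.
have KD0 : 0 <= K * D by rewrite mulr_ge0 // ltW.
have L0 : 0 < L by rewrite /L; lra.
have [w [wL wLE]] : exists w, w * L = e1 * n%:R /\ w = e1 * n%:R / L.
  by exists (e1 * n%:R / L); rewrite mulfVK // gt_eqF.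
have Ww : 1 + tw + Num.sqrt (2 * lam) + Num.sqrt ml <= w by rewrite wLE ler_pdivlMr.
have sl0 := sqrtr_ge0 (2 * lam); have sm0 := sqrtr_ge0 ml.
have w1 : 1 <= w by lra.
have w0 : 0 < w by lra.
have wr : w <= e1 * r.
  rewrite wLE ler_pdivrMr // -[leRHS]mulrA ler_pM2l // -rr expr2 ler_pM2l // /L; clear -KD0; lra.
have wD : w * (K * D) <= e1 * n%:R by rewrite -wL ler_pM2l // /L; clear -r0; lra.
have ww : w ^+ 2 <= e1 ^+ 2 * n%:R.
  by rewrite -rr -exprMn lerXn2r ?nnegrE ?(ltW w0) // mulr_ge0 // ltW.
have e12 : 36 * e1 ^+ 2 <= 1.
  have -> : 36 * e1 ^+ 2 = (e1 * 6) ^+ 2 by ring.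
  by rewrite exprn_ile1 // mulr_ge0 // ltW.
have ww' : 36 * w ^+ 2 <= n%:R.
  have : 0 <= (1 - 36 * e1 ^+ 2) * n%:R by rewrite mulr_ge0 ?(ltW n0) //; clear -e12; lra.
  clear -ww; lra.
have w2 : 1 <= w ^+ 2 by rewrite exprn_ege1.
have [m [m1 m2]] : exists m : nat, 4 * w ^+ 2 <= m%:R /\ m%:R <= 5 * w ^+ 2.
  have p : 0 <= 4 * w ^+ 2 by lra.
  exists (Num.truncn (4 * w ^+ 2)).+1; split; first by rewrite ltW // truncnS_gt.
  have : (Num.truncn (4 * w ^+ 2))%:R <= 4 * w ^+ 2 by rewrite truncn_le.
  by rewrite -natr1; clear -w2; lra.
have sn1' : n%:R <= 3 * N%:R :> R by rewrite -natrM ler_nat.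
have sn2' : N%:R <= n%:R :> R by rewrite ler_nat.
have ms : (m <= N)%N by rewrite -(ler_nat R); clear -m2 ww' sn1' n0; lra.
have N1E : (N - m)%:R = N%:R - m%:R :> R by rewrite natrB.
have nn : n%:R <= n%:R ^+ 2 :> R by rewrite expr2 ler_pMl //; lra.
have etaX (X : R) : X <= n%:R ^+ 2 -> eta * X <= 1.
  by move=> hX; apply: le_trans etan; rewrite ler_wpM2l.
have erm : 0 <= er * m%:R by rewrite mulr_ge0.
have hr : h * r <= r by rewrite ler_piMl // ltW.
have Bh : Num.sqrt (er * m%:R) <= h * r.
  apply: (@le_trans _ _ (q * w)).
    rewrite -[leRHS]ger0_norm ?mulr_ge0 ?(ltW w0) // -sqrtr_sqr ler_sqrt ?sqr_ge0 //.
    rewrite exprMn qq; have := ler_wpM2l er0 m2; clear; lra.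
  apply: (@le_trans _ _ (q * (e1 * r))); first by rewrite ler_wpM2l.
  rewrite mulrA ler_wpM2r ?(ltW r0) //; clear -aE a0; lra.
have Bm : er * m%:R <= n%:R.
  rewrite -[leLHS](sqr_sqrtr erm) -rr.
  by rewrite lerXn2r ?nnegrE ?sqrtr_ge0 ?(ltW r0) //; exact: le_trans Bh hr.
exists w, m; split; [split => //|split => //|split => //|split => //|].
- by clear -Ww sl0 sm0; lra.
- apply: (le_trans wr); rewrite ler_wpM2r ?(ltW r0) //; clear -aE e1q0 a0; lra.
- apply: etaX; apply: (@le_trans _ _ (r ^+ 3)).
    rewrite lerXn2r ?nnegrE ?(ltW w0) ?(ltW r0) //.
    by apply: (le_trans wr); rewrite ler_piMl ?(ltW r0) //; clear -e16 a0; lra.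
  by rewrite -rr -exprM ler_weXn2l.
- rewrite ler_pdivrMr ?exprn_gt0 //.
  have : Num.sqrt (2 * lam) ^+ 2 <= w ^+ 2.
    by rewrite lerXn2r ?nnegrE ?(ltW w0) //; clear -Ww sm0 tw0; lra.
  by rewrite sqr_sqrtr ?mulr_ge0 ?(ltW lam0) //; clear; lra.
- by rewrite -(ltr_nat R); clear -m1 w2; lra.
- by rewrite N1E; clear -m2 ww' sn1' n0; lra.
- have : Num.sqrt ml ^+ 2 <= w ^+ 2.
    by rewrite lerXn2r ?nnegrE ?(ltW w0) //; clear -Ww sl0 tw0; lra.
  by rewrite sqr_sqrtr //; clear -m1 w2; lra.
- rewrite mulrC; apply: etaX; apply: (@le_trans _ _ (24 * n%:R)); first by clear -m2 ww' n0; lra.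
  by rewrite expr2 ler_wpM2r ?(ltW n0).
- by apply: etaX; exact: le_trans Bm nn.
- by apply: etaX; apply: (le_trans Bh); apply: (le_trans hr); exact: le_trans nn.
- by rewrite -[r]gtr0_norm // -sqrtr_sqr ler_sqrt ?sqr_ge0 // rr; clear -m2 ww' n0; lra.
apply: (@le_trans _ _ (2 * (lam / w ^+ 2) * n%:R)).
  rewrite ler_wpM2l ?mulr_ge0 ?invr_ge0 ?sqr_ge0 ?(ltW lam0) // N1E.
  by have : 0 <= m%:R :> R by []; clear -sn2'; lra.
have -> : 2 * (lam / w ^+ 2) * n%:R = 2 * lam / e1 ^+ 2 * (L ^+ 2 / n%:R).
  by rewrite wLE; field; rewrite !gt_eqF.
have -> : 4 * lam / e1 ^+ 2 + 4 * lam * K ^+ 2 / e1 ^+ 2 * (D ^+ 2 / n%:R) =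
   2 * lam / e1 ^+ 2 * ((2 * (n%:R + (K * D) ^+ 2)) / n%:R).
  by field; rewrite !gt_eqF.
apply: ler_wpM2l; first by rewrite divr_ge0 ?sqr_ge0 // mulr_ge0 // ltW.
rewrite ler_wpM2r ?invr_ge0 // /L -rr.
have := sqr_ge0 (r - K * D); clear; lra.
Qed.

Section Bulk.
Context {R : realType}.
Variables (s1 s2 c3 eps : R) (N0 : nat).
Hypotheses (s1_gt0 : 0 < s1) (s2_ge0 : 0 <= s2) (c3_gt0 : 0 < c3).
Hypothesis eps01 : 0 < eps <= 1.
Hypothesis N0_gt0 : (0 < N0)%N.

(** Above the boundary layer a tube of the width given by [bulk_scales] joins
    the two end points: its loss is the Gaussian factor, and its last piece
    gives the order [1 / sqrt n]. *)
Lemma walk_bulk (n : nat) eta Q (s : seq (@law R)) (x y : R)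
    (r := Num.sqrt (n%:R : R)) :
  (24 <= n)%N -> 0 <= eta -> eta * n%:R ^+ 2 <= 1 ->
  admissible s1 s2 c3 eps N0 eta Q -> (forall l, l \in s -> Q l) ->
  (n <= 3 * size s)%N -> (size s <= n)%N ->
  height s1 * r <= x -> height s1 * r <= y ->
  min_width s1 s2 c3 eps N0 * (r + spread s1 s2 eps N0 * `|x - y|)
    <= aperture s1 s2 eps N0 * n%:R ->
  bulk_cst s1 s2 c3 eps N0 / r *
     expR (- (bulk_exp s1 s2 c3 eps N0 * ((x - y) ^+ 2 / n%:R)))
   <= walk pos s (bin y) x.
Proof.
move=> n24 eta0 etan gQ hs sn1 sn2 Hx Hy hW.
have n0 : 0 < n%:R :> R by rewrite ltr0n; exact: leq_trans n24.
have rr : r ^+ 2 = n%:R by rewrite sqr_sqrtr // ltW.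
have r0 : 0 < r by rewrite sqrtr_gt0.
have lam0 : 0 < tube_rate s1 s2 c3 by exact: tube_rate_gt0.
have tw0 : 0 < tube_width s1 c3 by exact: tube_width_gt0.
have er0 := exit_ratio_gt0 s2_ge0 eps01 N0_gt0.
have er5 : 0 <= 5 * exit_ratio s2 eps N0 by rewrite mulr_ge0 // ltW.
have a0 : 0 < aperture s1 s2 eps N0 by exact: aperture_gt0.
have K0 : 0 < spread s1 s2 eps N0 by exact: spread_gt0.
have mL0 : 0 <= mL s2 eps N0.
  by apply: mulr_ge0; [exact: mulr_ge0 | exact: sqr_ge0].
have [w [m [[w1 w2 w3 w4 w5] [m1 m2 m3] [b1 b2 b3 b4 b5] [d1 d2 d3] ex]]] :=
  bulk_scales n24 sn1 sn2 r0 rr eta0 etan a0 (sqrtr_ge0 _) (sqr_sqrtr er5)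
    (ltW er0) (apertureE _ _ _ _) (height_le1 s1) K0 lam0
    (ltW tw0) mL0 (normr_ge0 (x - y)) hW.
have lam1 : tube_rate s1 s2 c3 / w ^+ 2 <= 1.
  by apply: (le_trans w5); rewrite ler_pdivrMr // mul1r ler1n.
have w0 : 0 < w by exact: lt_le_trans w1.
set N1 := (size s - m)%N in m3 ex.
have N10 : (0 < N1)%N.
  by rewrite lt0n; apply/negP => /eqP z; move: m3; rewrite z mulr0 leNgt n0.
have sz1 : size (take N1 s) = N1 by rewrite size_takel // leq_subr.
have sz2 : size (drop N1 s) = m by rewrite size_drop subKn.
have nn : 1 <= n%:R ^+ 2 :> R by rewrite exprn_ege1 // ler1n; exact: leq_trans n24.
have eta01 : 0 <= eta <= 1.
  rewrite eta0 /=; apply: le_trans etan; by rewrite ler_peMr.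
have slope : `|x - y| * w <= tube_slope s1 * N1%:R.
  rewrite -(ler_pM2l K0).
  have -> : spread s1 s2 eps N0 * (`|x - y| * w) = w * (spread s1 s2 eps N0 * `|x - y|).
    by ring.
  apply: (le_trans d2).
  have -> : spread s1 s2 eps N0 * (tube_slope s1 * N1%:R) =
     aperture s1 s2 eps N0 * (6 * N1%:R).
    by rewrite /spread; field; rewrite gt_eqF // slope_gt0.
  by rewrite ler_wpM2l // ltW.
have := @steer R s1 s2 c3 eps N0 s1_gt0 s2_ge0 c3_gt0 eps01 N0_gt0 eta Q (take N1 s) (drop N1 s) x y w.
rewrite cat_take_drop sz1 sz2 => /(_ eta01 gQ (fun l h => hs l (mem_take h))
  (fun l h => hs l (mem_drop h)) N10 m1 w1 w2 w4 lam1 (le_trans w3 Hx) (le_trans w3 Hy)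
  slope b1 b2 b3 b4 b5 (le_trans d1 Hy)).
apply: le_trans.
have lw0 : 0 <= tube_rate s1 s2 c3 / w ^+ 2 by rewrite divr_ge0 ?sqr_ge0 // ltW.
rewrite /bulk_cst [X in X <= _](_ : _ = cL s2 eps N0 / 2 / r *
   (expR (- (4 * tube_rate s1 s2 c3 / aperture s1 s2 eps N0 ^+ 2)) *
    expR (- (bulk_exp s1 s2 c3 eps N0 * ((x - y) ^+ 2 / n%:R))))); last by ring.
have cL0 := cL_gt0 s2 eps N0.
have m0 : 0 < Num.sqrt (m%:R : R) by rewrite sqrtr_gt0 ltr0n ltnW.
apply: ler_pM.
- by rewrite divr_ge0 ?(ltW r0) // divr_ge0 // ltW.
- by rewrite mulr_ge0 ?expR_ge0.
- rewrite ler_wpM2l ?lef_pV2 ?posrE //.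
  by rewrite divr_ge0 // ltW.
apply: (@le_trans _ _ (expR (- (2 * (tube_rate s1 s2 c3 / w ^+ 2))) ^+ N1)).
  rewrite -expRM_natl -expRD ler_expR -opprD mulrN lerN2 mulrC.
  by apply: (le_trans ex); rewrite real_normK ?num_real.
have := @expR_le_1Bx _ (tube_rate s1 s2 c3 / w ^+ 2).
rewrite lw0 w5 => /(_ isT) h2.
rewrite lerXn2r ?nnegrE ?expR_ge0 //.
exact: le_trans (expR_ge0 _) h2.
Qed.

End Bulk.

(** * End points near the boundary *)

Section Core.
Context {R : realType}.
Implicit Types (l : @law R) (s t : seq (@law R)) (x y z : R).
Variables (s1 s2 c3 eps : R) (N0 : nat).
Hypotheses (s1_gt0 : 0 < s1) (s2_ge0 : 0 <= s2) (c3_gt0 : 0 < c3).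
Hypothesis eps01 : 0 < eps <= 1.
Hypothesis N0_gt0 : (0 < N0)%N.

Lemma expRN_le1 (t : R) : 0 <= t -> expR (- t) <= 1.
Proof. by move=> t0; rewrite -expR0 ler_expR oppr_le0. Qed.

Lemma walk_map_reflect s (f : R -> R) x :
  walk predT [seq reflect_law l | l <- s] f x = walk predT s (fun z => f (- z)) (- x).
Proof.
elim: s x => [|l s IH] x /=; first by rewrite opprK.
rewrite step_reflect; apply: eq_step => d; rewrite !mul1r IH.
by rewrite opprD opprK.
Qed.

Lemma minorized_reflect t : minorized eps [seq reflect_law l | l <- t] ->
  minorized eps t.
Proof.
move=> [m hm]; exists (- m) => g x g0.
have := hm (fun z => g (- z)) (- x) (fun z => g0 (- z)).
rewrite walk_map_reflect opprK.
rewrite (@eq_walk _ predT t _ g); last by move=> z; rewrite opprK.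
congr (_ <= _); congr (_ * _); rewrite /lazy.
rewrite addrC addrA -[RHS]/((_ + _ + _) / 4) addrC; congr (_ / 4).
have -> : - (- x - m - 1) = x - - m + 1 by ring.
have -> : - (- x - m + 1) = x - - m - 1 by ring.
have -> : - (- x - m) = x - - m by ring.
by ring.
Qed.

Lemma admissible_reflect eta (Q : @law R -> Prop) : admissible s1 s2 c3 eps N0 eta Q ->
  admissible s1 s2 c3 eps N0 eta (fun l => Q (reflect_law l)).
Proof.
move=> [Qr Qm]; split=> [l /Qr /regular_reflect|t tN ht].
  by rewrite reflect_lawK.
apply: minorized_reflect; apply: Qm; first by rewrite size_map.
by move=> _ /mapP[l lt ->]; exact: ht.
Qed.

Lemma drift_reversal s : drift (reversal s) = - drift s.
Proof.
rewrite /drift /reversal (perm_big [seq reflect_law l | l <- s]) /=; last first.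
  by rewrite perm_rev.
by rewrite big_map -sumrN.
Qed.

Lemma drop_reversal i s : drop i (reversal s) = reversal (take (size s - i) s).
Proof. by rewrite /reversal drop_rev size_map map_take. Qed.

(** The ratio between the entrance probability and [damp]. *)
Definition boundary_ratio : R := Num.min 1 (entrance_cst s1 c3 / (2 * height s1)).
Definition gauss_rate : R := bulk_exp s1 s2 c3 eps N0.
Definition boundary_cst : R :=
  bulk_cst s1 s2 c3 eps N0 * expR (- (8 * gauss_rate)) * boundary_ratio.
Definition core_cst : R := boundary_cst * expR (- (36 * gauss_rate)) * boundary_ratio.

Lemma entrance_cst_gt0 : 0 < entrance_cst s1 c3.
Proof.
rewrite /entrance_cst divr_gt0 // lt_min ltr01 /entrance_gain.
by rewrite divr_gt0 ?exprn_gt0 // mulr_gt0.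
Qed.

Lemma boundary_ratio_gt0 : 0 < boundary_ratio.
Proof.
by rewrite /boundary_ratio lt_min ltr01 divr_gt0 ?entrance_cst_gt0 // mulr_gt0 // height_gt0.
Qed.

Lemma gauss_rate_ge0 : 0 <= gauss_rate.
Proof.
rewrite /gauss_rate /bulk_exp; apply: divr_ge0; last exact: sqr_ge0.
apply: mulr_ge0; last exact: sqr_ge0.
by apply: mulr_ge0 => //; apply/ltW/tube_rate_gt0.
Qed.

Lemma bulk_cst_gt0 : 0 < bulk_cst s1 s2 c3 eps N0.
Proof. by rewrite /bulk_cst mulr_gt0 ?expR_gt0 // divr_gt0 // cL_gt0. Qed.

Lemma boundary_cst_gt0 : 0 < boundary_cst.
Proof.
rewrite /boundary_cst mulr_gt0 ?boundary_ratio_gt0 // mulr_gt0 ?expR_gt0 //.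
exact: bulk_cst_gt0.
Qed.

Lemma core_cst_gt0 : 0 < core_cst.
Proof.
by rewrite /core_cst mulr_gt0 ?boundary_ratio_gt0 // mulr_gt0 ?expR_gt0 // boundary_cst_gt0.
Qed.

Lemma min_width_ge0 : 0 <= min_width s1 s2 c3 eps N0.
Proof.
have tw : 0 <= tube_width s1 c3 by apply: ltW; exact: tube_width_gt0.
by apply: addr_ge0; [apply: addr_ge0; [exact: addr_ge0|]|]; exact: sqrtr_ge0.
Qed.

Lemma quarter_bounds (n i : nat) (q := (n %/ 4).+1) : (64 <= n)%N -> (i <= q)%N ->
  [/\ (n <= 8 * (n %/ 4))%N, (n <= 3 * (n - i - q))%N, (n <= 3 * (n - i))%N
    & (n %/ 4 < n - i)%N].
Proof. by rewrite /q => n64 iq; split; lia. Qed.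

(** The price of an end point at height [u]: of order [(u + 1) / sqrt n] in
    the boundary layer and of order one above it. *)
Definition damp (r u : R) : R := Num.min (u + 1) r / r.

Lemma damp_bounds r u : 0 < r -> 0 <= u -> 0 <= damp r u <= 1.
Proof.
move=> r0 u0; rewrite /damp; apply/andP; split.
  rewrite divr_ge0 ?(ltW r0) // le_min (ltW r0) andbT; lra.
by rewrite ler_pdivrMr // mul1r ge_min lexx orbT.
Qed.

Lemma damp_mono r u u' : 0 < r -> u <= u' -> damp r u <= damp r u'.
Proof.
move=> r0 uu'; rewrite /damp ler_wpM2r ?invr_ge0 ?(ltW r0) //.
by rewrite le_min ge_min lerD2r uu' /= ge_min lexx orbT.
Qed.

Section FixedLength.
Variables (n : nat) (eta : R).
Hypotheses (n64 : (64 <= n)%N) (eta0 : 0 <= eta) (etan : eta * n%:R ^+ 2 <= 1).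
Let r : R := Num.sqrt n%:R.
Let h := height s1.
Hypothesis scale_le : entrance_scale s1 c3 <= 2 * h * r.

Let n_gt0 : 0 < n%:R :> R.
Proof. by rewrite ltr0n; apply: leq_trans n64. Qed.

Let rr : r ^+ 2 = n%:R. Proof. by rewrite sqr_sqrtr // ltW. Qed.

Let r_ge8 : 8 <= r.
Proof.
rewrite -ler_sqr ?nnegrE ?sqrtr_ge0 // rr -natrX ler_nat; exact: n64.
Qed.

Let eta_scale : eta * (2 * h * r) ^+ 3 <= 1.
Proof.
have r8 := r_ge8; have h0 := height_gt0 s1_gt0; have h1 := height_le1 s1.
apply: le_trans etan; rewrite ler_wpM2l // -rr.
have hr : 2 * h * r <= 2 * r by rewrite ler_wpM2r //; rewrite /h; lra.
apply: (@le_trans _ _ ((2 * r) ^+ 3)).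
  by rewrite lerXn2r ?nnegrE // !mulr_ge0 // ?(ltW h0) //; lra.
have -> : (r ^+ 2) ^+ 2 = r * r ^+ 3 by ring.
rewrite exprMn ler_wpM2r ?exprn_ge0 //; lra.
Qed.

Let scale_steps : 4 * (2 * h * r) ^+ 2 <= s1 * (n %/ 4)%:R.
Proof.
have [q8 _ _ _] := quarter_bounds n64 (leq0n _).
have q8' : n%:R <= 8 * (n %/ 4)%:R :> R by rewrite -natrM ler_nat.
have hs := height_sqr_le s1_gt0; rewrite -/h in hs.
have -> : 4 * (2 * h * r) ^+ 2 = 16 * h ^+ 2 * n%:R by rewrite -rr; ring.
have p1 := s1_gt0; have n0 := n_gt0.
have := ler_wpM2r (ltW n0) hs; have := ler_wpM2l (ltW p1) q8'; lra.
Qed.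

Lemma walk_from_boundary Q s (f : R -> R) (be u : R) :
  admissible s1 s2 c3 eps N0 eta Q -> (forall l, l \in s -> Q l) ->
  (forall z, 0 <= f z) -> (n %/ 4 < size s)%N -> 0 <= be ->
  (forall i x, (0 < i <= (n %/ 4).+1)%N -> h * r <= x <= 2 * h * r ->
      be <= walk pos (drop i s) f x) ->
  0 <= u <= h * r ->
  be * (boundary_ratio * damp r u) <= walk pos s f u.
Proof.
move=> gQ hs f0 ns be0 hbe uh.
have [rQ _] := gQ.
have hreg l : l \in s -> regular s1 s2 c3 eta l by move=> /hs /rQ.
have uH : 0 <= u <= 2 * h * r / 2 by case/andP: uh => ? ?; apply/andP; split=> //; lra.
have := @walk_entrance _ s1 s2 c3 s1_gt0 c3_gt0 eta s f (2 * h * r) be u (n %/ 4)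
  hreg f0 scale_le eta0 eta_scale scale_steps ns be0 _ uH.
have hH : 2 * h * r / 2 = h * r by field.
rewrite hH => hent; apply: le_trans (hent hbe).
rewrite ler_wpM2l // /damp /boundary_ratio -/h.
have r8 := r_ge8; have h0 : 0 < h := height_gt0 s1_gt0.
have r0 : 0 < r by lra.
have [u0 _] := andP uh.
have -> : entrance_cst s1 c3 * (u + 1) / (2 * h * r) =
  entrance_cst s1 c3 / (2 * h) * ((u + 1) / r) by field; rewrite !gt_eqF.
have e0 := entrance_cst_gt0.
apply: ler_pM.
- rewrite le_min ler01 /=; apply: divr_ge0; [exact: ltW | by rewrite mulr_ge0 // ltW].
- apply: divr_ge0; last exact: ltW.
  by rewrite le_min (ltW r0) andbT addr_ge0.
- by rewrite ge_min lexx orbT.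
- by rewrite ler_wpM2r ?invr_ge0 ?(ltW r0) // ge_min lexx.
Qed.

(** From the boundary layer the walk enters the bulk within [n / 4] steps, at
    a price [damp r u], and the bulk estimate applies to the steps that are
    left; the entrance point differs from [u] by at most [2 * r], which
    changes the Gaussian factor by a constant. *)
Lemma walk_up Q s u y :
  admissible s1 s2 c3 eps N0 eta Q -> (forall l, l \in s -> Q l) ->
  (n <= 3 * (size s - (n %/ 4).+1))%N -> (n %/ 4 < size s <= n)%N ->
  0 <= u -> h * r <= y ->
  min_width s1 s2 c3 eps N0 * (r + spread s1 s2 eps N0 * (`|u - y| + 2 * r))
    <= aperture s1 s2 eps N0 * n%:R ->
  boundary_cst / r * damp r u * expR (- (2 * gauss_rate * ((u - y) ^+ 2 / n%:R)))
    <= walk pos s (bin y) u.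
Proof.
move=> gQ hs n1 /andP[n2 n3] u0 hy hW.
have r8 := r_ge8; have r0 : 0 < r by lra.
have h0 : 0 < h := height_gt0 s1_gt0; have h1 : h <= 1 := height_le1 s1.
have n0 := n_gt0.
have K0 := gauss_rate_ge0; have b0 := bulk_cst_gt0; have br0 := boundary_ratio_gt0.
have br1 : boundary_ratio <= 1 by rewrite /boundary_ratio ge_min lexx.
have n24 : (24 <= n)%N by apply: leq_trans n64.
have mw0 := min_width_ge0.
have sp0 : 0 < spread s1 s2 eps N0 by exact: spread_gt0.
have bulk t x : (forall l, l \in t -> Q l) -> (n <= 3 * size t)%N -> (size t <= n)%N ->
    h * r <= x -> `|x - y| <= `|u - y| + 2 * r ->
    bulk_cst s1 s2 c3 eps N0 / r * expR (- (gauss_rate * ((x - y) ^+ 2 / n%:R)))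
      <= walk pos t (bin y) x.
  move=> ht t1 t2 hx xy.
  apply: (walk_bulk s1_gt0 s2_ge0 c3_gt0 eps01 N0_gt0 n24 eta0 etan gQ) => //.
  apply: le_trans hW; rewrite ler_wpM2l // lerD2l ler_wpM2l //; exact: ltW.
have q0 : 0 <= (u - y) ^+ 2 / n%:R by rewrite divr_ge0 ?sqr_ge0 // ltW.
have /andP[d0 d1] := damp_bounds r0 u0.
have bc1 : boundary_cst <= bulk_cst s1 s2 c3 eps N0.
  rewrite /boundary_cst -mulrA ler_piMr ?(ltW b0) // mulr_ile1 ?expR_ge0 ?(ltW br0) //.
  by rewrite expRN_le1 // mulr_ge0.
have bc0 := boundary_cst_gt0.
have [uh|uh] := lerP (h * r) u.
  apply: le_trans (bulk s u hs _ n3 uh _); last first.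
  - by rewrite lerDl mulr_ge0 // ltW.
  - apply: (leq_trans n1); rewrite leq_mul2l leq_subr orbT //.
  apply: ler_pM; rewrite ?expR_ge0 //.
  - apply: mulr_ge0 => //; apply: divr_ge0; exact: ltW.
  - apply: (@le_trans _ _ (boundary_cst / r)).
      rewrite ler_piMr //; apply: divr_ge0; exact: ltW.
    by rewrite ler_wpM2r // invr_ge0 ltW.
  - rewrite ler_expR lerN2; have := mulr_ge0 K0 q0; lra.
pose be := bulk_cst s1 s2 c3 eps N0 / r * expR (- (8 * gauss_rate))
   * expR (- (2 * gauss_rate * ((u - y) ^+ 2 / n%:R))).
have be0 : 0 <= be.
  rewrite /be; apply: mulr_ge0; rewrite ?expR_ge0 //; apply: mulr_ge0; rewrite ?expR_ge0 //.
  apply: divr_ge0; exact: ltW.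
have -> : boundary_cst / r * damp r u * expR (- (2 * gauss_rate * ((u - y) ^+ 2 / n%:R))) =
  be * (boundary_ratio * damp r u) by rewrite /be /boundary_cst; ring.
apply: (walk_from_boundary gQ hs) => //; last by rewrite u0 ltW.
move=> i x /andP[i0 i1] /andP[x1 x2].
have szd : (size (drop i s) = size s - i)%N by rewrite size_drop.
have xu : `|x - u| <= 2 * h * r.
  have : 0 <= u by [].
  rewrite ler_norml => ?; lra.
have hr2 : 2 * h * r <= 2 * r.
  have : h * r <= 1 * r by rewrite ler_wpM2r // ltW.
  lra.
apply: le_trans (bulk (drop i s) x _ _ _ x1 _).
- rewrite /be -mulrA -expRD ler_wpM2l //; first by apply: divr_ge0; exact: ltW.
  rewrite ler_expR -opprD lerN2.
  have -> : 8 * gauss_rate + 2 * gauss_rate * ((u - y) ^+ 2 / n%:R) =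
     gauss_rate * ((8 * r ^+ 2 + 2 * (u - y) ^+ 2) / n%:R).
    by rewrite rr; field; rewrite gt_eqF.
  rewrite ler_wpM2l // ler_wpM2r ?invr_ge0 ?(ltW n0) //.
  have xu2 : (x - u) ^+ 2 <= (2 * r) ^+ 2.
    rewrite -[leLHS]real_normK ?num_real // lerXn2r ?nnegrE //; lra.
  have := sqr_ge0 ((x - u) - (u - y)); lra.
- by move=> l /mem_drop /hs.
- rewrite szd; apply: (leq_trans n1); rewrite leq_mul2l /=; exact: leq_sub2l.
- rewrite szd; apply: leq_trans n3; exact: leq_subr.
- have -> : x - y = (u - y) + (x - u) by ring.
  apply: (le_trans (ler_normD _ _)); rewrite lerD2l; exact: le_trans xu hr2.
Qed.

(** If [v] lies in the boundary layer as well, the reversed walk starts from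
    [v]: it enters the bulk at the price [damp r v], and from there
    [walk_up], reversed once more, leads to [u]. *)
Lemma walk_core Q s u v :
  admissible s1 s2 c3 eps N0 eta Q -> (forall l, l \in s -> Q l) -> size s = n ->
  0 <= u -> 0 <= v -> v - u + drift s \is a Num.int ->
  min_width s1 s2 c3 eps N0 * (r + spread s1 s2 eps N0 * (`|u - v| + 6 * r))
    <= aperture s1 s2 eps N0 * n%:R ->
  core_cst / r * damp r u * damp r v * expR (- (4 * gauss_rate * ((u - v) ^+ 2 / n%:R)))
    <= walk pos s (delta v) u.
Proof.
move=> gQ hs sn u0 v0 uv hW.
have r8 := r_ge8; have r0 : 0 < r by lra.
have h0 : 0 < h := height_gt0 s1_gt0; have h1 : h <= 1 := height_le1 s1.
have n0 := n_gt0.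
have K0 := gauss_rate_ge0; have br0 := boundary_ratio_gt0.
have br1 : boundary_ratio <= 1 by rewrite /boundary_ratio ge_min lexx.
have mw0 := min_width_ge0.
have sp0 : 0 < spread s1 s2 eps N0 by exact: spread_gt0.
have bc0 := boundary_cst_gt0.
have q0 : 0 <= (u - v) ^+ 2 / n%:R by rewrite divr_ge0 ?sqr_ge0 // ltW.
have /andP[du0 du1] := damp_bounds r0 u0.
have /andP[dv0 dv1] := damp_bounds r0 v0.
have hW' D : D <= `|u - v| + 6 * r ->
    min_width s1 s2 c3 eps N0 * (r + spread s1 s2 eps N0 * D)
    <= aperture s1 s2 eps N0 * n%:R.
  move=> hD; apply: le_trans hW; rewrite ler_wpM2l // lerD2l ler_wpM2l //; exact: ltW.
have [hv|hv] := lerP (h * r) v.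
  rewrite (walk_bin _ uv).
  have [_ b2 _ b4] := quarter_bounds n64 (leq0n _).
  rewrite !subn0 in b2 b4.
  apply: le_trans (walk_up gQ hs _ _ u0 hv (hW' _ _)); rewrite ?sn ?b4 ?leqnn //; last lra.
  have cc : core_cst <= boundary_cst.
    rewrite /core_cst -mulrA ler_piMr ?(ltW bc0) // mulr_ile1 ?expR_ge0 ?(ltW br0) //.
    by rewrite expRN_le1 // mulr_ge0.
  apply: ler_pM; rewrite ?expR_ge0 //.
  - apply: mulr_ge0 => //; apply: mulr_ge0 => //; apply: divr_ge0; last exact: ltW.
    exact/ltW/core_cst_gt0.
  - apply: (@le_trans _ _ (core_cst / r * damp r u)).
      rewrite ler_piMr //; apply: mulr_ge0 => //; apply: divr_ge0; last exact: ltW.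
      exact/ltW/core_cst_gt0.
    by rewrite ler_wpM2r // ler_wpM2r // invr_ge0 ltW.
  - rewrite ler_expR lerN2; have := mulr_ge0 K0 q0; lra.
have rQ := admissible_reflect gQ.
have hrs l : l \in reversal s -> Q (reflect_law l).
  by rewrite mem_rev => /mapP[l' /hs h' ->]; rewrite reflect_lawK.
have -> : walk pos s (delta v) u = walk pos (reversal s) (bin u) v.
  have := walk_reversal pos s u v; rewrite /pos u0 v0 !mul1r => ->.
  apply: walk_bin; rewrite drift_reversal.
  have -> : u - v + - drift s = - (v - u + drift s) by ring.
  by rewrite rpredN.
pose be := boundary_cst / r * damp r u * expR (- (36 * gauss_rate))
   * expR (- (4 * gauss_rate * ((u - v) ^+ 2 / n%:R))).
have be0 : 0 <= be.
  rewrite /be; apply: mulr_ge0; rewrite ?expR_ge0 //; apply: mulr_ge0; rewrite ?expR_ge0 //.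
  apply: mulr_ge0 => //; apply: divr_ge0; exact: ltW.
have -> : core_cst / r * damp r u * damp r v * expR (- (4 * gauss_rate * ((u - v) ^+ 2 / n%:R)))
  = be * (boundary_ratio * damp r v) by rewrite /be /core_cst; ring.
have hr2 : 2 * h * r <= 2 * r.
  have : h * r <= 1 * r by rewrite ler_wpM2r // ltW.
  lra.
apply: (walk_from_boundary rQ hrs) => //; last by rewrite v0 ltW.
- by rewrite size_reversal sn; have [_ _ _] := quarter_bounds n64 (leq0n _); rewrite subn0.
move=> i z /andP[i0 i1] /andP[z1 z2].
rewrite drop_reversal sn; set t := take _ s.
have szt : size t = (n - i)%N by rewrite size_takel // sn leq_subr.
have ht l : l \in t -> Q l by move=> /mem_take /hs.
(* a starting point of the lattice just above u *)
pose q := z + drift t - u; pose u' := u + (q - (Num.floor q)%:~R).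
have /andP[q1 q2] := floor_itv q; rewrite intrD in q2.
have uu' : u <= u' < u + 1 by rewrite /u'; lra.
have [uu1 uu2] := andP uu'.
have u'0 : 0 <= u' by lra.
have z0 : 0 <= z by apply: le_trans z1; rewrite mulr_ge0 // ltW.
have nt l : l \in reversal t -> nneg l.
  by apply: nneg_reversal => l' /ht h'; case: gQ => /(_ _ h')[].
apply: (@le_trans _ _ (walk pos (reversal t) (delta u') z)); last first.
  by apply: le_walk => // x; exact: delta_le_bin.
have := walk_reversal pos t u' z; rewrite /pos u'0 z0 !mul1r => <-.
rewrite (@walk_bin _ _ t u' z); last first.
  have -> : z - u' + drift t = (Num.floor q)%:~R by rewrite /u' /q; ring.
  exact: intr_int.
have [_ b2 _ b4] := quarter_bounds n64 i1.
have uz : `|u' - z| <= `|u - v| + 3 * r.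
  have -> : u' - z = (u - v) + ((u' - u) - (z - v)) by ring.
  apply: (le_trans (ler_normD _ _)); rewrite lerD2l ler_norml.
  have : 0 <= v by [].
  move=> ?; lra.
apply: le_trans (walk_up gQ ht _ _ u'0 z1 (hW' _ _)).
- rewrite /be -mulrA -expRD.
  apply: ler_pM; rewrite ?expR_ge0 //.
  + apply: mulr_ge0 => //; apply: divr_ge0; exact: ltW.
  + rewrite ler_wpM2l ?damp_mono //; apply: divr_ge0; exact: ltW.
  + rewrite ler_expR -opprD lerN2.
    have -> : 36 * gauss_rate + 4 * gauss_rate * ((u - v) ^+ 2 / n%:R) =
       2 * gauss_rate * ((18 * r ^+ 2 + 2 * (u - v) ^+ 2) / n%:R).
      by rewrite rr; field; rewrite gt_eqF.
    apply: ler_wpM2l; first exact: mulr_ge0.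
    apply: ler_wpM2r; first by rewrite invr_ge0 ltW.
    pose e := (u' - u) - (z - v).
    have e3 : `|e| <= 3 * r by rewrite ler_norml /e; lra.
    have e2 : e ^+ 2 <= (3 * r) ^+ 2.
      rewrite -[leLHS]real_normK ?num_real // lerXn2r ?nnegrE //; lra.
    have -> : u' - z = (u - v) + e by rewrite /e; ring.
    have := sqr_ge0 ((u - v) - e); lra.
- by rewrite szt.
- by rewrite szt b4 leq_subr.
- lra.
Qed.

End FixedLength.

End Core.

(** * Irreducible and aperiodic sequences *)

Require Import Defs.
From mathcomp Require Import all_classical all_reals all_analysis.
From mathcomp Require Import measurable_realfun.
Import Order.TTheory GRing.Theory Num.Theory numFieldNormedType.Exports.
Local Open Scope classical_set_scope.
Local Open Scope ring_scope.

(** The least positive difference [d] of two elements divides every element,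
    as a remainder would be a smaller difference; hence [d = 1], and two
    consecutive elements [m] and [m + 1] generate all [n >= m ^ 2]. *)
Lemma numerical_semigroup (A : set nat) : A 0%N ->
  (forall m n, A m -> A n -> A (m + n)%N) ->
  (forall d, (forall n, A n -> (d %| n)%N) -> d = 1%N) ->
  exists n0, forall n, (n0 <= n)%N -> A n.
Proof.
move=> A0 AD Agcd.
have AM q m : A m -> A (q * m)%N by elim: q => // q IH Am; rewrite mulSn; apply: AD => //; exact: IH.
pose gap d := `[< (0 < d)%N /\ exists m, A m /\ A (m + d)%N >].
have exgap : exists d, gap d.
  have [h|/existsNP[n /not_implyP[An /negP n0]]] := pselect (forall n, A n -> (n == 0)%N).
    suff : 0%N = 1%N by [].
    by apply: Agcd => n /h; rewrite dvd0n.
  by exists n; apply/asboolP; split; [rewrite lt0n|exists 0%N].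
case: (ex_minnP exgap) => d /asboolP[d0 [m [Am Amd]]] dmin.
(* a nonzero remainder modulo d would be a smaller gap *)
have d1 : d = 1%N.
  apply: Agcd => a Aa; rewrite /dvdn; apply/negPn/negP => r0.
  have /dmin : gap (a %% d)%N.
    apply/asboolP; split; first by rewrite lt0n.
    exists ((a %/ d) * (m + d))%N; split; first exact: AM.
    have -> : ((a %/ d) * (m + d) + a %% d = (a %/ d) * m + a)%N.
      by rewrite mulnDr -addnA -divn_eq.
    by apply: AD => //; exact: AM.
  by rewrite leqNgt ltn_mod d0.
rewrite d1 in Amd; exists (m * m)%N => n mn.
case: (posnP m) => [m0|m_gt0].
  by rewrite -[n]muln1; apply: AM; rewrite m0 in Amd.
have qm : (n %% m <= n %/ m)%N.
  apply: ltnW; apply: (@leq_trans m); first by rewrite ltn_mod.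
  by rewrite leq_divRL.
have -> : (n = (n %/ m - n %% m) * m + (n %% m) * (m + 1))%N.
  by rewrite mulnDr muln1 addnA -mulnDl subnK // -divn_eq.
by apply: AD; exact: AM.
Qed.

Section Reachability.
Context {R : realType}.
Implicit Types (a : int -> R).

Definition reach a (n : nat) (z : int) : Prop :=
  exists ks : seq int, [/\ size ks = n, \sum_(k <- ks) k = z &
    forall k, k \in ks -> 0 < a k].

Lemma reachD a m n y z : reach a m y -> reach a n z -> reach a (m + n)%N (y + z).
Proof.
move=> [s [<- <- hs]] [t [<- <- ht]]; exists (s ++ t).
rewrite size_cat big_cat; split=> // k; rewrite mem_cat => /orP[/hs|/ht] //.
Qed.

Lemma reach0 a : reach a 0 0.
Proof. by exists [::]; rewrite big_nil. Qed.

Lemma mc_step_reach (p : probability int R) a n x y :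
  (forall i, (0 < p [set i])%E -> 0 < a i) ->
  (0 < mc_step (walk_matrix p) n x y)%E -> reach a n (y - x).
Proof.
move=> pa; elim: n x => [|n IH] x /=.
  by case: eqP => [->|_]; rewrite ?ltxx // subrr => _; exact: reach0.
have q0 m x' y' : (0 <= mc_step (walk_matrix p) m x' y')%E.
  elim: m x' => [|m IHm] x' /=; first by rewrite lee_fin.
  by apply: esum_ge0 => z _; rewrite mule_ge0 // /walk_matrix.
move=> h; have [z [h1 h2]] : exists z, (0 < walk_matrix p x z)%E /\
    (0 < mc_step (walk_matrix p) n z y)%E.
  apply: contrapT => /forallNP hz; move: h; rewrite esum1 ?ltxx // => z _.
  have : (0 <= walk_matrix p x z)%E by rewrite /walk_matrix.
  rewrite le_eqVlt => /orP[/eqP <-|h1]; first by rewrite mul0e.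
  have := q0 n z y; rewrite le_eqVlt => /orP[/eqP <-|h2]; first by rewrite mule0.
  by case: (hz z).
have -> : y - x = (z - x) + (y - z) by ring.
rewrite -add1n; apply: reachD (IH _ h2).
exists [:: z - x]; rewrite big_seq1; split=> // k; rewrite inE => /eqP ->.
exact: pa.
Qed.

Lemma reach_prod a n z : (forall i, 0 <= a i) -> reach a n z ->
  exists ks : seq int, [/\ size ks = n, \sum_(k <- ks) k = z &
    0 < \prod_(k <- ks) a k].
Proof.
move=> a0 [ks [sz sm hk]]; exists ks; split=> //.
by rewrite big_seq; apply: prodr_gt0 => k /hk.
Qed.

(** Return times to the origin form a numerical semigroup whose common
    divisors are trivial by aperiodicity; a passage to [1] or [-1] can be
    completed by a loop of any large length. *)
Lemma irreducible_aperiodic_paths a : (forall i, 0 <= a i) ->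
  irreducible_aperiodic_seq a ->
  exists N0, (0 < N0)%N /\ forall n (j : int), (N0 <= n)%N -> j \in [:: 0; 1; -1] ->
    reach a n j.
Proof.
move=> a0 [p [b [irr aper b0 ab]]].
have pa i : (0 < p [set i])%E -> 0 < a i.
  by move=> h; rewrite -lte_fin ab mule_gt0 // lte_fin.
have [n0 hn0] : exists n0, forall n, (n0 <= n)%N -> reach a n 0.
  apply: (@numerical_semigroup [set n | reach a n 0]).
  - exact: reach0.
  - by move=> m n hm hn; rewrite -[0]addr0; exact: reachD.
  move=> d hd; have [_ /(_ d) h] := aper 0; apply/eqP; rewrite -dvdn1; apply: h.
  move=> k [k0 hk]; apply: hd => /=.
  by rewrite -[0](subrr (0 : int)); exact: mc_step_reach hk.
have [n1 h1] := irr 0 1; have [n2 h2] := irr 0 (-1).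
have {}h1 : reach a n1 1 by rewrite -[1](subr0 (1 : int)); exact: mc_step_reach h1.
have {}h2 : reach a n2 (-1).
  by rewrite -[-1](subr0 (-1 : int)); exact: mc_step_reach h2.
exists (n0 + n1 + n2).+1; split=> // n j hn.
rewrite !inE => /or3P[] /eqP ->.
- by apply: hn0; lia.
- have -> : n = (n1 + (n - n1))%N by lia.
  by rewrite -[1](addr0 (1 : int)); apply: reachD => //; apply: hn0; lia.
- have -> : n = (n2 + (n - n2))%N by lia.
  by rewrite -[-1](addr0 (-1 : int)); apply: reachD => //; apply: hn0; lia.
Qed.

(** A path of bounded jumps whose weight is bounded below by the sequence [a]
    alone, so that it serves every law above [a] and every window of size at
    least [L]. *)
Definition path_cst (a : int -> R) (eps : R) (L n : nat) (j : int) : Prop :=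
  exists ks : seq int, [/\ size ks = n, \sum_(k <- ks) k = j,
    forall k, k \in ks -> (`|k| <= L)%N & eps <= \prod_(k <- ks) a k].

Lemma reach_uniform a (r : seq (nat * int)) : (forall i, 0 <= a i) ->
  (forall nj, nj \in r -> reach a nj.1 nj.2) ->
  exists (eps : R) (L : nat), 0 < eps <= 1 /\
    forall nj, nj \in r -> path_cst a eps L nj.1 nj.2.
Proof.
move=> a0; elim: r => [|[n j] r IH] hr.
  by exists 1, 0%N; rewrite ltr01 lexx.
have [|eps [L [/andP[e0 e1] he]]] := IH.
  by move=> nj h; apply: hr; rewrite inE h orbT.
have [ks [sz sm pr]] := reach_prod a0 (hr (n, j) (mem_head _ _)).
exists (Num.min eps (\prod_(k <- ks) a k)), (maxn L (\max_(k <- ks) `|k|)%N).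
split; first by rewrite lt_min e0 pr /= ge_min e1.
move=> nj; rewrite inE => /predU1P[->|/he[ks' [h1 h2 h3 h4]]].
  exists ks; split=> //; last by rewrite ge_min lexx orbT.
  move=> k kks; rewrite leq_max; apply/orP; right.
  exact: (@leq_bigmax_seq _ _ xpredT (fun k : int => `|k|%N)).
exists ks'; split=> //; last by rewrite ge_min h4.
by move=> k /h3 h; rewrite leq_max h.
Qed.

(** The quantitative content of irreducibility and aperiodicity. The two
    distinct atoms [k1] and [k2] will bound the variance from below: with a
    single atom all paths of a given length would have the same end point. *)
Lemma seq_paths a : (forall i, 0 <= a i) -> irreducible_aperiodic_seq a ->
  exists (N0 : nat) (eps sig : R) (L : nat), [/\ (0 < N0)%N, 0 < eps <= 1, 0 < sig,
    forall n j, (N0 <= n < N0.*2)%N -> j \in [:: 0; 1; -1] -> path_cst a eps L n j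
    & exists k1 k2, [/\ k1 <> k2, (`|k1| <= L)%N, (`|k2| <= L)%N, sig <= a k1
        & sig <= a k2]].
Proof.
move=> a0 ha; have [N0 [N0_gt0 hN]] := irreducible_aperiodic_paths a0 ha.
have [k1 [k2 [k12 ak1 ak2]]] : exists k1 k2, [/\ k1 <> k2, 0 < a k1 & 0 < a k2].
  apply: contrapT => hk.
  (* otherwise a has a single atom, and a path of N0 steps cannot have both
     sums 0 and 1 *)
  have same k k' : 0 < a k -> 0 < a k' -> k = k'.
    by move=> h h'; apply: contrapT => kk; apply: hk; exists k, k'.
  have [ks [sz sm hks]] := hN N0 0 (leqnn _) isT.
  have [ks' [sz' sm' hks']] := hN N0 1 (leqnn _) isT.
  case: ks sz sm hks => [|k0 ks] sz sm hks; first by move: N0_gt0; rewrite -sz.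
  have ak0 : 0 < a k0 by apply: hks; rewrite mem_head.
  have cst s n : size s = n -> (forall k, k \in s -> 0 < a k) ->
      \sum_(k <- s) k = k0 *+ n.
    move=> <- {n}; elim: s => [|k s IHs] hs; first by rewrite big_nil.
    rewrite big_cons IHs /= ?mulrS; last by move=> k' h; apply: hs; rewrite inE h orbT.
    by congr (_ + _); apply: same ak0; apply: hs; rewrite mem_head.
  move: sm'; rewrite (cst ks' N0) // -(cst (k0 :: ks) N0) // sm.
  by [].
pose r := [seq (n, j) | n <- iota N0 N0, j <- [:: 0; 1; -1 : int]].
have hr nj : nj \in r -> reach a nj.1 nj.2.
  move=> /allpairsP[[n j] /= [+ hj ->]] /=; rewrite mem_iota => /andP[hn _].
  exact: hN.
have [eps [L [e01 he]]] := reach_uniform a0 hr.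
exists N0, eps, (Num.min (a k1) (a k2)), (maxn L (maxn `|k1| `|k2|)).
split=> //; first by rewrite lt_min ak1.
- move=> n j /andP[n1 n2] hj; have [|ks [h1 h2 h3 h4]] := he (n, j).
    apply/allpairsP; exists (n, j); split=> //=; rewrite mem_iota n1 addnn //.
  by exists ks; split=> // k /h3 h; rewrite leq_max h.
- exists k1, k2; split=> //; rewrite ?leq_max ?leqnn ?orbT //.
    by rewrite ge_min lexx.
  by rewrite ge_min lexx orbT.
Qed.

Lemma walk_path a (L : nat) (t : seq (@law R)) (ks : seq int) (g : R -> R) x :
  (forall i, 0 <= a i) -> (forall z, 0 <= g z) -> (forall l, l \in t -> nneg l) ->
  (forall l, l \in t -> forall k f, (`|k| <= L)%N -> (forall d, 0 <= f d) ->
      a k * f (k%:~R - l.1) <= step l f) ->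
  size ks = size t -> (forall k, k \in ks -> (`|k| <= L)%N) ->
  \prod_(k <- ks) a k * g (x + (\sum_(k <- ks) k)%:~R - drift t) <= walk predT t g x.
Proof.
move=> a0 g0; elim: t ks x => [|l t IH] [|k ks] x //= nt ht.
  by rewrite !big_nil /drift big_nil mul1r addr0 subr0.
move=> [sz] hks; rewrite !big_cons.
have w0 z : 0 <= walk predT t g z.
  by apply: walk_ge0 => // l' h; apply: nt; rewrite inE h orbT.
have hk : (`|k| <= L)%N by apply: hks; rewrite mem_head.
have f0 d : 0 <= (predT (x + d))%:R * walk predT t g (x + d) by rewrite mul1r.
apply: le_trans (ht l (mem_head _ _) k _ hk f0).
rewrite mul1r -mulrA ler_wpM2l //.
have -> : x + (k + \sum_(j <- ks) j)%:~R - drift (l :: t) =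
   x + (k%:~R - l.1) + (\sum_(j <- ks) j)%:~R - drift t.
  by rewrite /drift big_cons intrD; ring.
apply: IH => //.
- by move=> l' h; apply: nt; rewrite inE h orbT.
- by move=> l' h; apply: ht; rewrite inE h orbT.
- by move=> k' h; apply: hks; rewrite inE h orbT.
Qed.

(** Paths with sums [0], [1] and [-1] have weights at least [eps] each, and
    [lazy] is a convex combination of the three values that they reach. *)
Lemma minorized_paths a (eps : R) (L : nat) (t : seq (@law R)) :
  (forall i, 0 <= a i) -> (forall l, l \in t -> nneg l) ->
  (forall l, l \in t -> forall k f, (`|k| <= L)%N -> (forall d, 0 <= f d) ->
      a k * f (k%:~R - l.1) <= step l f) ->
  (forall j, j \in [:: 0; 1; -1] -> path_cst a eps L (size t) j) ->
  minorized eps t.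
Proof.
move=> a0 nt ht hp; exists (drift t) => g x g0.
have h j : j \in [:: 0; 1; -1] -> eps * g (x + j%:~R - drift t) <= walk predT t g x.
  move=> /hp[ks [sz sm hks he]].
  apply: le_trans (walk_path x a0 g0 nt ht sz hks).
  by rewrite sm ler_wpM2r.
have := h 0 isT; have := h 1 isT; have := h (-1) isT.
rewrite /lazy rmorphN /= !rmorph1 rmorph0 addr0.
have -> : x + -1 - drift t = x - drift t - 1 by ring.
have -> : x + 1 - drift t = x - drift t + 1 by ring.
lra.
Qed.

End Reachability.

(** * Truncation *)

Definition window (L : nat) : seq int := [seq i%:Z - L%:Z | i <- iota 0 L.*2.+1].

Lemma mem_window L k : (k \in window L) = (`|k| <= L)%N.
Proof.
apply/mapP/idP => [[i]|kL].
  by rewrite mem_iota => /andP[_ iL] ->; lia.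
by exists (absz (k + L%:Z)); [rewrite mem_iota|]; lia.
Qed.

Lemma window_uniq L : uniq (window L).
Proof. by rewrite map_inj_uniq ?iota_uniq // => i j /addIr[]. Qed.

Section TruncatedLaw.
Context {d : measure_display} {T : measurableType d} {R : realType}.
Variables (P : probability T R) (X : {RV P >-> int}).
Implicit Types (g : int -> R) (k : int) (L : nat).

Definition mass k : R := fine (P (X @^-1` [set k])).

Definition trunc g L (w : T) : R := if (`|X w| <= L)%N then g (X w) else 0.

Lemma measurable_fiber k : measurable (X @^-1` [set k]).
Proof. by rewrite -[X @^-1` _]setTI; exact: (measurable_funP X). Qed.

Lemma measurable_RV_comp g : measurable_fun [set: T] (fun w => g (X w)).
Proof.
apply: (@measurableT_comp _ _ _ _ _ _ g) => //; exact: (measurable_funP X).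
Qed.

Lemma massE k : (mass k)%:E = P (X @^-1` [set k]).
Proof. by rewrite /mass fineK // fin_num_measure //; exact: measurable_fiber. Qed.

Lemma mass_ge0 k : 0 <= mass k.
Proof. by rewrite /mass fine_ge0. Qed.

Lemma trunc_sum g L w :
  trunc g L w = \sum_(k <- window L) g k * \1_(X @^-1` [set k]) w.
Proof.
have ind k : \1_(X @^-1` [set k]) w = (X w == k)%:R :> R.
  by rewrite indicE; congr (nat_of_bool _)%:R; apply/idP/eqP; rewrite inE.
under eq_bigr => k _ do rewrite ind.
rewrite /trunc -mem_window; case: ifP => Xw.
  rewrite (bigD1_seq (X w)) ?window_uniq //= eqxx mulr1 big1 ?addr0 //.
  by move=> k /negbTE; rewrite eq_sym => ->; rewrite mulr0.
rewrite big_seq big1 // => k kL; case: eqP => [Xk|_]; last by rewrite mulr0.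
by move: Xw; rewrite Xk kL.
Qed.

Lemma integrable_trunc g L : P.-integrable [set: T] (EFin \o trunc g L).
Proof.
have -> : EFin \o trunc g L = fun w =>
    (\sum_(k <- window L) (g k)%:E * (\1_(X @^-1` [set k]) w)%:E)%E.
  by apply/funext => w; rewrite /= trunc_sum -sumEFin.
apply: integrable_sum => // k _; apply: integrableZl => //.
exact/integrable_indic/measurable_fiber.
Qed.

Lemma integrable_piece (c : R) k :
  P.-integrable [set: T] (fun w => (c * \1_(X @^-1` [set k]) w)%:E).
Proof.
under eq_fun => w do rewrite EFinM.
by apply: integrableZl => //; exact/integrable_indic/measurable_fiber.
Qed.

Lemma integral_trunc g L :
  (\int[P]_w (trunc g L w)%:E)%E = (\sum_(k <- window L) mass k * g k)%:E.
Proof.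
under eq_integral => w _ do rewrite trunc_sum -sumEFin.
rewrite integral_sum //; last first.
  by move=> k; exact: integrable_piece.
rewrite -sumEFin; apply: eq_bigr => k _.
under eq_integral => w _ do rewrite EFinM.
rewrite integralZl //; last exact/integrable_indic/measurable_fiber.
rewrite integral_indic //; last exact: measurable_fiber.
rewrite setIT [RHS]EFinM muleC; congr (_ * _)%E.
exact: (esym (massE k)).
Qed.

Lemma trunc_cvg g w : (trunc g L w)%:E @[L --> \oo] --> (g (X w))%:E.
Proof.
apply: cvg_near_cst; exists `|X w|%N => // L /= XL.
by rewrite /trunc XL.
Qed.

(** Dominated convergence, applied to the values of the variable in growing
    windows. *)
Lemma trunc_mean_cvg g (eta : R) : P.-integrable [set: T] (fun w => (g (X w))%:E) ->
  0 < eta -> exists L0, forall L, (L0 <= L)%N ->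
    `|\sum_(k <- window L) mass k * g k - fine (\int[P]_w (g (X w))%:E)%E| <= eta.
Proof.
move=> ig eta0.
have mg := measurable_RV_comp g.
have bd w L : (`|(trunc g L w)%:E| <= `|(g (X w))%:E|)%E.
  by rewrite /trunc; case: ifP => // _; rewrite abse0.
have [_ _ h] := @dominated_convergence _ _ _ P setT measurableT
  (fun L w => (trunc g L w)%:E) (fun w => (g (X w))%:E) (fun w => `|(g (X w))%:E|%E)
  (fun L => measurable_int P (integrable_trunc g L))
  (measurable_int P ig)
  (aeW _ (fun w _ => @trunc_cvg g w)) (integrable_abse ig)
  (aeW _ (fun w L _ => bd w L)).
have {h} : (fun L => (\sum_(k <- window L) mass k * g k)%:E) @ \oo -->
    (\int[P]_w (g (X w))%:E)%E.
  have -> : (fun L => (\sum_(k <- window L) mass k * g k)%:E) =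
     [sequence (\int[P]_w (trunc g L w)%:E)%E]_L.
    by apply/funext => L; rewrite /= integral_trunc.
  exact: h.
have fi := integrable_fin_num measurableT ig.
rewrite -(fineK fi) => /fine_cvgP[_] /cvgrPdist_le /(_ _ eta0)[L0 _ hL].
exists L0 => L LL0; have := hL L LL0; by rewrite /= distrC.
Qed.

(** Monotone convergence: partial sums over windows are integrals of
    truncations. *)
Lemma integrable_of_bounded g (B : R) : (forall k, 0 <= g k) ->
  (forall L, \sum_(k <- window L) mass k * g k <= B) ->
  P.-integrable [set: T] (fun w => (g (X w))%:E).
Proof.
move=> g0 hB; apply/integrableP; split.
  exact/measurable_EFinP/measurable_RV_comp.
have t0 L w : (0 <= (trunc g L w)%:E)%E by rewrite lee_fin /trunc; case: ifP.
have nd w : nondecreasing_seq (fun L => (trunc g L w)%:E).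
  move=> m n mn; rewrite lee_fin /trunc; case: ifP => h; last by case: ifP.
  by rewrite (leq_trans h mn).
have := @monotone_convergence _ _ _ P setT measurableT (fun L w => (trunc g L w)%:E)
  (fun L => measurable_int P (integrable_trunc g L)) (fun L w _ => t0 L w) (fun w _ => nd w).
have -> : (\int[P]_w `|(g (X w))%:E|)%E = (\int[P]_w limn (fun L => (trunc g L w)%:E))%E.
  apply: eq_integral => w _; rewrite gee0_abs ?lee_fin //.
  by apply/esym/cvg_lim => //; exact: trunc_cvg.
move=> ->; apply: (@le_lt_trans _ _ B%:E); last exact: ltry.
apply: lime_le.
  apply: ereal_nondecreasing_is_cvgn => m n mn; apply: ge0_le_integral => //.
  - exact: (measurable_int P (integrable_trunc g m)).
  - exact: (measurable_int P (integrable_trunc g n)).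
  - by move=> w _; exact: nd.
by apply: nearW => L; rewrite integral_trunc lee_fin.
Qed.

Lemma esum_window (a : int -> \bar R) L : (forall k, 0 <= a k)%E ->
  (\sum_(k <- window L) a k <= \esum_(k in [set: int]) a k)%E.
Proof.
move=> a0; apply: esum_ge; exists [set` window L].
  by split => //; exact: finite_seq.
by rewrite -fsbig_seq ?window_uniq.
Qed.

(** The weights are not renormalised, and [mu] will be the mean of the whole
    law: truncation discards paths and does not modify the others. *)
Definition truncated_law (mu : R) L : @law R := (mu, [seq (mass k, k) | k <- window L]).

Lemma step_truncated mu L (f : R -> R) :
  step (truncated_law mu L) f = \sum_(k <- window L) mass k * f (k%:~R - mu).
Proof. by rewrite /step big_map. Qed.

End TruncatedLaw.

(** * Laws with uniform exponential moments *)

Section ClassLaw.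
Context {d : measure_display} {T : measurableType d} {R : realType}.
Variables (P : probability T R) (X : {RV P >-> int}).
Variables (delta c0 : R) (a : int -> R).
Hypotheses (delta_gt0 : 0 < delta) (c0_gt0 : 0 < c0).
Hypothesis Xclass : law_class delta c0 a (distribution P X).

(** The centring used by [centered_walk]. *)
Definition mean : R := fine ('E_P[fun w => ((X w)%:~R : R)]).

Lemma seq_le_mass k : a k <= mass X k.
Proof.
have [_ /(_ k)] := Xclass; rewrite -lee_fin massE; exact: le_trans.
Qed.

Lemma exp_moment t L : `|t| <= delta ->
  \sum_(k <- window L) mass X k * expR (t * k%:~R) <= c0.
Proof.
move=> td; have [h _] := Xclass; rewrite -lee_fin -sumEFin.
apply: le_trans h; apply: (@le_trans _ _ (\esum_(k in [set: int])
   (distribution P X [set k] * (expR (t * k%:~R))%:E)%E)); last first.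
  by apply: ereal_sup_ubound; exists t.
apply: le_trans (esum_window L _); last first.
  by move=> k; rewrite mule_ge0 // lee_fin expR_ge0.
rewrite le_eqVlt; apply/orP; left; apply/eqP; apply: eq_bigr => k _.
rewrite EFinM; congr (_ * _)%E; exact: massE.
Qed.

(** The cube of [`|x|] is at most [27 / delta ^+ 3] times the sum of the two
    exponentials at [delta] and [- delta], each of mean at most [c0]. *)
Definition moment3 : R := 54 * c0 / delta ^+ 3.
Definition mean_bound : R := moment3 + 1.

Lemma moment3_gt0 : 0 < moment3.
Proof. by rewrite /moment3 divr_gt0 ?exprn_gt0 // mulr_gt0. Qed.

Lemma cube_le_exp (x : R) : `|x| ^+ 3 <=
  27 / delta ^+ 3 * (expR (delta * x) + expR (- delta * x)).
Proof.
have d3 : 0 < delta ^+ 3 by rewrite exprn_gt0.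
(* the cube of t / 3 <= exp (t / 3) *)
have h : (delta * `|x| / 3) ^+ 3 <= expR (delta * `|x|).
  have -> : delta * `|x| = 3%:R * (delta * `|x| / 3) by field.
  rewrite expRM_natl (_ : 3%:R * (delta * `|x| / 3) / 3 = delta * `|x| / 3); last by field.
  rewrite lerXn2r ?nnegrE ?expR_ge0 //; first by rewrite divr_ge0 // mulr_ge0 // ltW.
  apply: le_trans (expR_ge1Dx _); lra.
have -> : `|x| ^+ 3 = 27 / delta ^+ 3 * (delta * `|x| / 3) ^+ 3.
  by field; rewrite gt_eqF.
rewrite ler_wpM2l ?divr_ge0 ?(ltW d3) //; apply: (le_trans h).
have e1 := expR_ge0 (delta * x); have e2 := expR_ge0 (- delta * x).
have [x0|x0] := lerP 0 x; first by rewrite ger0_norm //; lra.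
by rewrite ltr0_norm // mulrN -mulNr; lra.
Qed.

Lemma window_moment3 L : \sum_(k <- window L) mass X k * `|k%:~R| ^+ 3 <= moment3.
Proof.
apply: (@le_trans _ _ (\sum_(k <- window L) 27 / delta ^+ 3 *
   (mass X k * expR (delta * k%:~R) + mass X k * expR (- delta * k%:~R)))).
  apply: ler_sum => k _.
  have -> : 27 / delta ^+ 3 * (mass X k * expR (delta * k%:~R) +
      mass X k * expR (- delta * k%:~R)) = mass X k * (27 / delta ^+ 3 *
      (expR (delta * k%:~R) + expR (- delta * k%:~R))) by ring.
  by rewrite ler_wpM2l ?mass_ge0 //; exact: cube_le_exp.
rewrite -big_distrr /= big_split /=.
have h1 := @exp_moment delta L; have h2 := @exp_moment (- delta) L.
rewrite normrN (gtr0_norm delta_gt0) lexx in h1 h2.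
have -> : moment3 = 27 / delta ^+ 3 * (c0 + c0).
  by rewrite /moment3; field; rewrite gt_eqF.
rewrite ler_wpM2l ?divr_ge0 ?exprn_ge0 ?(ltW delta_gt0) //.
by apply: lerD; [apply: h1 | apply: h2].
Qed.

Lemma int_norm_le_cube (k : int) : `|k%:~R : R| <= `|k%:~R| ^+ 3 /\
  (k%:~R : R) ^+ 2 <= `|k%:~R| ^+ 3.
Proof.
rewrite -[(k%:~R : R) ^+ 2]real_normK ?num_real //.
have : `|k%:~R : R| = 0 \/ 1 <= `|k%:~R : R|.
  rewrite -intr_norm -natr_absz; case: `|k|%N => [|n]; first by left.
  by right; rewrite ler1n.
set x := `|k%:~R : R|; case=> [->|x1]; first by rewrite !expr0n.
by rewrite -{1}[x]expr1 !ler_weXn2l.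
Qed.

Lemma window_mass L : \sum_(k <- window L) mass X k <= 1.
Proof.
rewrite -lee_fin; have -> : \sum_(k <- window L) mass X k =
   \sum_(k <- window L) mass X k * 1 by apply: eq_bigr => k _; rewrite mulr1.
have <- := @integral_trunc _ _ _ P X (fun=> 1) L.
have <- : (\int[P]_w (1%:E : \bar R))%E = 1%E.
  by rewrite integral_cst // mul1e; exact: probability_setT.
apply: ge0_le_integral => //.
- by move=> w _; rewrite lee_fin /trunc; case: ifP.
- exact: (measurable_int P (integrable_trunc X (fun=> 1) L)).
- by move=> w _; rewrite lee_fin /trunc; case: ifP.
Qed.

Lemma integrable_class : P.-integrable [set: T] (fun w => ((X w)%:~R : R)%:E).
Proof.
have : P.-integrable [set: T] (fun w => (`|(X w)%:~R : R|)%:E).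
  apply: (@integrable_of_bounded _ _ _ P X (fun k => `|k%:~R : R|) moment3) => // L.
  apply: le_trans (window_moment3 L); apply: ler_sum => k _.
  by rewrite ler_wpM2l ?mass_ge0 //; have [] := int_norm_le_cube k.
apply: le_integrable => //.
  apply/measurable_EFinP; exact: (measurable_RV_comp X (fun k => k%:~R : R)).
by move=> w _; rewrite /= normr_id.
Qed.

Lemma window_mean_mass (eta : R) : 0 < eta -> exists L0, forall L, (L0 <= L)%N ->
  `|\sum_(k <- window L) mass X k * k%:~R - mean| <= eta /\
  1 - eta <= \sum_(k <- window L) mass X k.
Proof.
move=> eta0.
have [L1 h1] := @trunc_mean_cvg _ _ _ P X (fun k => k%:~R) eta integrable_class eta0.
have i1 : P.-integrable [set: T] (fun w => ((fun=> 1) (X w) : R)%:E).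
  exact: (finite_measure_integrable_cst P 1).
have [L2 h2] := @trunc_mean_cvg _ _ _ P X (fun=> 1) eta i1 eta0.
exists (maxn L1 L2) => L; rewrite geq_max => /andP[/h1 hL1 /h2 hL2]; split.
  rewrite /mean expectation.unlock; exact: hL1.
have e1 : fine (\int[P]_w (1 : R)%:E)%E = 1.
  by rewrite integral_cst //= mul1e probability_setT.
rewrite /= e1 in hL2.
move: hL2; under eq_bigr => k _ do rewrite mulr1.
by rewrite ler_norml => /andP[? _]; lra.
Qed.

Lemma mean_le : `|mean| <= mean_bound.
Proof.
have [L0 /(_ L0 (leqnn _))[h _]] := window_mean_mass ltr01.
have -> : mean = (\sum_(k <- window L0) mass X k * k%:~R) -
   (\sum_(k <- window L0) mass X k * k%:~R - mean) by ring.
apply: (le_trans (ler_normB _ _)); rewrite /mean_bound lerD //.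
apply: (le_trans (ler_norm_sum _ _ _)); apply: le_trans (window_moment3 L0).
apply: ler_sum => k _; rewrite normrM (ger0_norm (mass_ge0 X k)).
by rewrite ler_wpM2l ?mass_ge0 //; have [] := int_norm_le_cube k.
Qed.

(** Second moments of [k - mean], from those of [k] and the bound on the
    mean; similarly for [class_third]. *)
Definition class_var : R := 2 * moment3 + 2 * mean_bound ^+ 2.
Definition class_third : R := 4 * moment3 + 4 * mean_bound ^+ 3.

Lemma step_dominates L1 L k (f : R -> R) : (L1 <= L)%N -> (`|k| <= L1)%N ->
  (forall x, 0 <= f x) ->
  a k * f (k%:~R - mean) <= step (truncated_law X mean L) f.
Proof.
move=> L1L kL f0; rewrite step_truncated.
rewrite (bigD1_seq k) ?window_uniq ?mem_window ?(leq_trans kL) //=.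
apply: (@le_trans _ _ (mass X k * f (k%:~R - mean))).
  by rewrite ler_wpM2r // seq_le_mass.
by rewrite lerDl sumr_ge0 // => j _; rewrite mulr_ge0 ?mass_ge0.
Qed.

Lemma nneg_truncated L : nneg (truncated_law X mean L).
Proof. by move=> _ /mapP[k _ ->]; exact: mass_ge0. Qed.

(** The moment bounds hold uniformly over the class, and the defects of mass
    and mean vanish as the window grows, though at a speed depending on the
    law. Of two distinct integers one is at distance at least [1 / 2] from
    the mean, whence the lower bound on the variance. *)
Lemma regular_truncated (sig eta : R) L1 k1 k2 : k1 <> k2 ->
  (`|k1| <= L1)%N -> (`|k2| <= L1)%N -> sig <= a k1 -> sig <= a k2 -> 0 < sig ->
  0 < eta -> exists L0, forall L, (L0 <= L)%N ->
  regular (sig / 4) class_var class_third eta (truncated_law X mean L).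
Proof.
move=> k12 k1L k2L ak1 ak2 sig0 eta0.
have M0 := moment3_gt0; have muM := mean_le.
have b1 : 1 <= mean_bound by rewrite /mean_bound lerDr ltW.
pose eta' := eta / (1 + mean_bound).
have eta'E : eta' * (1 + mean_bound) = eta by rewrite mulfVK // gt_eqF //; lra.
have eta'0 : 0 < eta' by rewrite divr_gt0 //; lra.
have [L0 hL0] := window_mean_mass eta'0.
exists (maxn L0 L1) => L; rewrite geq_max => /andP[/hL0[hm hs] L1L].
set mu := mean in muM hm *; set S := \sum_(k <- window L) mass X k in hs.
have S1 : S <= 1 by exact: window_mass.
have S0 : 0 <= S by rewrite sumr_ge0 // => k _; exact: mass_ge0.
have n0 := normr_ge0 mu.
have ee : eta' <= eta.
  have : 0 <= eta' * mean_bound by rewrite mulr_ge0 ?ltW //; lra.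
  lra.
have third := window_moment3 L.
split.
- exact: nneg_truncated.
- rewrite step_truncated; have -> : \sum_(k <- window L) mass X k * 1 = S.
    by apply: eq_bigr => k _; rewrite mulr1.
  by rewrite S1 andbT; lra.
- rewrite step_truncated.
  have -> : \sum_(k <- window L) mass X k * id (k%:~R - mu) =
     (\sum_(k <- window L) mass X k * k%:~R - mu) + mu * (1 - S).
    rewrite mulrBr mulr1 addrA subrK /S big_distrr /= -sumrB.
    by apply: eq_bigr => k _; rewrite mulrBr [mu * _]mulrC.
  apply: (le_trans (ler_normD _ _)); rewrite normrM (ger0_norm (_ : 0 <= 1 - S)); last lra.
  have : `|mu| * (1 - S) <= mean_bound * eta' by apply: ler_pM => //; lra.
  move: eta'E hm; clearbody eta'; lra.
- apply/andP; split.
    have sq0 (x : R) : 0 <= x ^+ 2 by exact: sqr_ge0.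
    have d1 := step_dominates L1L k1L sq0; have d2 := step_dominates L1L k2L sq0.
    rewrite -/mu in d1 d2.
    have e1 := ler_wpM2r (sq0 (k1%:~R - mu)) ak1.
    have e2 := ler_wpM2r (sq0 (k2%:~R - mu)) ak2.
    have kk : 1 <= (k1%:~R - k2%:~R : R) ^+ 2.
      rewrite -intrB -rmorphXn /= -[1]/(1%:~R) ler_int.
      have : k1 - k2 != 0 by rewrite subr_eq0; apply/eqP.
      by move: (k1 - k2) => z z0; have : 0 < z ^+ 2 by rewrite exprn_even_gt0.
    have kk' : 1 / 2 <= (k1%:~R - mu) ^+ 2 + (k2%:~R - mu) ^+ 2.
      have := sq0 ((k1%:~R - mu) + (k2%:~R - mu)); lra.
    have := ler_wpM2l (ltW sig0) kk'; lra.
  rewrite step_truncated.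
  apply: (@le_trans _ _ (\sum_(k <- window L)
      (2 * (mass X k * `|k%:~R| ^+ 3) + 2 * mean_bound ^+ 2 * mass X k))).
    apply: ler_sum => k _.
    have -> : 2 * (mass X k * `|k%:~R| ^+ 3) + 2 * mean_bound ^+ 2 * mass X k =
      mass X k * (2 * `|k%:~R| ^+ 3 + 2 * mean_bound ^+ 2) by ring.
    rewrite ler_wpM2l ?mass_ge0 //.
    have [_ h] := int_norm_le_cube k.
    have mu2 : mu ^+ 2 <= mean_bound ^+ 2.
      by rewrite -[leLHS]real_normK ?num_real // lerXn2r ?nnegrE //; lra.
    have := sqr_ge0 (k%:~R + mu); lra.
  rewrite big_split /= -!big_distrr /= -/S /class_var.
  have : 2 * mean_bound ^+ 2 * S <= 2 * mean_bound ^+ 2.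
    by rewrite ler_piMr // mulr_ge0 // sqr_ge0.
  lra.
- rewrite step_truncated.
  apply: (@le_trans _ _ (\sum_(k <- window L)
      (4 * (mass X k * `|k%:~R| ^+ 3) + 4 * mean_bound ^+ 3 * mass X k))).
    apply: ler_sum => k _.
    have -> : 4 * (mass X k * `|k%:~R| ^+ 3) + 4 * mean_bound ^+ 3 * mass X k =
      mass X k * (4 * `|k%:~R| ^+ 3 + 4 * mean_bound ^+ 3) by ring.
    rewrite ler_wpM2l ?mass_ge0 //.
    apply: (@le_trans _ _ ((`|k%:~R| + mean_bound) ^+ 3)).
      rewrite lerXn2r ?nnegrE ?addr_ge0 //; first by lra.
      by apply: (le_trans (ler_normB _ _)); rewrite lerD2l.
    have k0 : 0 <= `|k%:~R : R| by exact: normr_ge0.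
    have : 0 <= (`|k%:~R : R| + mean_bound) * (`|k%:~R| - mean_bound) ^+ 2.
      by rewrite mulr_ge0 ?sqr_ge0 // addr_ge0 //; lra.
    set A := `|k%:~R : R|; set B := mean_bound; lra.
  rewrite big_split /= -!big_distrr /= -/S /class_third.
  have : 4 * mean_bound ^+ 3 * S <= 4 * mean_bound ^+ 3.
    by rewrite ler_piMr // mulr_ge0 // exprn_ge0 //; lra.
  lra.
Qed.

End ClassLaw.

(** * From paths to probabilities *)

Section PathProbability.
Context {d : measure_display} {T : measurableType d} {R : realType}.
Variables (P : probability T R) (n : nat) (X : 'I_n -> {RV P >-> int}).
Variables (u v : R).

Lemma le_bigmin_seq (x : R) (r : seq nat) (F : nat -> R) (c : R) :
  (c <= \big[Num.min/x]_(i <- r) F i) = (c <= x) && all (fun i => c <= F i) r.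
Proof.
elim: r => [|i r IH]; first by rewrite big_nil andbT.
by rewrite big_cons le_min IH /= andbCA.
Qed.

Definition stay_event : set T :=
  [set w | centered_walk X u n w = v /\ 0 <= centered_walk_min X u w].

Lemma measurable_walk k : measurable_fun [set: T] (centered_walk X u k).
Proof.
apply: measurable_funD => //; elim: (index_enum _) => [|i r IH].
  under eq_fun => w do rewrite big_nil.
  exact: measurable_cst.
under eq_fun => w do rewrite big_cons.
case: (i < k)%N => //.
apply: measurable_funD => //; apply: measurable_funB => //.
exact: (measurable_RV_comp (X i) (fun z => z%:~R)).
Qed.

Lemma measurable_walk_min : measurable_fun [set: T] (centered_walk_min X u).
Proof.
rewrite /centered_walk_min; elim: (index_iota 1 n.+1) => [|i r IH].
  under eq_fun => w do rewrite big_nil; exact: measurable_walk.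
under eq_fun => w do rewrite big_cons.
by apply: measurable_minr => //; exact: measurable_walk.
Qed.

Lemma measurable_stay_event : measurable stay_event.
Proof.
have -> : stay_event = (centered_walk X u n @^-1` [set v]) `&`
    (centered_walk_min X u @^-1` `[0, +oo[).
  apply/seteqP; split => w /=; rewrite in_itv /= andbT //.
apply: measurableI.
  by rewrite -[X in measurable X]setTI; apply: measurable_walk.
by rewrite -[X in measurable X]setTI; apply: measurable_walk_min.
Qed.

(** The fibers of [X i] over distinct values are disjoint. *)
Lemma sum_fibers_le (A : set T) i (ks : seq int) : measurable A -> uniq ks ->
  (\sum_(k <- ks) P (A `&` (X i @^-1` [set k])) <= P A)%E.
Proof.
elim: ks A => [|k ks IH] A mA /=; first by rewrite big_nil.
move=> /andP[kks uks]; rewrite big_cons.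
have mk := measurable_fiber (X i) k.
rewrite [leRHS](measureDI P mA mk) addeC leeD2r //.
apply: le_trans (IH _ (measurableD mA mk) uks).
rewrite !big_seq le_eqVlt; apply/orP; left; apply/eqP; apply: eq_bigr => k' k'ks.
congr (P _); apply/seteqP; split => w /=; last by move=> [[]].
move=> [Aw Xw]; split=> //; split=> // Xw'.
by move: kks; rewrite -Xw' Xw k'ks.
Qed.

Hypothesis indep : independent_RVs X.
Hypothesis n_gt0 : (0 < n)%N.
Variable L : nat.

Definition truncated_laws : seq (@law R) :=
  [seq truncated_law (X i) (mean (X i)) L | i <- enum 'I_n].

Definition path_mass (kap : 'I_n -> int) j : R :=
  \prod_(i < n | (i < j)%N) mass (X i) (kap i).

Definition path_pos (kap : 'I_n -> int) j : R :=
  u + \sum_(i < n | (i < j)%N) ((kap i)%:~R - mean (X i)).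

(** Prescribing steps one at a time turns the recursion of [walk] into a
    decomposition of [stay_event]. *)
Definition path_event (kap : 'I_n -> int) j : set T :=
  stay_event `&` [set w | forall i : 'I_n, (i < j)%N -> X i w = kap i].

Lemma measurable_path_event kap j : measurable (path_event kap j).
Proof.
apply: measurableI; first exact: measurable_stay_event.
have -> : [set w | forall i : 'I_n, (i < j)%N -> X i w = kap i] =
    \bigcap_(i in [set i : 'I_n | (i < j)%N]) (X i @^-1` [set kap i]).
  by apply/seteqP; split => w h i /h.
apply: fin_bigcap_measurable => [|i _]; last exact: measurable_fiber.
exact: finite_finset.
Qed.

Lemma walk_along_path kap j w : (forall i : 'I_n, (i < j)%N -> X i w = kap i) ->
  centered_walk X u j w = path_pos kap j.
Proof.
by move=> h; congr (_ + _); apply: eq_bigr => i /h; rewrite /centered /mean => ->.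
Qed.

Lemma path_full_mass kap :
  P [set w | forall i : 'I_n, X i w = kap i] = (path_mass kap n)%:E.
Proof.
have -> : [set w | forall i : 'I_n, X i w = kap i] =
   \bigcap_(i in [set` [set: 'I_n]%SET]) (X i @^-1` [set kap i]).
  by apply/seteqP; split => [w h i _ //|w h i]; apply: h; rewrite /= inE.
rewrite indep // /path_mass -prodEFin.
by apply: eq_big => i; rewrite ?inE ?ltn_ord // => _; rewrite massE.
Qed.

(** Induction on the number [m] of steps still free: the next step splits the
    event into disjoint fibers, of which the truncated law keeps those over
    the window. When all steps are prescribed, independence gives the mass of
    the path. *)
Lemma walk_le_path_event m j kap : (j + m)%N = n ->
  (forall k, (0 < k <= j)%N -> 0 <= path_pos kap k) ->
  ((path_mass kap j * walk pos (drop j truncated_laws) (delta v) (path_pos kap j))%:E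
    <= P (path_event kap j))%E.
Proof.
elim: m j kap => [|m IH] j kap.
  rewrite addn0 => -> hpos.
  rewrite drop_oversize /=; last by rewrite size_map size_enum_ord.
  rewrite /delta; case: eqP => [uv|_]; last by rewrite mulr0 measure_ge0.
  rewrite mulr1 -path_full_mass le_measure ?inE //.
  - have -> : [set w | forall i : 'I_n, X i w = kap i] =
        [set w | forall i : 'I_n, (i < n)%N -> X i w = kap i].
      by apply/seteqP; split => w h i //; exact: h.
    have -> : [set w | forall i : 'I_n, (i < n)%N -> X i w = kap i] =
       \bigcap_(i in [set i : 'I_n | (i < n)%N]) (X i @^-1` [set kap i]).
      by apply/seteqP; split => w h i /h.
    apply: fin_bigcap_measurable => [|i _]; last exact: measurable_fiber.
    exact: finite_finset.
  - exact: measurable_path_event.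
  move=> w h; split=> //; split.
    by rewrite (walk_along_path (kap := kap)).
  rewrite /centered_walk_min le_bigmin_seq (walk_along_path (kap := kap)) //.
  rewrite hpos ?n_gt0 ?leqnn //=; apply/allP => k; rewrite mem_index_iota => kn.
  by rewrite (walk_along_path (kap := kap)) // hpos.
rewrite addnS -addSn => jm hpos.
have jn : (j < n)%N by rewrite -jm; lia.
pose i0 := Ordinal jn.
have dropE : drop j truncated_laws =
    truncated_law (X i0) (mean (X i0)) L :: drop j.+1 truncated_laws.
  rewrite (drop_nth (truncated_law (X i0) (mean (X i0)) L)); last first.
    by rewrite size_map size_enum_ord.
  congr cons; rewrite (nth_map i0); last by rewrite size_enum_ord.
  by have -> : nth i0 (enum 'I_n) j = i0 by exact: (nth_ord_enum i0 i0).
rewrite dropE /= step_truncated big_distrr /=.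
apply: le_trans (sum_fibers_le i0 (measurable_path_event kap j) (window_uniq L)).
rewrite -sumEFin; apply: lee_sum => k _.
pose kap' i := if i == i0 then k else kap i.
have lt_i0 (i : 'I_n) : (i < j)%N -> (i == i0) = false.
  by move=> ij; apply/eqP => ii; move: ij; rewrite ii /= ltnn.
have massE' : path_mass kap' j.+1 = path_mass kap j * mass (X i0) k.
  rewrite /path_mass (bigD1 i0) //= mulrC; congr (_ * _); last by rewrite /kap' eqxx.
  apply: eq_big => i; first by rewrite ltnS leq_eqVlt -val_eqE /=; case: ltngtP.
  by move=> /andP[_ /negbTE ii]; rewrite /kap' ii.
have posE l : (l <= j)%N -> path_pos kap' l = path_pos kap l.
  move=> lj; congr (_ + _); apply: eq_bigr => i il.
  by rewrite /kap' lt_i0 // (leq_trans il).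
have posE' : path_pos kap' j.+1 = path_pos kap j + (k%:~R - mean (X i0)).
  rewrite -(posE j) // /path_pos -addrA; congr (_ + _).
  rewrite (bigD1 i0) //= addrC; congr (_ + _); last by rewrite /kap' eqxx.
  by apply: eq_bigl => i; rewrite ltnS leq_eqVlt -val_eqE /=; case: ltngtP.
have eventE : path_event kap' j.+1 =
    path_event kap j `&` (X i0 @^-1` [set k]).
  apply/seteqP; split => w /=.
    move=> [gw hw]; split; last by have := hw i0 (ltnSn j); rewrite /kap' eqxx.
    split=> // i ij; have := hw i (ltnW ij); by rewrite /kap' lt_i0.
  move=> [[gw hw] hk]; split=> // i; rewrite ltnS leq_eqVlt /kap' -val_eqE /=.
  by case: eqP => [ii _|_ /= /hw //]; have -> : i = i0 by exact: val_inj.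
rewrite -eventE; have [xk|xk] := boolP (pos (path_pos kap j + (k%:~R - mean (X i0)))).
  rewrite mul1r mulrA -massE' -posE'; apply: IH => // l /andP[l0].
  rewrite leq_eqVlt => /predU1P[->|lj]; first by rewrite posE'.
  by rewrite posE // hpos // l0.
by rewrite mul0r !mulr0 measure_ge0.
Qed.

Lemma walk_le_probability :
  ((walk pos truncated_laws (delta v) u)%:E <= P stay_event)%E.
Proof.
have := @walk_le_path_event n 0 (fun=> 0) (add0n n).
have -> : path_mass (fun=> 0) 0 = 1 by rewrite /path_mass big_pred0.
have -> : path_pos (fun=> 0) 0 = u by rewrite /path_pos big_pred0 ?addr0.
rewrite mul1r drop0 => h; apply: le_trans (h _) _; first by move=> k /andP[]; lia.
apply: le_measure; rewrite ?inE //; first exact: measurable_path_event.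
  exact: measurable_stay_event.
by move=> w [].
Qed.

End PathProbability.

(** * Conclusion *)

Lemma sqrt_le_powR (R : realType) (n : nat) (alpha : R) : 1 / 2 < alpha ->
  (0 < n)%N -> Num.sqrt n%:R <= n%:R `^ alpha.
Proof.
move=> al n0; rewrite -powR12_sqrt // ler_powR ?ler1n //; lra.
Qed.

Lemma powR_three_halves (R : realType) (n : nat) :
  n%:R `^ (3 / 2) = Num.sqrt n%:R ^+ 3 :> R.
Proof.
rewrite (_ : 3 / 2 = 2^-1 * 3%:R :> R); last by field.
by rewrite powRrM powR12_sqrt // powR_mulrn ?sqrtr_ge0.
Qed.

(** As [alpha < 1], the distance [n `^ alpha] between the end points is
    negligible with respect to [n], so the tube is as wide as desired. *)
Lemma horizon (R : realType) (A : R) (W K e alpha : R) : 0 <= W -> 0 <= K -> 0 < e ->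
  1 / 2 < alpha < 1 ->
  exists n0 : nat, forall n : nat, (n0 <= n)%N ->
    [/\ (64 <= n)%N, A <= Num.sqrt n%:R &
      W * (Num.sqrt n%:R + K * (n%:R `^ alpha + 6 * Num.sqrt n%:R)) <= e * n%:R].
Proof.
move=> W0 K0 e0 /andP[al1 al2].
pose G := 1 + W * (1 + 7 * K) / e.
have WK0 : 0 <= W * (1 + 7 * K) by rewrite mulr_ge0 // addr_ge0 // mulr_ge0.
have G1 : 0 < G by rewrite /G ltr_wpDr // divr_ge0 // ltW.
pose B := G `^ (1 / (1 - alpha)).
have B0 : 0 <= B by exact: powR_ge0.
have al3 : 0 < 1 - alpha by lra.
exists (64 + (Num.truncn (A ^+ 2)).+1 + (Num.truncn B).+1)%N => n hn.
have n64 : (64 <= n)%N by apply: leq_trans hn; rewrite -addnA leq_addr.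
have n_gt0 : (0 < n)%N by apply: leq_trans n64.
have nA : A ^+ 2 <= n%:R.
  apply: (le_trans (ltW (truncnS_gt _))); rewrite ler_nat; apply: leq_trans hn.
  by rewrite addnAC leq_addl.
have nB : B <= n%:R.
  apply: (le_trans (ltW (truncnS_gt _))); rewrite ler_nat; apply: leq_trans hn.
  by rewrite leq_addl.
split=> //.
  apply: (le_trans (ler_norm A)); rewrite -sqrtr_sqr ler_sqrt //.
set r := Num.sqrt n%:R; set na := n%:R `^ alpha.
have rna : r <= na by exact: sqrt_le_powR.
have na0 : 0 <= na by exact: powR_ge0.
have r0 : 0 <= r by exact: sqrtr_ge0.
have nE : n%:R = na * n%:R `^ (1 - alpha) :> R.
  rewrite -powRD; first by rewrite addrC subrK powRr1.
  by apply/implyP => _; rewrite pnatr_eq0 -lt0n.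
have nG : G <= n%:R `^ (1 - alpha).
  have -> : G = B `^ (1 - alpha).
    rewrite /B -powRrM divfK ?gt_eqF // powRr1 //; exact: ltW.
  by apply: ge0_ler_powR; rewrite ?nnegrE // ltW.
apply: (@le_trans _ _ (W * (1 + 7 * K) * na)).
  rewrite -mulrA ler_wpM2l //.
  have := ler_wpM2l K0 rna; lra.
have WG : W * (1 + 7 * K) <= e * G.
  have -> : e * G = e + W * (1 + 7 * K) by rewrite /G; field; rewrite gt_eqF.
  by rewrite lerDr ltW.
apply: (@le_trans _ _ (e * G * na)); first by rewrite ler_wpM2r.
rewrite -mulrA ler_pM2l // nE mulrC; exact: ler_wpM2l.
Qed.

Theorem lemma6p1 (R : realType) (c0 delta0 : R) (hc0 : 0 < c0)
    (hdelta0 : 0 < delta0) (a : int -> R) (ha01 : forall i, 0 <= a i <= 1)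
    (ha : irreducible_aperiodic_seq a)
    (alpha : R) (halpha : 1 / 2 < alpha < 2 / 3) :
  exists (C c : R) (n0 : nat), [/\ 0 < C, 0 < c, (1 <= n0)%N &
    forall n : nat, (n0 <= n)%N ->
    forall (d : measure_display) (T : measurableType d) (P : probability T R)
      (X : 'I_n -> {RV P >-> int}),
      independent_RVs X ->
      (forall i, law_class delta0 c0 a (distribution P (X i))) ->
    forall u v : R,
      0 <= u <= n%:R `^ alpha -> 0 <= v <= n%:R `^ alpha ->
      (0 < P [set w | centered_walk X u n w = v])%E ->
      ((C * Num.min (u + 1) (Num.sqrt n%:R) * Num.min (v + 1) (Num.sqrt n%:R)
          / n%:R `^ (3 / 2) * expR (- c * (u - v) ^+ 2 / n%:R))%R%:E
        <= P [set w | centered_walk X u n w = v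
                      /\ (0 <= centered_walk_min X u w)%R])%E].
Proof.
have a0 i : 0 <= a i by case/andP: (ha01 i).
have [N0 [eps [sig [L1 [N0_gt0 eps01 sig0 paths [k1 [k2 [k12 k1L k2L ak1 ak2]]]]]]]] :=
  seq_paths a0 ha.
pose s1 := sig / 4; pose s2 := class_var delta0 c0; pose c3 := class_third delta0 c0.
have s1_gt0 : 0 < s1 by rewrite divr_gt0.
have M0 : 0 < moment3 delta0 c0 by exact: moment3_gt0.
have b0 : 0 < mean_bound delta0 c0 by rewrite /mean_bound ltr_wpDr // ltW.
have s2_ge0 : 0 <= s2.
  by rewrite /s2 /class_var addr_ge0 // mulr_ge0 ?exprn_ge0 // ltW.
have c3_gt0 : 0 < c3.
  by rewrite /c3 /class_third addr_gt0 // mulr_gt0 ?exprn_gt0.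
have al12 : 1 / 2 < alpha < 1 by case/andP: halpha => ? ?; apply/andP; split=> //; lra.
have h0 : 0 < height s1 by exact: height_gt0.
have sp0 : 0 < spread s1 s2 eps N0 by exact: spread_gt0.
have ap0 : 0 < aperture s1 s2 eps N0 by exact: aperture_gt0.
have mw0 : 0 <= min_width s1 s2 c3 eps N0 by exact: min_width_ge0.
have [n0 hn0] := @horizon R (entrance_scale s1 c3 / (2 * height s1)) _ _ _ _ mw0 (ltW sp0) ap0 al12.
have K0 : 0 <= gauss_rate s1 s2 c3 eps N0 by exact: gauss_rate_ge0.
exists (core_cst s1 s2 c3 eps N0), (4 * gauss_rate s1 s2 c3 eps N0 + 1), n0.+1; split => //.
- exact: core_cst_gt0.
- by rewrite ltr_wpDl // mulr_ge0.
move=> n n0n d T P X indep Xclass u v /andP[u0 un] /andP[v0 vn] Puv.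
have [n64 nA nW] := hn0 n (ltnW n0n).
have n_gt0 : (0 < n)%N by apply: leq_trans n64.
have nR : 0 < n%:R :> R by rewrite ltr0n.
pose r : R := Num.sqrt n%:R.
have r0 : 0 < r by rewrite sqrtr_gt0.
have rr : r ^+ 2 = n%:R by rewrite sqr_sqrtr // ltW.
pose eta : R := (n%:R ^+ 2)^-1.
have eta0 : 0 < eta by rewrite invr_gt0 exprn_gt0.
have etan : eta * n%:R ^+ 2 <= 1 by rewrite mulVf // gt_eqF // exprn_gt0.
have scale : entrance_scale s1 c3 <= 2 * height s1 * r.
  by rewrite mulrC -ler_pdivrMr // mulr_gt0.
(* a truncation level suitable for all steps at once *)
have hL i : exists L0, forall L, (L0 <= L)%N ->
    regular s1 s2 c3 eta (truncated_law (X i) (mean (X i)) L).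
  exact: (regular_truncated hdelta0 hc0 (Xclass i) k12 k1L k2L ak1 ak2 sig0 eta0).
have [Lf hLf] := choice hL.
pose L := maxn L1 (\max_i Lf i).
pose Q (l : @law R) := regular s1 s2 c3 eta l /\ forall k f, (`|k| <= L1)%N ->
  (forall x, 0 <= f x) -> a k * f (k%:~R - l.1) <= step l f.
have gQ : admissible s1 s2 c3 eps N0 eta Q.
  split=> [l []//|t tN ht]; apply: (@minorized_paths _ a eps L1) => //.
  - by move=> l /ht[[]].
  - by move=> l /ht[].
  - by move=> j hj; exact: paths.
have hs l : l \in truncated_laws X L -> Q l.
  move=> /mapP[i _ ->]; split.
    by apply: hLf; rewrite leq_max leq_bigmax orbT.
  move=> k f kL f0; have L1L : (L1 <= L)%N by exact: leq_maxl.
  exact: (step_dominates (Xclass i) L1L kL f0).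
have sz : size (truncated_laws X L) = n by rewrite size_map size_enum_ord.
(* a realisation of the terminal value shows that it lies on the lattice *)
have lattice : v - u + drift (truncated_laws X L) \is a Num.int.
  have /set0P[w /= hw] : [set w | centered_walk X u n w = v] != set0.
    by apply/eqP => e; move: Puv; rewrite e measure0 ltxx.
  have -> : v - u + drift (truncated_laws X L) = \sum_(i < n) (X i w)%:~R.
    rewrite -hw /centered_walk /drift big_map big_enum /=.
    rewrite [X in X + _]addrAC subrr add0r.
    rewrite (eq_bigl xpredT) => [|i]; last by rewrite ltn_ord.
    rewrite -big_split /=; apply: eq_bigr => i _.
    by rewrite /centered /mean /= subrK.
  by apply: rpred_sum => i _; exact: intr_int.
have D : `|u - v| <= n%:R `^ alpha.
  rewrite ler_norml; apply/andP; split.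
    by rewrite -opprB lerN2; apply: le_trans vn; rewrite gerBl.
  by apply: le_trans un; rewrite gerBl.
have hW : min_width s1 s2 c3 eps N0 * (r + spread s1 s2 eps N0 * (`|u - v| + 6 * r))
    <= aperture s1 s2 eps N0 * n%:R.
  apply: le_trans nW; rewrite ler_wpM2l // lerD2l ler_wpM2l ?(ltW sp0) //.
  by rewrite lerD2r.
have := walk_core s1_gt0 s2_ge0 c3_gt0 eps01 N0_gt0 n64 (ltW eta0) etan scale gQ hs sz
  u0 v0 lattice hW.
rewrite -/r => core.
apply: le_trans (walk_le_probability u v indep n_gt0 L).
rewrite lee_fin; apply: le_trans core.
rewrite powR_three_halves -/r /damp.
have C0 : 0 < core_cst s1 s2 c3 eps N0 by exact: core_cst_gt0.
set C := core_cst _ _ _ _ _ in C0 *; set K := gauss_rate _ _ _ _ _ in K0 *.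
set mu := Num.min (u + 1) r; set mv := Num.min (v + 1) r.
have mu0 : 0 <= mu by rewrite le_min (ltW r0) addr_ge0.
have mv0 : 0 <= mv by rewrite le_min (ltW r0) addr_ge0.
have -> : C / r * (mu / r) * (mv / r) = C * mu * mv / r ^+ 3.
  by field; rewrite gt_eqF.
apply: ler_wpM2l.
  rewrite divr_ge0 ?exprn_ge0 ?(ltW r0) //; apply: mulr_ge0 => //.
  by apply: mulr_ge0 => //; exact: ltW.
rewrite ler_expR -mulrA mulNr lerN2 ler_wpM2r //; last by rewrite lerDl.
by rewrite divr_ge0 ?sqr_ge0 // ltW.
Qed.
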